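(* The critical points of the weighted total twist functional $\widetilde{\mathrm{Tw}}:\mathcal{M}\to\mathbb{R}$ are exactly the equivalence classes $\llbracket\gamma,V\rrbracket$ such that $\gamma$ is an arclength-parameterized, length-2, multiply covered round circle and $V$ has constant twist rate. In complex coordinates, the critical points are represented by symmetric torus knots on the Clifford torus in $\mathbb{S}^3\subset\mathbb{C}^2$.
   Context: Let $S^1=[0,2]/(0\sim2)$, $\mathbb{S}^1\subset\mathbb{C}$ the unit circle group. A framed loop is a pair $(\gamma,V)$ of smooth maps $S^1\to\mathbb{R}^3$ with $\gamma$ an immersion and $V$ a unit field normal to $\gamma'$. $\mathcal{M}$ is the Fréchet manifold of framed loops modulo translations, rotations $(A\gamma,AV)$, scalings $(r\gamma,V)$, and constant frame twists $(\gamma,\cos(2\theta)V+\sin(2\theta)W)$, where $T=\gamma'/\|\gamma'\|$, $W=T\times V$. Elements are written $\llbracket\gamma,V\rrbracket$ with $\gamma$ normalized to have length $2$ (not necessarily based at the origin). The twist rate is $\mathrm{tw}(\gamma,V)=\langle\frac{d}{ds}V,W\rangle$, with $\frac{d}{ds}=\frac{1}{\|\gamma'\|}\frac{d}{dt}$ and $\mathrm{d}s=\|\gamma'\|\mathrm{d}t$, and the weighted total twist is $\widetilde{\mathrm{Tw}}(\llbracket\gamma,V\rrbracket)=\frac1{2\pi}\int_{S^1}\mathrm{tw}(\gamma,V)\,\|\gamma'\|\,\mathrm{d}s$ (computed with the length-2 representative). ''Multiply covered'' means $h$-times covered for some integer $h\ge1$. Complex coordinates: identify $\mathbb{C}^2$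 with the quaternions by $(z,w)\leftrightarrow q=z+w\mathbf{j}$ and $\mathrm{span}_{\mathbb{R}}\{\mathbf{i},\mathbf{j},\mathbf{k}\}$ with $\mathbb{R}^3$. A path $\Phi=(\phi,\psi):[0,2]\to\mathbb{C}^2\setminus\{\vec0\}$, identified with $q(t)$, represents the framed path $(\gamma,V)$ with $\gamma'=\bar q\mathbf{i}q$, $V=\bar q\mathbf{j}q/|q|^2$. For $\mathcal{V}$ the space of smooth loops $S^1\to\mathbb{C}$, or of smoothly antiperiodic paths $[0,2]\to\mathbb{C}$ (all derivatives at $2$ are minus those at $0$), this correspondence induces a diffeomorphism from the disjoint union, over the two choices of $\mathcal{V}$, of the spaces of $L^2$-orthonormal pairs $(\phi,\psi)\in\mathcal{V}^2$ without simultaneous zeros, modulo $\mathrm{U}(2)$ acting by right multiplication, onto $\mathcal{M}$. The Clifford torus is $\{|z|=|w|=1/\sqrt2\}\subset\mathbb{S}^3$. Symmetric torus knots are the curves $$\Phi_{h,k}(t)=\tfrac1{\sqrt2}\Big(\exp\big(\tfrac i2(k+h)\pi t\big),\exp\big(\tfrac i2(k-h)\pi t\big)\Big),\qquad h\ge1,\ k\in\mathbb{Z}.$$ *)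

(* Defs.v *)
From Stdlib Require Import Reals ZArith Lra Psatz.
From Stdlib Require Import FunctionalExtensionality PropExtensionality ProofIrrelevance.
From Stdlib Require Import IndefiniteDescription.
From Coquelicot Require Import Coquelicot.
Open Scope R_scope.

(** * Vectors of R^3 *)

Definition vec3 := (R * R * R)%type.

Definition vx (v : vec3) : R := fst (fst v).
Definition vy (v : vec3) : R := snd (fst v).
Definition vz (v : vec3) : R := snd v.

Definition vzero : vec3 := (0, 0, 0).
Definition vadd (u v : vec3) : vec3 := (vx u + vx v, vy u + vy v, vz u + vz v).
Definition vscal (r : R) (v : vec3) : vec3 := (r * vx v, r * vy v, r * vz v).
Definition dot (u v : vec3) : R := vx u * vx v + vy u * vy v + vz u * vz v.
Definition cross (u v : vec3) : vec3 :=
  (vy u * vz v - vz u * vy v, vz u * vx v - vx u * vz v, vx u * vy v - vy u * vx v).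
Definition vnorm (v : vec3) : R := sqrt (dot v v).

(** 3x3 real matrices, as triples of rows. *)
Definition mat3 := (vec3 * vec3 * vec3)%type.
Definition row1 (A : mat3) : vec3 := fst (fst A).
Definition row2 (A : mat3) : vec3 := snd (fst A).
Definition row3 (A : mat3) : vec3 := snd A.
Definition mapply (A : mat3) (v : vec3) : vec3 :=
  (dot (row1 A) v, dot (row2 A) v, dot (row3 A) v).
Definition det3 (A : mat3) : R := dot (row1 A) (cross (row2 A) (row3 A)).

Definition SO3 (A : mat3) : Prop :=
  dot (row1 A) (row1 A) = 1 /\ dot (row2 A) (row2 A) = 1 /\ dot (row3 A) (row3 A) = 1 /\
  dot (row1 A) (row2 A) = 0 /\ dot (row1 A) (row3 A) = 0 /\ dot (row2 A) (row3 A) = 0 /\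
  det3 A = 1.

(** * Smooth maps *)

Definition smooth (f : R -> R) : Prop := forall n t, ex_derive_n f n t.

Definition vsmooth (f : R -> vec3) : Prop :=
  smooth (fun t => vx (f t)) /\ smooth (fun t => vy (f t)) /\ smooth (fun t => vz (f t)).

Definition vderiv (f : R -> vec3) (t : R) : vec3 :=
  (Derive (fun s => vx (f s)) t, Derive (fun s => vy (f s)) t, Derive (fun s => vz (f s)) t).

(** * Framed loops

    A map on [S^1 = [0,2]/(0~2)] is a [2]-periodic map on [R]. *)

Definition periodic2 {T : Type} (f : R -> T) : Prop := forall t, f (t + 2) = f t.

Record framed_loop := FramedLoop {
  curve : R -> vec3;
  frame : R -> vec3;
  curve_smooth : vsmooth curve;
  frame_smooth : vsmooth frame;
  curve_periodic : periodic2 curve;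
  frame_periodic : periodic2 frame;
  curve_immersion : forall t, vderiv curve t <> vzero;
  frame_unit : forall t, dot (frame t) (frame t) = 1;
  frame_normal : forall t, dot (frame t) (vderiv curve t) = 0
}.

Definition speed (g : R -> vec3) (t : R) : R := vnorm (vderiv g t).
Definition tangent (g : R -> vec3) (t : R) : vec3 := vscal (/ speed g t) (vderiv g t).
Definition conormal (g V : R -> vec3) (t : R) : vec3 := cross (tangent g t) (V t).
Definition length (g : R -> vec3) : R := RInt (speed g) 0 2.

Definition twist_rate (g V : R -> vec3) (t : R) : R :=
  dot (vscal (/ speed g t) (vderiv V t)) (conormal g V t).

(** The two factors [speed g t] are the weight [|g'|] and the density of [ds]. *)
Definition weighted_total_twist (g V : R -> vec3) : R :=
  1 / (2 * PI) * RInt (fun t => twist_rate g V t * speed g t * speed g t) 0 2.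

(** * The moduli space of framed loops

    [framed_equiv x y]: [y] lies in the orbit of [x] under translations, rotations,
    scalings and constant frame twists. *)

Definition framed_equiv (x y : framed_loop) : Prop :=
  exists (A : mat3) (r : R) (c : vec3) (theta : R),
    SO3 A /\ 0 < r /\
    forall t,
      curve y t = vadd (vscal r (mapply A (curve x t))) c /\
      frame y t =
        mapply A (vadd (vscal (cos (2 * theta)) (frame x t))
                       (vscal (sin (2 * theta)) (conormal (curve x) (frame x) t))).

Definition M : Type := {C : framed_loop -> Prop | exists x, C = framed_equiv x}.

Definition class (x : framed_loop) : M :=
  exist _ (framed_equiv x) (ex_intro _ x eq_refl).

Definition repr (m : M) : framed_loop :=
  proj1_sig (constructive_indefinite_description _ (proj2_sig m)).

Definition normalize (g : R -> vec3) : R -> vec3 :=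
  fun t => vscal (2 / length g) (g t).

(** Independent of the representative chosen by [repr]: see [Tw_class] below. *)
Definition Tw (m : M) : R :=
  weighted_total_twist (normalize (curve (repr m))) (frame (repr m)).

(** * Critical points

    Smooth curves [e |-> (g_e, V_e)] in the Frechet manifold of framed loops are the
    families that are jointly C^infinity in [(e, t)], and smooth curves in the quotient [M]
    are those that lift locally to such families.  A critical point of [F] is a point where
    the derivative of [F] vanishes in the direction of every smooth curve. *)

Definition jointly_smooth_near (e0 d : R) (f : R -> R -> R) : Prop :=
  forall n e t, Rabs (e - e0) < d -> ex_diff_n f n e t.

Definition vjointly_smooth_near (e0 d : R) (f : R -> R -> vec3) : Prop :=
  jointly_smooth_near e0 d (fun e t => vx (f e t)) /\
  jointly_smooth_near e0 d (fun e t => vy (f e t)) /\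
  jointly_smooth_near e0 d (fun e t => vz (f e t)).

Definition smooth_curve_near (e0 : R) (c : R -> M) : Prop :=
  exists (d : R) (x : R -> framed_loop),
    0 < d /\
    vjointly_smooth_near e0 d (fun e t => curve (x e) t) /\
    vjointly_smooth_near e0 d (fun e t => frame (x e) t) /\
    forall e, Rabs (e - e0) < d -> c e = class (x e).

Definition critical_point (F : M -> R) (m : M) : Prop :=
  forall c : R -> M,
    smooth_curve_near 0 c -> c 0 = m -> is_derive (fun e => F (c e)) 0 0.

(** * Multiply covered circles *)

Definition arclength_parameterized (g : R -> vec3) : Prop := forall t, speed g t = 1.

(** [a] is an angular coordinate along the circle of centre [p] and radius [r] in the plane
    spanned by the orthonormal pair [u], [v]; it turns [h] times over a period. *)
Definition covers_round_circle (h : nat) (g : R -> vec3) : Prop :=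
  exists (p : vec3) (r : R) (u v : vec3) (a : R -> R),
    0 < r /\ dot u u = 1 /\ dot v v = 1 /\ dot u v = 0 /\
    smooth a /\ (forall t, 0 < Derive a t) /\
    (forall t, a (t + 2) = a t + INR h * (2 * PI)) /\
    forall t, g t = vadd p (vscal r (vadd (vscal (cos (a t)) u) (vscal (sin (a t)) v))).

Definition multiply_covered_round_circle (g : R -> vec3) : Prop :=
  exists h : nat, (1 <= h)%nat /\ covers_round_circle h g.

Definition constant_twist_rate (g V : R -> vec3) : Prop :=
  exists k : R, forall t, twist_rate g V t = k.

(** * Complex coordinates

    The pair [(z, w)] of [C * C] is the quaternion [z + w j]. *)

Definition quat := (C * C)%type.
Definition qi : quat := (Ci, RtoC 0).
Definition qj : quat := (RtoC 0, RtoC 1).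
Definition qconj (q : quat) : quat := (Cconj (fst q), Copp (snd q)).

(** Uses [j w = conj w * j] and [j^2 = -1]. *)
Definition qmul (p q : quat) : quat :=
  (Cminus (Cmult (fst p) (fst q)) (Cmult (snd p) (Cconj (snd q))),
   Cplus (Cmult (fst p) (snd q)) (Cmult (snd p) (Cconj (fst q)))).

Definition qnorm2 (q : quat) : R := Cmod (fst q) ^ 2 + Cmod (snd q) ^ 2.

(** The coordinates of the imaginary part along [i, j, k]. *)
Definition qim (q : quat) : vec3 := (Im (fst q), Re (snd q), Im (snd q)).

Definition Csmooth (f : R -> C) : Prop :=
  smooth (fun t => Re (f t)) /\ smooth (fun t => Im (f t)).

(** A smoothly antiperiodic path on [[0,2]] is the restriction of a smooth map on [R] that
    changes sign under translation by [2]. *)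
Definition antiperiodic2 (f : R -> C) : Prop := forall t, f (t + 2) = Copp (f t).

Definition l2_inner (f g : R -> C) : C :=
  (RInt (fun t => Re (Cmult (f t) (Cconj (g t)))) 0 2,
   RInt (fun t => Im (Cmult (f t) (Cconj (g t)))) 0 2).

Definition complex_coordinates (phi psi : R -> C) : Prop :=
  Csmooth phi /\ Csmooth psi /\
  ((periodic2 phi /\ periodic2 psi) \/ (antiperiodic2 phi /\ antiperiodic2 psi)) /\
  (forall t, ~ (phi t = RtoC 0 /\ psi t = RtoC 0)) /\
  l2_inner phi phi = RtoC 1 /\ l2_inner psi psi = RtoC 1 /\ l2_inner phi psi = RtoC 0.

(** [x] is the framed loop of the path [Phi], up to a translation. *)
Definition framed_loop_of_path (Phi : R -> quat) (x : framed_loop) : Prop :=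
  forall t,
    vderiv (curve x) t = qim (qmul (qmul (qconj (Phi t)) qi) (Phi t)) /\
    frame x t =
      vscal (/ qnorm2 (Phi t)) (qim (qmul (qmul (qconj (Phi t)) qj) (Phi t))).

Definition represents (Phi : R -> quat) (m : M) : Prop :=
  complex_coordinates (fun t => fst (Phi t)) (fun t => snd (Phi t)) /\
  exists x : framed_loop, framed_loop_of_path Phi x /\ class x = m.

Definition expi (a : R) : C := (cos a, sin a).

Definition torus_knot (h : nat) (k : Z) (t : R) : quat :=
  (Cmult (RtoC (/ sqrt 2)) (expi (/ 2 * (IZR k + INR h) * PI * t)),
   Cmult (RtoC (/ sqrt 2)) (expi (/ 2 * (IZR k - INR h) * PI * t))).

Definition clifford_torus (q : quat) : Prop :=
  Cmod (fst q) = / sqrt 2 /\ Cmod (snd q) = / sqrt 2.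

(** * The quotient and the functional are well defined *)

Definition mtrans (A : mat3) : mat3 :=
  ((vx (row1 A), vx (row2 A), vx (row3 A)),
   (vy (row1 A), vy (row2 A), vy (row3 A)),
   (vz (row1 A), vz (row2 A), vz (row3 A))).

Definition mid : mat3 := ((1, 0, 0), (0, 1, 0), (0, 0, 1)).

Definition mmul (A B : mat3) : mat3 :=
  (mapply (mtrans B) (row1 A), mapply (mtrans B) (row2 A), mapply (mtrans B) (row3 A)).

Ltac vunf :=
  unfold mmul, mid, mtrans, det3, mapply, row1, row2, row3, vadd, vscal, cross, dot,
    vx, vy, vz in *; simpl in *.

Lemma vec3_eq (u v : vec3) : vx u = vx v -> vy u = vy v -> vz u = vz v -> u = v.
Proof.
  destruct u as [[a b] c], v as [[a' b'] c']; vunf; intros; subst; reflexivity.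
Qed.

Ltac vring := apply vec3_eq; vunf; ring.

Lemma sumsq0 (a b c : R) : a * a + b * b + c * c = 0 -> a = 0 /\ b = 0 /\ c = 0.
Proof. intros; repeat split; nra. Qed.

Lemma cross_of_orthonormal (a b c : vec3) :
  dot a a = 1 -> dot b b = 1 -> dot c c = 1 -> dot a b = 0 ->
  dot a (cross b c) = 1 -> c = cross a b.
Proof.
  intros Ha Hb Hc Hab Hd.
  set (w := vadd c (vscal (-1) (cross a b))).
  assert (Hw : dot w w = 0).
  { transitivity (dot c c - 2 * dot a (cross b c)
                  + (dot a a * dot b b - dot a b * dot a b)).
    - unfold w; destruct a as [[a1 a2] a3], b as [[b1 b2] b3], c as [[c1 c2] c3].
      vunf; ring.
    - rewrite Ha, Hb, Hc, Hab, Hd; ring. }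
  destruct (sumsq0 (vx w) (vy w) (vz w)) as [H1 [H2 H3]]; [exact Hw|].
  unfold w in *; apply vec3_eq; destruct a as [[a1 a2] a3], b as [[b1 b2] b3],
    c as [[c1 c2] c3]; vunf; lra.
Qed.

Lemma SO3_cross (A : mat3) : SO3 A ->
  row3 A = cross (row1 A) (row2 A) /\ row1 A = cross (row2 A) (row3 A) /\
  row2 A = cross (row3 A) (row1 A).
Proof.
  destruct A as [[a b] c]; unfold SO3, det3, row1, row2, row3; simpl.
  intros [Ha [Hb [Hc [Hab [Hac [Hbc Hd]]]]]].
  assert (sym : forall u v, dot u v = dot v u) by (intros; unfold dot; ring).
  assert (cyc : forall u v w, dot u (cross v w) = dot v (cross w u)).
  { intros [[? ?] ?] [[? ?] ?] [[? ?] ?]; vunf; ring. }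
  split; [|split]; apply cross_of_orthonormal; auto.
  - rewrite <- cyc; exact Hd.
  - rewrite sym; exact Hac.
  - rewrite cyc; exact Hd.
Qed.

Lemma mapply_lin (A : mat3) (s r : R) (u v : vec3) :
  mapply A (vadd (vscal s u) (vscal r v)) =
  vadd (vscal s (mapply A u)) (vscal r (mapply A v)).
Proof. destruct A as [[a b] c]; vring. Qed.

Lemma mapply_scal (A : mat3) (s : R) (u : vec3) :
  mapply A (vscal s u) = vscal s (mapply A u).
Proof. destruct A as [[a b] c]; vring. Qed.

Lemma mapply_mmul (A B : mat3) (v : vec3) : mapply (mmul A B) v = mapply A (mapply B v).
Proof. destruct A as [[a b] c], B as [[a' b'] c']; vring. Qed.

Lemma mapply_mid (v : vec3) : mapply mid v = v.
Proof. destruct v as [[a b] c]; vring. Qed.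

Lemma mtrans_mapply (A : mat3) (v : vec3) : SO3 A -> mapply (mtrans A) (mapply A v) = v.
Proof.
  intros HA; destruct (SO3_cross A HA) as [H3 [H1 H2]].
  assert (Hd : det3 A = 1) by apply HA.
  transitivity (vscal (det3 A) v); [|rewrite Hd; destruct v as [[? ?] ?]; vring].
  transitivity
    (vadd (vscal (dot (row1 A) v) (cross (row2 A) (row3 A)))
       (vadd (vscal (dot (row2 A) v) (cross (row3 A) (row1 A)))
             (vscal (dot (row3 A) v) (cross (row1 A) (row2 A))))).
  - rewrite <- H1, <- H2, <- H3; destruct A as [[a b] c]; vring.
  - clear; destruct A as [[[[? ?] ?] [[? ?] ?]] [[? ?] ?]], v as [[? ?] ?]; vring.
Qed.

Lemma dot_mtrans (A : mat3) (u v : vec3) :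
  dot (mapply A u) v = dot u (mapply (mtrans A) v).
Proof. destruct A as [[a b] c]; vunf; ring. Qed.

Lemma SO3_dot (A : mat3) (u v : vec3) : SO3 A -> dot (mapply A u) (mapply A v) = dot u v.
Proof. intros HA; rewrite dot_mtrans, mtrans_mapply; auto. Qed.

Lemma SO3_mapply_cross (A : mat3) (u v : vec3) :
  SO3 A -> cross (mapply A u) (mapply A v) = mapply A (cross u v).
Proof.
  intros HA; destruct (SO3_cross A HA) as [H3 [H1 H2]].
  transitivity (mapply ((cross (row2 A) (row3 A)), (cross (row3 A) (row1 A)),
                        (cross (row1 A) (row2 A))) (cross u v)).
  - clear; destruct A as [[a b] c]; vring.
  - rewrite <- H1, <- H2, <- H3; destruct A as [[a b] c]; reflexivity.
Qed.

Lemma SO3_of_columns (A : mat3) :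
  (forall u v, dot (mapply (mtrans A) u) (mapply (mtrans A) v) = dot u v) ->
  det3 A = 1 -> SO3 A.
Proof.
  intros H Hd; destruct A as [[a b] c].
  pose proof (H (1,0,0) (1,0,0)); pose proof (H (0,1,0) (0,1,0));
  pose proof (H (0,0,1) (0,0,1)); pose proof (H (1,0,0) (0,1,0));
  pose proof (H (1,0,0) (0,0,1)); pose proof (H (0,1,0) (0,0,1)); clear H.
  unfold SO3; vunf; repeat split; lra.
Qed.

Lemma mtrans_mtrans (A : mat3) : mtrans (mtrans A) = A.
Proof. destruct A as [[[[? ?] ?] [[? ?] ?]] [[? ?] ?]]; reflexivity. Qed.

Lemma SO3_mtrans (A : mat3) : SO3 A -> SO3 (mtrans A).
Proof.
  intros HA; apply SO3_of_columns.
  - rewrite mtrans_mtrans; intros; apply SO3_dot; exact HA.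
  - transitivity (det3 A); [|apply HA].
    clear; destruct A as [[a b] c]; vunf; ring.
Qed.

Lemma mapply_mtrans (A : mat3) (v : vec3) : SO3 A -> mapply A (mapply (mtrans A) v) = v.
Proof.
  intros HA; rewrite <- (mtrans_mtrans A) at 1; apply mtrans_mapply, SO3_mtrans, HA.
Qed.

Lemma SO3_mmul (A B : mat3) : SO3 A -> SO3 B -> SO3 (mmul A B).
Proof.
  intros HA HB; apply SO3_of_columns.
  - assert (E : mtrans (mmul A B) = mmul (mtrans B) (mtrans A)).
    { clear; destruct A as [[[[? ?] ?] [[? ?] ?]] [[? ?] ?]],
        B as [[[[? ?] ?] [[? ?] ?]] [[? ?] ?]]; vunf.
      repeat (f_equal; try ring). }
    intros u v; rewrite E, !mapply_mmul, !SO3_dot; auto using SO3_mtrans.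
  - transitivity (det3 A * det3 B).
    + clear; destruct A as [[a b] c], B as [[a' b'] c']; vunf; ring.
    + replace (det3 A) with 1 by (symmetry; apply HA).
      replace (det3 B) with 1 by (symmetry; apply HB); ring.
Qed.

Lemma SO3_mid : SO3 mid.
Proof. unfold SO3; vunf; repeat split; ring. Qed.

Lemma smooth_ex_derive (f : R -> R) (t : R) : smooth f -> ex_derive f t.
Proof. intros H; exact (H 1%nat t). Qed.

Lemma smooth_Derive (f : R -> R) : smooth f -> smooth (Derive f).
Proof.
  intros H [|n] t; [exact I|].
  apply ex_derive_ext with (Derive_n f (S n)); [|exact (H (S (S n)) t)].
  intros s; transitivity (Derive_n (Derive_n f 1) n s); [|reflexivity].
  rewrite Derive_n_comp; f_equal; lia.
Qed.

Lemma Derive_lin3 (f1 f2 f3 : R -> R) (k a1 a2 a3 c t : R) :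
  ex_derive f1 t -> ex_derive f2 t -> ex_derive f3 t ->
  Derive (fun s => k * (a1 * f1 s + a2 * f2 s + a3 * f3 s) + c) t =
  k * (a1 * Derive f1 t + a2 * Derive f2 t + a3 * Derive f3 t).
Proof.
  intros; apply is_derive_unique; (auto_derive; [auto|]).
  change (fun x => f1 x) with f1; change (fun x => f2 x) with f2;
    change (fun x => f3 x) with f3; ring.
Qed.

Lemma Derive_lin2 (f1 f2 : R -> R) (a1 a2 t : R) :
  ex_derive f1 t -> ex_derive f2 t ->
  Derive (fun s => a1 * f1 s + a2 * f2 s) t = a1 * Derive f1 t + a2 * Derive f2 t.
Proof.
  intros; apply is_derive_unique; (auto_derive; [auto|]).
  change (fun x => f1 x) with f1; change (fun x => f2 x) with f2; ring.
Qed.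

Lemma ex_derive_lin2 (f1 f2 : R -> R) (a1 a2 t : R) :
  ex_derive f1 t -> ex_derive f2 t -> ex_derive (fun s => a1 * f1 s + a2 * f2 s) t.
Proof. intros; auto_derive; auto. Qed.

Lemma ex_derive_norm3 (f1 f2 f3 : R -> R) (t : R) :
  ex_derive f1 t -> ex_derive f2 t -> ex_derive f3 t ->
  0 < f1 t * f1 t + f2 t * f2 t + f3 t * f3 t ->
  ex_derive (fun s => sqrt (f1 s * f1 s + f2 s * f2 s + f3 s * f3 s)) t.
Proof. intros; auto_derive; auto 10. Qed.

Lemma ex_derive_cross1 (q f1 g2 f2 g1 : R -> R) (t : R) :
  ex_derive q t -> ex_derive f1 t -> ex_derive g2 t -> ex_derive f2 t -> ex_derive g1 t ->
  ex_derive (fun s => q s * f1 s * g2 s - q s * f2 s * g1 s) t.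
Proof. intros; auto_derive; tauto. Qed.

Lemma Derive_dot3 (f1 f2 f3 g1 g2 g3 : R -> R) (t : R) :
  ex_derive f1 t -> ex_derive f2 t -> ex_derive f3 t ->
  ex_derive g1 t -> ex_derive g2 t -> ex_derive g3 t ->
  Derive (fun s => f1 s * g1 s + f2 s * g2 s + f3 s * g3 s) t =
  Derive f1 t * g1 t + f1 t * Derive g1 t + (Derive f2 t * g2 t + f2 t * Derive g2 t)
  + (Derive f3 t * g3 t + f3 t * Derive g3 t).
Proof.
  intros; apply is_derive_unique; (auto_derive; [tauto|]).
  change (fun x => f1 x) with f1; change (fun x => f2 x) with f2;
    change (fun x => f3 x) with f3; change (fun x => g1 x) with g1;
    change (fun x => g2 x) with g2; change (fun x => g3 x) with g3; ring.
Qed.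

Lemma vderiv_affine (f : R -> vec3) (A : mat3) (k : R) (c : vec3) (t : R) :
  ex_derive (fun s => vx (f s)) t -> ex_derive (fun s => vy (f s)) t ->
  ex_derive (fun s => vz (f s)) t ->
  vderiv (fun s => vadd (vscal k (mapply A (f s))) c) t = vscal k (mapply A (vderiv f t)).
Proof.
  intros Hx Hy Hz; destruct A as [[[[a1 a2] a3] [[b1 b2] b3]] [[c1 c2] c3]].
  apply vec3_eq; exact (Derive_lin3 (fun s => vx (f s)) (fun s => vy (f s))
    (fun s => vz (f s)) k _ _ _ _ t Hx Hy Hz).
Qed.

Lemma vderiv_comb (f g : R -> vec3) (a b : R) (t : R) :
  ex_derive (fun s => vx (f s)) t -> ex_derive (fun s => vy (f s)) t ->
  ex_derive (fun s => vz (f s)) t ->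
  ex_derive (fun s => vx (g s)) t -> ex_derive (fun s => vy (g s)) t ->
  ex_derive (fun s => vz (g s)) t ->
  vderiv (fun s => vadd (vscal a (f s)) (vscal b (g s))) t =
  vadd (vscal a (vderiv f t)) (vscal b (vderiv g t)).
Proof.
  intros; apply vec3_eq;
    [ apply (Derive_lin2 (fun s => vx (f s)) (fun s => vx (g s)))
    | apply (Derive_lin2 (fun s => vy (f s)) (fun s => vy (g s)))
    | apply (Derive_lin2 (fun s => vz (f s)) (fun s => vz (g s))) ]; assumption.
Qed.

Lemma Derive_dot (f g : R -> vec3) (t : R) :
  ex_derive (fun s => vx (f s)) t -> ex_derive (fun s => vy (f s)) t ->
  ex_derive (fun s => vz (f s)) t ->
  ex_derive (fun s => vx (g s)) t -> ex_derive (fun s => vy (g s)) t ->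
  ex_derive (fun s => vz (g s)) t ->
  Derive (fun s => dot (f s) (g s)) t = dot (vderiv f t) (g t) + dot (f t) (vderiv g t).
Proof.
  intros; etransitivity;
    [ apply (Derive_dot3 (fun s => vx (f s)) (fun s => vy (f s)) (fun s => vz (f s))
               (fun s => vx (g s)) (fun s => vy (g s)) (fun s => vz (g s))); assumption
    | unfold dot, vderiv, vx, vy, vz; cbn -[Derive Rplus Rmult]; ring ].
Qed.

Section FramedLoop.
Variable x : framed_loop.
Let g := curve x.
Let V := frame x.
Let W := conormal g V.

Lemma dot_vderiv_pos (t : R) : 0 < dot (vderiv g t) (vderiv g t).
Proof.
  assert (N := curve_immersion x t); fold g in N; revert N.
  generalize (vderiv g t); intros [[a b] c] N; vunf.
  destruct (Req_dec (a * a + b * b + c * c) 0) as [E|E]; [|nra].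
  exfalso; apply N; destruct (sumsq0 a b c E) as [-> [-> ->]]; reflexivity.
Qed.

Lemma speed_pos (t : R) : 0 < speed g t.
Proof. apply sqrt_lt_R0, dot_vderiv_pos. Qed.

Lemma tangent_unit (t : R) : dot (tangent g t) (tangent g t) = 1.
Proof.
  assert (P := speed_pos t).
  assert (E : dot (vderiv g t) (vderiv g t) = speed g t * speed g t).
  { unfold speed, vnorm; rewrite sqrt_sqrt; [reflexivity|].
    apply Rlt_le, dot_vderiv_pos. }
  transitivity (/ speed g t * / speed g t * dot (vderiv g t) (vderiv g t)).
  - unfold tangent; generalize (/ speed g t) (vderiv g t); intros; vunf; ring.
  - rewrite E; field; lra.
Qed.

Lemma tangent_normal (t : R) : dot (tangent g t) (V t) = 0.
Proof.
  transitivity (/ speed g t * dot (V t) (vderiv g t)).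
  - unfold tangent; generalize (/ speed g t) (vderiv g t); intros; vunf; ring.
  - unfold V, g; rewrite frame_normal; ring.
Qed.

Lemma cross_tangent_conormal (t : R) : cross (tangent g t) (W t) = vscal (-1) (V t).
Proof.
  transitivity (vadd (vscal (dot (tangent g t) (V t)) (tangent g t))
                     (vscal (- dot (tangent g t) (tangent g t)) (V t))).
  - unfold W, conormal; vring.
  - rewrite tangent_unit, tangent_normal; vring.
Qed.

Lemma conormal_unit (t : R) : dot (W t) (W t) = 1.
Proof.
  transitivity (dot (tangent g t) (tangent g t) * dot (V t) (V t)
                - dot (tangent g t) (V t) * dot (tangent g t) (V t)).
  - unfold W, conormal; vunf; ring.
  - rewrite tangent_unit, tangent_normal; unfold V; rewrite frame_unit; ring.
Qed.

Lemma conormal_normal (t : R) : dot (W t) (V t) = 0.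
Proof. unfold W, conormal; vunf; ring. Qed.

Lemma curve_ex_derive (t : R) :
  ex_derive (fun s => vx (g s)) t /\ ex_derive (fun s => vy (g s)) t /\
  ex_derive (fun s => vz (g s)) t.
Proof. destruct (curve_smooth x) as [? [? ?]]; auto using smooth_ex_derive. Qed.

Lemma frame_ex_derive (t : R) :
  ex_derive (fun s => vx (V s)) t /\ ex_derive (fun s => vy (V s)) t /\
  ex_derive (fun s => vz (V s)) t.
Proof. destruct (frame_smooth x) as [? [? ?]]; auto using smooth_ex_derive. Qed.

Lemma vderiv_ex_derive (t : R) :
  ex_derive (fun s => vx (vderiv g s)) t /\ ex_derive (fun s => vy (vderiv g s)) t /\
  ex_derive (fun s => vz (vderiv g s)) t.
Proof.
  destruct (curve_smooth x) as [Hx [Hy Hz]].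
  repeat split; apply smooth_ex_derive, smooth_Derive; assumption.
Qed.

Lemma speed_ex_derive (t : R) : ex_derive (speed g) t.
Proof.
  destruct (vderiv_ex_derive t) as [Hx [Hy Hz]].
  exact (ex_derive_norm3 (fun s => vx (vderiv g s)) (fun s => vy (vderiv g s))
    (fun s => vz (vderiv g s)) t Hx Hy Hz (dot_vderiv_pos t)).
Qed.

Lemma conormal_ex_derive (t : R) :
  ex_derive (fun s => vx (W s)) t /\ ex_derive (fun s => vy (W s)) t /\
  ex_derive (fun s => vz (W s)) t.
Proof.
  destruct (vderiv_ex_derive t) as [Hx [Hy Hz]].
  destruct (frame_ex_derive t) as [Kx [Ky Kz]].
  assert (S := speed_ex_derive t); assert (P := speed_pos t).
  assert (T : ex_derive (fun s => / speed g s) t).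
  { apply ex_derive_inv; [exact S|lra]. }
  split; [|split].
  - exact (ex_derive_cross1 (fun s => / speed g s) (fun s => vy (vderiv g s))
      (fun s => vz (V s)) (fun s => vz (vderiv g s)) (fun s => vy (V s)) t T Hy Kz Hz Ky).
  - exact (ex_derive_cross1 (fun s => / speed g s) (fun s => vz (vderiv g s))
      (fun s => vx (V s)) (fun s => vx (vderiv g s)) (fun s => vz (V s)) t T Hz Kx Hx Kz).
  - exact (ex_derive_cross1 (fun s => / speed g s) (fun s => vx (vderiv g s))
      (fun s => vy (V s)) (fun s => vy (vderiv g s)) (fun s => vx (V s)) t T Hx Ky Hy Kx).
Qed.

(** The effect of a similarity and of a constant frame twist. *)
Section Act.
Variables (A : mat3) (k : R) (c : vec3) (a b : R).
Hypotheses (HA : SO3 A) (Hk : 0 < k) (Hab : a * a + b * b = 1).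
Let g' := fun t => vadd (vscal k (mapply A (g t))) c.
Let V' := fun t => mapply A (vadd (vscal a (V t)) (vscal b (W t))).

Lemma vderiv_act (t : R) : vderiv g' t = vscal k (mapply A (vderiv g t)).
Proof. destruct (curve_ex_derive t) as [? [? ?]]; apply vderiv_affine; auto. Qed.

Lemma speed_act (t : R) : speed g' t = k * speed g t.
Proof.
  unfold speed, vnorm; rewrite vderiv_act.
  replace (dot (vscal k (mapply A (vderiv g t))) (vscal k (mapply A (vderiv g t))))
    with (k * k * dot (vderiv g t) (vderiv g t)).
  - rewrite sqrt_mult, sqrt_square; try nra; try apply Rlt_le, dot_vderiv_pos.
  - rewrite <- (SO3_dot A _ _ HA); vunf; ring.
Qed.

Lemma tangent_act (t : R) : tangent g' t = mapply A (tangent g t).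
Proof.
  unfold tangent; rewrite speed_act, vderiv_act, mapply_scal.
  assert (P := speed_pos t).
  apply vec3_eq; unfold vscal, vx, vy, vz; simpl; field; lra.
Qed.

Lemma conormal_act (t : R) :
  conormal g' V' t = mapply A (vadd (vscal (- b) (V t)) (vscal a (W t))).
Proof.
  unfold conormal; rewrite tangent_act; unfold V'; rewrite SO3_mapply_cross by exact HA.
  f_equal.
  transitivity (vadd (vscal a (cross (tangent g t) (V t)))
                     (vscal b (cross (tangent g t) (W t)))).
  - vring.
  - rewrite cross_tangent_conormal; unfold W, conormal; vring.
Qed.

Lemma vderiv_frame_act (t : R) :
  vderiv V' t = mapply A (vadd (vscal a (vderiv V t)) (vscal b (vderiv W t))).
Proof.
  destruct (frame_ex_derive t) as [Kx [Ky Kz]].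
  destruct (conormal_ex_derive t) as [Lx [Ly Lz]].
  rewrite <- (vderiv_comb V W a b t) by assumption.
  transitivity (vscal 1 (mapply A
    (vderiv (fun s => vadd (vscal a (V s)) (vscal b (W s))) t))); [|vring].
  rewrite <- (vderiv_affine _ A 1 vzero t).
  - f_equal; apply functional_extensionality; intros s; unfold V', vzero; vring.
  - exact (ex_derive_lin2 (fun s => vx (V s)) (fun s => vx (W s)) a b t Kx Lx).
  - exact (ex_derive_lin2 (fun s => vy (V s)) (fun s => vy (W s)) a b t Ky Ly).
  - exact (ex_derive_lin2 (fun s => vz (V s)) (fun s => vz (W s)) a b t Kz Lz).
Qed.

Lemma twist_rate_act (t : R) : twist_rate g' V' t = / k * twist_rate g V t.
Proof.
  destruct (frame_ex_derive t) as [Kx [Ky Kz]].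
  destruct (conormal_ex_derive t) as [Lx [Ly Lz]].
  assert (P := speed_pos t).
  assert (EVV : dot (vderiv V t) (V t) = 0).
  { assert (E := Derive_dot V V t Kx Ky Kz Kx Ky Kz).
    rewrite (Derive_ext _ (fun _ => 1)), Derive_const in E
      by (intros; apply frame_unit).
    revert E; vunf; lra. }
  assert (EWW : dot (vderiv W t) (W t) = 0).
  { assert (E := Derive_dot W W t Lx Ly Lz Lx Ly Lz).
    rewrite (Derive_ext _ (fun _ => 1)), Derive_const in E
      by (intros; apply conormal_unit).
    revert E; vunf; lra. }
  assert (EWV : dot (vderiv W t) (V t) = - dot (vderiv V t) (W t)).
  { assert (E := Derive_dot W V t Lx Ly Lz Kx Ky Kz).
    rewrite (Derive_ext _ (fun _ => 0)), Derive_const in E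
      by (intros; apply conormal_normal).
    revert E; unfold dot; lra. }
  unfold twist_rate; rewrite speed_act, conormal_act, vderiv_frame_act.
  rewrite <- mapply_scal, SO3_dot by exact HA.
  fold W.
  transitivity (/ (k * speed g t) *
    (a * a * dot (vderiv V t) (W t) - b * b * dot (vderiv W t) (V t)
     + a * b * (dot (vderiv W t) (W t) - dot (vderiv V t) (V t)))).
  - vunf; ring.
  - rewrite EVV, EWW, EWV.
    replace (dot (vscal (/ speed g t) (vderiv V t)) (W t))
      with (/ speed g t * dot (vderiv V t) (W t)) by (vunf; ring).
    transitivity (/ (k * speed g t) * ((a * a + b * b) * dot (vderiv V t) (W t)));
      [ring|].
    rewrite Hab; field; lra.
Qed.

Lemma speed_ex_RInt : ex_RInt (speed g) 0 2.
Proof.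
  apply (ex_RInt_continuous (V := R_CompleteNormedModule)).
  intros t _; apply (ex_derive_continuous (V := R_NormedModule)), speed_ex_derive.
Qed.

Lemma length_pos : 0 < length g.
Proof.
  apply RInt_gt_0; [lra| |].
  - intros t _; apply speed_pos.
  - intros t _; apply (ex_derive_continuous (V := R_NormedModule)), speed_ex_derive.
Qed.

Lemma length_act : length g' = k * length g.
Proof.
  unfold length; rewrite (RInt_ext _ (fun t => k * speed g t)).
  - apply (RInt_scal (V := R_CompleteNormedModule)), speed_ex_RInt.
  - intros; apply speed_act.
Qed.

End Act.
End FramedLoop.

Lemma cos_sin_unit (a : R) : cos a * cos a + sin a * sin a = 1.
Proof. generalize (sin2_cos2 a); unfold Rsqr; lra. Qed.

Lemma framed_equiv_refl (x : framed_loop) : framed_equiv x x.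
Proof.
  exists mid, 1, vzero, 0; split; [exact SO3_mid|split; [lra|]].
  intros t; rewrite Rmult_0_r, cos_0, sin_0, !mapply_mid; unfold vzero; split; vring.
Qed.

Lemma conormal_equiv (x y : framed_loop) (A : mat3) (r : R) (c : vec3) (a b : R) :
  SO3 A -> 0 < r ->
  (forall t, curve y t = vadd (vscal r (mapply A (curve x t))) c /\
     frame y t = mapply A (vadd (vscal a (frame x t))
                                (vscal b (conormal (curve x) (frame x) t)))) ->
  forall t, conormal (curve y) (frame y) t =
    mapply A (vadd (vscal (- b) (frame x t))
                   (vscal a (conormal (curve x) (frame x) t))).
Proof.
  intros HA Hr E t; rewrite <- (conormal_act x A r c a b HA Hr t).
  f_equal; apply functional_extensionality; intros s; apply E.
Qed.

Lemma framed_equiv_sym (x y : framed_loop) : framed_equiv x y -> framed_equiv y x.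
Proof.
  intros [A [r [c [th [HA [Hr E]]]]]].
  assert (EW := conormal_equiv x y A r c _ _ HA Hr E).
  exists (mtrans A), (/ r), (vscal (- / r) (mapply (mtrans A) c)), (- th).
  split; [exact (SO3_mtrans A HA)|split; [apply Rinv_0_lt_compat, Hr|]].
  intros t; destruct (E t) as [E1 E2]; rewrite EW, E1, E2; split.
  - transitivity (vadd (vscal (/ r) (vadd (vscal r (mapply (mtrans A)
      (mapply A (curve x t)))) (vscal 1 (mapply (mtrans A) c))))
      (vscal (- / r) (mapply (mtrans A) c))).
    + rewrite mtrans_mapply by exact HA.
      apply vec3_eq; unfold vadd, vscal, vx, vy, vz; simpl; field; lra.
    + rewrite <- mapply_lin; do 3 f_equal; vring.
  - rewrite <- mapply_lin, mtrans_mapply by exact HA.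
    replace (2 * - th) with (- (2 * th)) by ring; rewrite cos_neg, sin_neg.
    set (co := cos (2 * th)); set (si := sin (2 * th)).
    assert (Hcs : co * co + si * si = 1) by apply cos_sin_unit.
    transitivity (vscal (co * co + si * si) (frame x t)); [rewrite Hcs|]; vring.
Qed.

Lemma framed_equiv_trans (x y z : framed_loop) :
  framed_equiv x y -> framed_equiv y z -> framed_equiv x z.
Proof.
  intros [A [r [c [th [HA [Hr E]]]]]] [B [r' [c' [th' [HB [Hr' F]]]]]].
  assert (EW := conormal_equiv x y A r c _ _ HA Hr E).
  exists (mmul B A), (r' * r), (vadd (vscal r' (mapply B c)) c'), (th + th').
  split; [auto using SO3_mmul|split; [nra|]].
  intros t; destruct (E t) as [E1 E2], (F t) as [F1 F2]; split.
  - rewrite F1, E1, mapply_mmul.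
    replace (vadd (vscal r (mapply A (curve x t))) c)
      with (vadd (vscal r (mapply A (curve x t))) (vscal 1 c)) by vring.
    rewrite mapply_lin; vring.
  - rewrite F2, E2, EW, mapply_mmul, <- mapply_lin.
    replace (2 * (th + th')) with (2 * th + 2 * th') by ring.
    rewrite cos_plus, sin_plus; do 2 f_equal; vring.
Qed.

Lemma class_eq (x y : framed_loop) : class x = class y <-> framed_equiv x y.
Proof.
  split.
  - intros E; apply (f_equal (@proj1_sig _ _)) in E; simpl in E.
    rewrite E; apply framed_equiv_refl.
  - intros H; unfold class.
    assert (E : framed_equiv x = framed_equiv y).
    { apply functional_extensionality; intros z; apply propositional_extensionality.
      split; intros K; eauto using framed_equiv_trans, framed_equiv_sym. }
    apply eq_sig_hprop; [intros; apply proof_irrelevance|exact E].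
Qed.

Lemma class_repr (m : M) : class (repr m) = m.
Proof.
  unfold repr; destruct constructive_indefinite_description as [x E]; simpl.
  apply eq_sig_hprop; [intros; apply proof_irrelevance|symmetry; exact E].
Qed.

Lemma twist_normalize_act (x : framed_loop) (A : mat3) (r : R) (c : vec3) (a b : R) :
  SO3 A -> 0 < r -> a * a + b * b = 1 ->
  weighted_total_twist (fun t => vadd (vscal r (mapply A (curve x t))) c)
    (fun t => mapply A (vadd (vscal a (frame x t))
                             (vscal b (conormal (curve x) (frame x) t)))) =
  weighted_total_twist (fun t => vscal r (curve x t)) (frame x).
Proof.
  intros HA Hr Hab; unfold weighted_total_twist; f_equal; apply RInt_ext; intros t _.
  rewrite speed_act, twist_rate_act by assumption.
  assert (Eg : (fun s => vscal r (curve x s)) =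
               (fun s => vadd (vscal r (mapply mid (curve x s))) vzero)).
  { apply functional_extensionality; intros s; rewrite mapply_mid; unfold vzero; vring. }
  assert (EV : frame x = (fun s => mapply mid (vadd (vscal 1 (frame x s))
                            (vscal 0 (conormal (curve x) (frame x) s))))).
  { apply functional_extensionality; intros s; rewrite mapply_mid; vring. }
  rewrite Eg; rewrite EV at 2.
  rewrite speed_act, twist_rate_act by (try apply SO3_mid; auto; ring).
  reflexivity.
Qed.

(** [Tw] is computed with any representative of length 2. *)
Lemma Tw_class (x : framed_loop) :
  length (curve x) = 2 -> Tw (class x) = weighted_total_twist (curve x) (frame x).
Proof.
  intros Hx; unfold Tw.
  assert (E : framed_equiv x (repr (class x))).
  { apply class_eq; rewrite class_repr; reflexivity. }
  set (y := repr (class x)) in *; clearbody y.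
  destruct E as [A [r [c [th [HA [Hr E]]]]]].
  assert (Eg : curve y = (fun t => vadd (vscal r (mapply A (curve x t))) c)).
  { apply functional_extensionality; intros t; apply E. }
  assert (EL : length (curve y) = r * 2).
  { rewrite Eg, length_act, Hx by assumption; reflexivity. }
  assert (En : normalize (curve y) =
               (fun t => vadd (vscal 1 (mapply A (curve x t))) (vscal (/ r) c))).
  { apply functional_extensionality; intros t; unfold normalize; rewrite EL, Eg.
    apply vec3_eq; unfold vadd, vscal, vx, vy, vz; simpl; field; lra. }
  assert (EV : frame y = (fun t => mapply A (vadd (vscal (cos (2 * th)) (frame x t))
                 (vscal (sin (2 * th)) (conormal (curve x) (frame x) t))))).
  { apply functional_extensionality; intros t; apply E. }
  rewrite En, EV, twist_normalize_act by (auto using cos_sin_unit; lra).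
  f_equal; apply functional_extensionality; intros t; vring.
Qed.

Lemma smooth_scal (k : R) (f : R -> R) : smooth f -> smooth (fun t => k * f t).
Proof.
  intros H [|n] t; [exact I|].
  apply ex_derive_ext with (fun s => k * Derive_n f n s).
  - intros s; rewrite Derive_n_scal_l; reflexivity.
  - apply (ex_derive_scal (Derive_n f n) k t), (H (S n) t).
Qed.

Lemma length2_representative (m : M) :
  exists x : framed_loop, length (curve x) = 2 /\ class x = m.
Proof.
  set (y := repr m); set (k := 2 / length (curve y)).
  assert (P : 0 < length (curve y)) by apply length_pos.
  assert (Hk : 0 < k) by (apply Rdiv_lt_0_compat; lra).
  assert (Eg : (fun t => vscal k (curve y t)) =
               (fun t => vadd (vscal k (mapply mid (curve y t))) vzero)).
  { apply functional_extensionality; intros s; rewrite mapply_mid; unfold vzero; vring. }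
  assert (D : forall t, vderiv (fun s => vscal k (curve y s)) t = vscal k (vderiv (curve y) t)).
  { intros t; rewrite Eg, vderiv_act, mapply_mid; reflexivity. }
  unshelve eset (x := @FramedLoop (fun t => vscal k (curve y t)) (frame y) _
    (frame_smooth y) _ (frame_periodic y) _ (frame_unit y) _).
  - destruct (curve_smooth y) as [H1 [H2 H3]]; split; [|split]; apply smooth_scal; assumption.
  - intros t; rewrite (curve_periodic y t); reflexivity.
  - intros t; rewrite D; intros E; apply (curve_immersion y t).
    transitivity (vscal (/ k) (vscal k (vderiv (curve y) t))).
    + apply vec3_eq; unfold vscal, vx, vy, vz; simpl; field; lra.
    + rewrite E; unfold vzero; vring.
  - intros t; rewrite D.
    transitivity (k * dot (frame y t) (vderiv (curve y) t)).
    + generalize (vderiv (curve y) t); intros; vunf; ring.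
    + rewrite frame_normal; ring.
  - exists x; split.
    + unfold x; simpl; rewrite Eg, length_act by (auto using SO3_mid).
      unfold k; field; lra.
    + rewrite <- (class_repr m); apply class_eq, framed_equiv_sym; fold y.
      exists mid, k, vzero, 0; split; [exact SO3_mid|split; [exact Hk|]].
      intros t; rewrite Rmult_0_r, cos_0, sin_0, !mapply_mid; unfold x, vzero; simpl.
      split; vring.
Qed.

(* Main.v *)
Require Import Defs.
From Stdlib Require Import Reals ZArith Lra Lia.
From Stdlib Require Import FunctionalExtensionality.
From Coquelicot Require Import Coquelicot.
Open Scope R_scope.

(** Write [D = <V', g' x V>]. The weight [|g'|] cancels the speeds hidden in the twist rate, so
    that the functional of a framed loop of any length is [(1/PI) G / L], where [G] is the
    integral of [D] over a period and [L] the length ([Tw_formula]).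

    Critical points are found with two families of variations. Rotating the frame by the angle
    [e a(t)] adds [e a' |g'|] to [D]; when [L = 2] the choice [a' = |g'| - 1] makes the
    derivative of [G] equal to the integral of [(|g'| - 1)^2], so a critical loop has unit speed
    ([critical_speed]). At constant speed, integration by parts removes the velocity of the
    frame from the first variation, and the derivative of the functional along a variation with
    velocity [eta] is a positive multiple of the integral of [<eta', Z>], where
    [Z = (D - mean D) g' + g' x g''] is called the moment below ([first_variation]). Taking for
    [eta'] a multiple of [Z - mean Z] shows that the moment of a critical loop is constant
    ([critical_moment]). Conversely, if [Z] is constant then the integral of [<eta', Z>] vanishes,
    because [eta] is periodic ([critical_of_moment]). At unit speed, then, critical means: of
    constant moment.

    If [Z = l] is constant and [T = g'] is a unit vector, then [<T, l> = D - mean D] has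
    derivative [<T', l> = 0]; as [T] has mean zero, [<T, l> = 0]. Hence [D] is constant and
    [l = T x T'], that is [T' = l x T]: the tangent rotates uniformly in the plane normal to [l],
    and the curve is a circle run [h] times, [|l| = h PI] ([moment_circle]). The opposite
    implication is a computation ([circle_moment]).

    For torus knots the quaternionic formulas give [T = (0, sin (h PI t), cos (h PI t))] and
    [D = - k PI], so that their moment is constant ([torus_moment]). A critical loop is equivalent
    to one of these: its frame, expressed in the frame made of the radial direction and of the
    axis of the circle, rotates at the constant rate [D], and periodicity makes [D] an integral
    multiple of [PI]; the initial position of the frame and the position of the circle are
    absorbed by a frame twist and a rigid motion ([uniform_circle_torus]). *)

(** * Joint smoothness of families *)

(** Differentiability of a fixed order on a whole strip: the order is the variable of the
    inductions below, and the strip is open, so that formulas for partial derivatives can be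
    differentiated again. *)
Definition jdiff (e0 d : R) (n : nat) (f : R -> R -> R) : Prop :=
  forall e t, Rabs (e - e0) < d -> ex_diff_n f n e t.

Section JointSmoothness.
Variables e0 d : R.

Lemma strip_open (e t : R) :
  Rabs (e - e0) < d -> locally_2d (fun u _ => Rabs (u - e0) < d) e t.
Proof.
  intros H; assert (P : 0 < d - Rabs (e - e0)) by lra.
  exists (mkposreal _ P); simpl; intros u v Hu _.
  replace (u - e0) with ((u - e) + (e - e0)) by ring.
  eapply Rle_lt_trans; [apply Rabs_triang|lra].
Qed.

Lemma strip_locally (e : R) :
  Rabs (e - e0) < d -> locally e (fun u => Rabs (u - e0) < d).
Proof.
  intros H; destruct (strip_open e 0 H) as [r Hr].
  exists r; intros u Hu; apply (Hr u 0); [exact Hu|].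
  rewrite Rminus_0_r, Rabs_R0; apply cond_pos.
Qed.

Lemma jdiff_ext (n : nat) (f g : R -> R -> R) :
  (forall e t, Rabs (e - e0) < d -> f e t = g e t) -> jdiff e0 d n f -> jdiff e0 d n g.
Proof.
  intros E Hf e t H; apply (ex_diff_n_ext_loc f); [|apply Hf, H].
  destruct (strip_open e t H) as [r Hr]; exists r; intros; apply E, (Hr u v); assumption.
Qed.

Lemma jdiff_le (n m : nat) (f : R -> R -> R) :
  (m <= n)%nat -> jdiff e0 d n f -> jdiff e0 d m f.
Proof. intros L Hf e t H; exact (ex_diff_n_m n m L f e t (Hf e t H)). Qed.

Lemma jdiff_continuity (n : nat) (f : R -> R -> R) (e t : R) :
  jdiff e0 d n f -> Rabs (e - e0) < d -> continuity_2d_pt f e t.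
Proof. intros Hf H; destruct n; exact (proj1 (Hf e t H)). Qed.

Lemma jdiff_derive1 (n : nat) (f : R -> R -> R) (e t : R) :
  jdiff e0 d (S n) f -> Rabs (e - e0) < d ->
  is_derive (fun z => f z t) e (Derive (fun z => f z t) e).
Proof. intros Hf H; apply Derive_correct; exact (proj1 (proj2 (Hf e t H))). Qed.

Lemma jdiff_derive2 (n : nat) (f : R -> R -> R) (e t : R) :
  jdiff e0 d (S n) f -> Rabs (e - e0) < d ->
  is_derive (fun z => f e z) t (Derive (fun z => f e z) t).
Proof. intros Hf H; apply Derive_correct; exact (proj1 (proj2 (proj2 (Hf e t H)))). Qed.

Lemma jdiff_partial1 (n : nat) (f : R -> R -> R) :
  jdiff e0 d (S n) f -> jdiff e0 d n (fun e t => Derive (fun z => f z t) e).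
Proof. intros Hf e t H; exact (proj1 (proj2 (proj2 (proj2 (Hf e t H))))). Qed.

Lemma jdiff_partial2 (n : nat) (f : R -> R -> R) :
  jdiff e0 d (S n) f -> jdiff e0 d n (fun e t => Derive (fun z => f e z) t).
Proof. intros Hf e t H; exact (proj2 (proj2 (proj2 (proj2 (Hf e t H))))). Qed.

Lemma jdiff_0 (f : R -> R -> R) :
  (forall e t, Rabs (e - e0) < d -> continuity_2d_pt f e t) -> jdiff e0 d 0 f.
Proof. intros C e t H; split; [exact (C e t H)|exact I]. Qed.

(** The closure properties below go by induction on the order through this rule: formulas for
    the partial derivatives are built from functions already known at the previous order. *)
Lemma jdiff_intro (n : nat) (f f1 f2 : R -> R -> R) :
  (forall e t, Rabs (e - e0) < d -> continuity_2d_pt f e t) ->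
  (forall e t, Rabs (e - e0) < d -> is_derive (fun z => f z t) e (f1 e t)) ->
  (forall e t, Rabs (e - e0) < d -> is_derive (fun z => f e z) t (f2 e t)) ->
  jdiff e0 d n f1 -> jdiff e0 d n f2 -> jdiff e0 d (S n) f.
Proof.
  intros C D1 D2 H1 H2 e t H; split; [exact (C e t H)|].
  split; [exists (f1 e t); exact (D1 e t H)|].
  split; [exists (f2 e t); exact (D2 e t H)|]; split.
  - revert e t H; apply (jdiff_ext n f1); [|exact H1].
    intros e t H; symmetry; apply is_derive_unique, D1, H.
  - revert e t H; apply (jdiff_ext n f2); [|exact H2].
    intros e t H; symmetry; apply is_derive_unique, D2, H.
Qed.

Lemma jdiff_const (n : nat) (c : R) : jdiff e0 d n (fun _ _ => c).
Proof.
  revert c; induction n as [|n IH]; intros c.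
  - apply jdiff_0; intros; apply continuity_2d_pt_const.
  - apply (jdiff_intro n _ (fun _ _ => 0) (fun _ _ => 0)); auto;
      intros; [apply continuity_2d_pt_const| |]; apply (is_derive_const c).
Qed.

Lemma jdiff_plus (n : nat) (f g : R -> R -> R) :
  jdiff e0 d n f -> jdiff e0 d n g -> jdiff e0 d n (fun e t => f e t + g e t).
Proof.
  revert f g; induction n as [|n IH]; intros f g Hf Hg.
  - apply jdiff_0; intros; apply continuity_2d_pt_plus; eapply jdiff_continuity; eauto.
  - eapply jdiff_intro; cycle 3.
    + apply IH; [exact (jdiff_partial1 n f Hf)|exact (jdiff_partial1 n g Hg)].
    + apply IH; [exact (jdiff_partial2 n f Hf)|exact (jdiff_partial2 n g Hg)].
    + intros; apply continuity_2d_pt_plus; eapply jdiff_continuity; eauto.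
    + intros; apply (is_derive_plus (fun z => f z t) (fun z => g z t));
        eapply jdiff_derive1; eauto.
    + intros; apply (is_derive_plus (fun z => f e z) (fun z => g e z));
        eapply jdiff_derive2; eauto.
Qed.

Lemma jdiff_mult (n : nat) (f g : R -> R -> R) :
  jdiff e0 d n f -> jdiff e0 d n g -> jdiff e0 d n (fun e t => f e t * g e t).
Proof.
  revert f g; induction n as [|n IH]; intros f g Hf Hg.
  - apply jdiff_0; intros; apply continuity_2d_pt_mult; eapply jdiff_continuity; eauto.
  - assert (Hf' := jdiff_le (S n) n f (le_S _ _ (le_n _)) Hf).
    assert (Hg' := jdiff_le (S n) n g (le_S _ _ (le_n _)) Hg).
    eapply jdiff_intro; cycle 3.
    + apply jdiff_plus; apply IH;
        [exact (jdiff_partial1 n f Hf)|exact Hg'|exact Hf'|exact (jdiff_partial1 n g Hg)].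
    + apply jdiff_plus; apply IH;
        [exact (jdiff_partial2 n f Hf)|exact Hg'|exact Hf'|exact (jdiff_partial2 n g Hg)].
    + intros; apply continuity_2d_pt_mult; eapply jdiff_continuity; eauto.
    + intros; apply (is_derive_mult (fun z => f z t) (fun z => g z t));
        [eapply jdiff_derive1; eauto|eapply jdiff_derive1; eauto|intros; apply Rmult_comm].
    + intros; apply (is_derive_mult (fun z => f e z) (fun z => g e z));
        [eapply jdiff_derive2; eauto|eapply jdiff_derive2; eauto|intros; apply Rmult_comm].
Qed.

Lemma is_derive_inv_sqrt (f : R -> R) (x l : R) :
  0 < f x -> is_derive f x l ->
  is_derive (fun z => / sqrt (f z)) x
    (- / 2 * (l * (/ sqrt (f x) * (/ sqrt (f x) * / sqrt (f x))))).
Proof.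
  intros P H; assert (Q := sqrt_lt_R0 _ P).
  assert (E : Derive f x = l) by (apply is_derive_unique, H).
  auto_derive.
  - repeat split; auto; [exists l; exact H|lra].
  - change (fun x => f x) with f; rewrite E; field; lra.
Qed.

(** [/ sqrt y] has derivative [- (/ sqrt y)^3 / 2], a polynomial in itself, so the induction
    closes on this single function; square roots follow as [y * / sqrt y]. *)
Lemma jdiff_inv_sqrt (n : nat) (f : R -> R -> R) :
  (forall e t, Rabs (e - e0) < d -> 0 < f e t) ->
  jdiff e0 d n f -> jdiff e0 d n (fun e t => / sqrt (f e t)).
Proof.
  intros P Hf.
  assert (C : forall e t, Rabs (e - e0) < d ->
                continuity_2d_pt (fun e t => / sqrt (f e t)) e t).
  { intros e t H; apply (continuity_1d_2d_pt_comp (fun y => / sqrt y) f).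
    - apply derivable_continuous_pt, ex_derive_Reals_0.
      eexists; apply (is_derive_inv_sqrt (fun y => y)); [apply P, H|apply (is_derive_id (K := R_AbsRing))].
    - eapply jdiff_continuity; eauto. }
  induction n as [|n IH]; [apply jdiff_0, C|].
  specialize (IH (jdiff_le (S n) n f (le_S _ _ (le_n _)) Hf)).
  eapply jdiff_intro; [exact C| | | |].
  - intros e t H; apply (is_derive_inv_sqrt (fun z => f z t)); [apply P, H|].
    eapply jdiff_derive1; eauto.
  - intros e t H; apply (is_derive_inv_sqrt (fun z => f e z)); [apply P, H|].
    eapply jdiff_derive2; eauto.
  - apply (jdiff_mult n (fun _ _ => - / 2)); [apply jdiff_const|].
    repeat (apply jdiff_mult; auto); exact (jdiff_partial1 n f Hf).
  - apply (jdiff_mult n (fun _ _ => - / 2)); [apply jdiff_const|].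
    repeat (apply jdiff_mult; auto); exact (jdiff_partial2 n f Hf).
Qed.

(** Each function is the derivative of the other up to sign, whence the joint induction. *)
Lemma jdiff_cos_sin (n : nat) (f : R -> R -> R) :
  jdiff e0 d n f ->
  jdiff e0 d n (fun e t => cos (f e t)) /\ jdiff e0 d n (fun e t => sin (f e t)).
Proof.
  assert (DC : forall (h : R -> R) x l, is_derive h x l ->
                 is_derive (fun z => cos (h z)) x (l * (-1 * sin (h x)))).
  { intros h x l H; assert (E : Derive h x = l) by (apply is_derive_unique, H).
    auto_derive; [exists l; exact H|change (fun x => h x) with h; rewrite E; ring]. }
  assert (DS : forall (h : R -> R) x l, is_derive h x l ->
                 is_derive (fun z => sin (h z)) x (l * cos (h x))).
  { intros h x l H; assert (E : Derive h x = l) by (apply is_derive_unique, H).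
    auto_derive; [exists l; exact H|change (fun x => h x) with h; rewrite E; ring]. }
  intros Hf.
  assert (CC : forall e t, Rabs (e - e0) < d ->
                 continuity_2d_pt (fun e t => cos (f e t)) e t).
  { intros; apply (continuity_1d_2d_pt_comp cos f); [apply continuity_cos|].
    eapply jdiff_continuity; eauto. }
  assert (CS : forall e t, Rabs (e - e0) < d ->
                 continuity_2d_pt (fun e t => sin (f e t)) e t).
  { intros; apply (continuity_1d_2d_pt_comp sin f); [apply continuity_sin|].
    eapply jdiff_continuity; eauto. }
  induction n as [|n IH]; [split; apply jdiff_0; assumption|].
  destruct (IH (jdiff_le (S n) n f (le_S _ _ (le_n _)) Hf)) as [IC IS].
  assert (P1 := jdiff_partial1 n f Hf); assert (P2 := jdiff_partial2 n f Hf).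
  split.
  - eapply jdiff_intro; [exact CC| | | |].
    + intros; apply (DC (fun z => f z t)); eapply jdiff_derive1; eauto.
    + intros; apply (DC (fun z => f e z)); eapply jdiff_derive2; eauto.
    + apply jdiff_mult; [exact P1|apply jdiff_mult; [apply jdiff_const|exact IS]].
    + apply jdiff_mult; [exact P2|apply jdiff_mult; [apply jdiff_const|exact IS]].
  - eapply jdiff_intro; [exact CS| | | |].
    + intros; apply (DS (fun z => f z t)); eapply jdiff_derive1; eauto.
    + intros; apply (DS (fun z => f e z)); eapply jdiff_derive2; eauto.
    + apply jdiff_mult; assumption.
    + apply jdiff_mult; assumption.
Qed.

Lemma smooth_continuity (f : R -> R) (t : R) : smooth f -> continuity_pt f t.
Proof.
  intros Hf; apply derivable_continuous_pt, ex_derive_Reals_0, smooth_ex_derive, Hf.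
Qed.

Lemma jdiff_time (n : nat) (f : R -> R) : smooth f -> jdiff e0 d n (fun _ t => f t).
Proof.
  revert f; induction n as [|n IH]; intros f Hf.
  - apply jdiff_0; intros.
    apply (continuity_1d_2d_pt_comp f (fun _ t => t));
      [apply smooth_continuity, Hf|apply continuity_2d_pt_id2].
  - apply (jdiff_intro n _ (fun _ _ => 0) (fun _ t => Derive f t)).
    + intros; apply (continuity_1d_2d_pt_comp f (fun _ t => t));
      [apply smooth_continuity, Hf|apply continuity_2d_pt_id2].
    + intros; apply (is_derive_const (f t)).
    + intros; apply Derive_correct, smooth_ex_derive, Hf.
    + apply jdiff_const.
    + apply IH, smooth_Derive, Hf.
Qed.

Lemma jdiff_parameter (n : nat) : jdiff e0 d n (fun e _ => e).
Proof.
  destruct n as [|n]; [apply jdiff_0; intros; apply continuity_2d_pt_id1|].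
  apply (jdiff_intro n _ (fun _ _ => 1) (fun _ _ => 0)); try apply jdiff_const; intros.
  - apply continuity_2d_pt_id1.
  - apply (is_derive_id (K := R_AbsRing)).
  - apply (is_derive_const e).
Qed.

End JointSmoothness.

Section JointClosure.
Variables e0 d : R.
Let JS := jointly_smooth_near e0 d.
Let vJS := vjointly_smooth_near e0 d.

Lemma joint_const (c : R) : JS (fun _ _ => c).
Proof. intros n; apply (jdiff_const e0 d n c). Qed.

Lemma joint_plus (f g : R -> R -> R) : JS f -> JS g -> JS (fun e t => f e t + g e t).
Proof. intros Hf Hg n; exact (jdiff_plus e0 d n f g (Hf n) (Hg n)). Qed.

Lemma joint_mult (f g : R -> R -> R) : JS f -> JS g -> JS (fun e t => f e t * g e t).
Proof. intros Hf Hg n; exact (jdiff_mult e0 d n f g (Hf n) (Hg n)). Qed.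

Lemma joint_ext (f g : R -> R -> R) :
  (forall e t, Rabs (e - e0) < d -> f e t = g e t) -> JS f -> JS g.
Proof. intros E Hf n; exact (jdiff_ext e0 d n f g E (Hf n)). Qed.

Lemma joint_minus (f g : R -> R -> R) : JS f -> JS g -> JS (fun e t => f e t - g e t).
Proof.
  intros Hf Hg; apply (joint_ext (fun e t => f e t + -1 * g e t)); [intros; ring|].
  apply joint_plus; [exact Hf|apply joint_mult; [apply joint_const|exact Hg]].
Qed.

Lemma joint_opp (f : R -> R -> R) : JS f -> JS (fun e t => - f e t).
Proof.
  intros Hf; apply (joint_ext (fun e t => 0 - f e t)); [intros; ring|].
  apply joint_minus; [apply joint_const|exact Hf].
Qed.

Lemma joint_inv_sqrt (f : R -> R -> R) :
  (forall e t, Rabs (e - e0) < d -> 0 < f e t) -> JS f -> JS (fun e t => / sqrt (f e t)).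
Proof. intros P Hf n; exact (jdiff_inv_sqrt e0 d n f P (Hf n)). Qed.

Lemma joint_sqrt (f : R -> R -> R) :
  (forall e t, Rabs (e - e0) < d -> 0 < f e t) -> JS f -> JS (fun e t => sqrt (f e t)).
Proof.
  intros P Hf; apply (joint_ext (fun e t => f e t * / sqrt (f e t))).
  - intros e t H; specialize (P e t H); assert (Q := sqrt_lt_R0 _ P).
    rewrite <- (sqrt_sqrt (f e t)) at 1 by lra; field; lra.
  - apply joint_mult; [exact Hf|apply joint_inv_sqrt; assumption].
Qed.

Lemma joint_cos (f : R -> R -> R) : JS f -> JS (fun e t => cos (f e t)).
Proof. intros Hf n; exact (proj1 (jdiff_cos_sin e0 d n f (Hf n))). Qed.

Lemma joint_sin (f : R -> R -> R) : JS f -> JS (fun e t => sin (f e t)).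
Proof. intros Hf n; exact (proj2 (jdiff_cos_sin e0 d n f (Hf n))). Qed.

Lemma joint_time (f : R -> R) : smooth f -> JS (fun _ t => f t).
Proof. intros Hf n; exact (jdiff_time e0 d n f Hf). Qed.

Lemma joint_parameter : JS (fun e _ => e).
Proof. intros n; exact (jdiff_parameter e0 d n). Qed.

Lemma joint_partial1 (f : R -> R -> R) :
  JS f -> JS (fun e t => Derive (fun z => f z t) e).
Proof. intros Hf n; exact (jdiff_partial1 e0 d n f (Hf (S n))). Qed.

Lemma joint_partial2 (f : R -> R -> R) :
  JS f -> JS (fun e t => Derive (fun z => f e z) t).
Proof. intros Hf n; exact (jdiff_partial2 e0 d n f (Hf (S n))). Qed.

Lemma joint_is_derive1 (f : R -> R -> R) (e t : R) :
  JS f -> Rabs (e - e0) < d -> is_derive (fun z => f z t) e (Derive (fun z => f z t) e).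
Proof. intros Hf; exact (jdiff_derive1 e0 d 0 f e t (Hf 1%nat)). Qed.

Lemma joint_ex_derive2 (f : R -> R -> R) (e t : R) :
  JS f -> Rabs (e - e0) < d -> ex_derive (fun z => f e z) t.
Proof. intros Hf H; eexists; exact (jdiff_derive2 e0 d 0 f e t (Hf 1%nat) H). Qed.

Lemma joint_continuity (f : R -> R -> R) (e t : R) :
  JS f -> Rabs (e - e0) < d -> continuity_2d_pt f e t.
Proof. intros Hf; exact (jdiff_continuity e0 d 0 f e t (Hf 0%nat)). Qed.

Lemma joint_slice (f : R -> R -> R) (e : R) :
  JS f -> Rabs (e - e0) < d -> smooth (fun t => f e t).
Proof.
  intros Hf H n; revert f Hf; induction n as [|n IH]; intros f Hf t; [exact I|].
  destruct n as [|n]; [exact (joint_ex_derive2 f e t Hf H)|].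
  apply (ex_derive_ext (Derive_n (Derive (fun s => f e s)) n)).
  - intros s; exact (eq_trans (Derive_n_comp (fun s => f e s) n 1 s)
      (f_equal (fun m => Derive_n (fun s => f e s) m s) (Nat.add_1_r n))).
  - exact (IH _ (joint_partial2 f Hf) t).
Qed.

Lemma joint_schwarz (f : R -> R -> R) (e t : R) :
  JS f -> Rabs (e - e0) < d ->
  Derive (fun z => Derive (fun s => f z s) t) e =
  Derive (fun s => Derive (fun z => f z s) e) t.
Proof.
  intros Hf H; apply Schwarz.
  - destruct (strip_open e0 d e t H) as [r Hr]; exists r; intros u v Hu Hv.
    assert (K := Hr u v Hu Hv); split; [|split; [|split]].
    + eexists; exact (joint_is_derive1 f u v Hf K).
    + exact (joint_ex_derive2 f u v Hf K).
    + eexists; exact (joint_is_derive1 _ u v (joint_partial2 f Hf) K).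
    + exact (joint_ex_derive2 _ u v (joint_partial1 f Hf) K).
  - exact (joint_continuity _ e t (joint_partial1 _ (joint_partial2 f Hf)) H).
  - exact (joint_continuity _ e t (joint_partial2 _ (joint_partial1 f Hf)) H).
Qed.

Lemma vjoint_intro (f : R -> R -> vec3) :
  JS (fun e t => vx (f e t)) -> JS (fun e t => vy (f e t)) -> JS (fun e t => vz (f e t)) ->
  vJS f.
Proof. intros; split; [|split]; assumption. Qed.

Lemma vjoint_add (f g : R -> R -> vec3) :
  vJS f -> vJS g -> vJS (fun e t => vadd (f e t) (g e t)).
Proof.
  intros [f1 [f2 f3]] [g1 [g2 g3]]; apply vjoint_intro; cbn;
    apply joint_plus; assumption.
Qed.

Lemma vjoint_scal (k : R -> R -> R) (f : R -> R -> vec3) :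
  JS k -> vJS f -> vJS (fun e t => vscal (k e t) (f e t)).
Proof.
  intros Hk [f1 [f2 f3]]; apply vjoint_intro; cbn; apply joint_mult; assumption.
Qed.

Lemma vjoint_cross (f g : R -> R -> vec3) :
  vJS f -> vJS g -> vJS (fun e t => cross (f e t) (g e t)).
Proof.
  intros [f1 [f2 f3]] [g1 [g2 g3]]; apply vjoint_intro; cbn;
    apply joint_minus; apply joint_mult; assumption.
Qed.

Lemma joint_dot (f g : R -> R -> vec3) :
  vJS f -> vJS g -> JS (fun e t => dot (f e t) (g e t)).
Proof.
  intros [f1 [f2 f3]] [g1 [g2 g3]]; repeat apply joint_plus; apply joint_mult; assumption.
Qed.

Lemma vjoint_vderiv (f : R -> R -> vec3) : vJS f -> vJS (fun e t => vderiv (f e) t).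
Proof.
  intros [f1 [f2 f3]]; apply vjoint_intro.
  - exact (joint_partial2 _ f1).
  - exact (joint_partial2 _ f2).
  - exact (joint_partial2 _ f3).
Qed.

Lemma vjoint_time (f : R -> vec3) : vsmooth f -> vJS (fun _ t => f t).
Proof.
  intros [f1 [f2 f3]]; apply vjoint_intro;
    [exact (joint_time _ f1)|exact (joint_time _ f2)|exact (joint_time _ f3)].
Qed.

Lemma vjoint_slice (f : R -> R -> vec3) (e : R) :
  vJS f -> Rabs (e - e0) < d -> vsmooth (fun t => f e t).
Proof.
  intros [f1 [f2 f3]] H; split; [|split];
    [exact (joint_slice _ e f1 H)|exact (joint_slice _ e f2 H)|exact (joint_slice _ e f3 H)].
Qed.

Lemma joint_is_derive_RInt (f : R -> R -> R) :
  0 < d -> JS f ->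
  is_derive (fun e => RInt (f e) 0 2) e0 (RInt (fun t => Derive (fun e => f e t) e0) 0 2).
Proof.
  intros Hd Hf; assert (H0 : Rabs (e0 - e0) < d).
  { rewrite Rminus_diag, Rabs_R0; exact Hd. }
  apply (is_derive_RInt_param f).
  - apply (filter_imp _ _ (fun u H t _ => ex_intro _ _ (joint_is_derive1 f u t Hf H))).
    exact (strip_locally e0 d e0 H0).
  - intros t _; exact (joint_continuity _ e0 t (joint_partial1 f Hf) H0).
  - apply (filter_imp (fun u => Rabs (u - e0) < d)); [|exact (strip_locally e0 d e0 H0)].
    intros u H; apply (ex_RInt_continuous (V := R_CompleteNormedModule)); intros t _.
    apply (ex_derive_continuous (V := R_NormedModule)); exact (joint_ex_derive2 f u t Hf H).
Qed.

End JointClosure.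

(** Functions of time alone are tried first: unfolding them would lose the hypotheses that
    assert their smoothness. *)
Ltac joint :=
  repeat first
    [ assumption | apply vjoint_time; assumption | apply joint_time; assumption
    | apply joint_const | apply joint_parameter
    | apply joint_dot | apply joint_minus | apply joint_plus | apply joint_opp | apply joint_mult
    | apply joint_cos | apply joint_sin
    | apply vjoint_add | apply vjoint_scal | apply vjoint_cross
    | apply vjoint_vderiv ].

(** A function of [t] alone is a family with a silent parameter, so that smoothness in one
    variable inherits all the closure properties above. *)
Lemma smooth_of_joint (f : R -> R) : jointly_smooth_near 0 1 (fun _ t => f t) -> smooth f.
Proof. intros H; apply (joint_slice 0 1 (fun _ t => f t) 0 H); rewrite Rminus_0_r, Rabs_R0; lra. Qed.

Lemma vsmooth_of_joint (f : R -> vec3) :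
  vjointly_smooth_near 0 1 (fun _ t => f t) -> vsmooth f.
Proof.
  intros H; apply (vjoint_slice 0 1 (fun _ t => f t) 0 H); rewrite Rminus_0_r, Rabs_R0; lra.
Qed.

(** * Calculus of smooth periodic functions *)

Lemma smooth_is_derive (f : R -> R) (t : R) : smooth f -> is_derive f t (Derive f t).
Proof. intros H; apply Derive_correct, smooth_ex_derive, H. Qed.

Lemma smooth_continuous (f : R -> R) (t : R) : smooth f -> continuous f t.
Proof. intros H; apply (ex_derive_continuous (V := R_NormedModule)), smooth_ex_derive, H. Qed.

Lemma smooth_ex_RInt (f : R -> R) (a b : R) : smooth f -> ex_RInt f a b.
Proof.
  intros H; apply (ex_RInt_continuous (V := R_CompleteNormedModule)); intros t _.
  apply smooth_continuous, H.
Qed.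

Lemma smooth_of_derive (f g : R -> R) :
  (forall t, is_derive f t (g t)) -> smooth g -> smooth f.
Proof.
  intros D Hg [|[|n]] t; [exact I|exists (g t); apply D|].
  apply (ex_derive_ext (Derive_n g n)); [|exact (Hg (S n) t)].
  intros s; rewrite <- (Derive_n_ext (Derive f) g n s).
  - exact (eq_trans (Derive_n_comp f n 1 s)
      (f_equal (fun m => Derive_n f m s) (Nat.add_1_r n))).
  - intros u; apply is_derive_unique, D.
Qed.

Lemma is_derive_value (f : R -> R) (t l l' : R) : is_derive f t l -> l = l' -> is_derive f t l'.
Proof. intros H <-; exact H. Qed.

Lemma constant_of_derive_0 (f : R -> R) :
  (forall t, is_derive f t 0) -> forall s t, f s = f t.
Proof.
  intros D s t; destruct (MVT_gen f t s (fun _ => 0)) as [c [_ E]].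
  - intros; apply D.
  - intros; apply derivable_continuous_pt, ex_derive_Reals_0; exists 0; apply D.
  - lra.
Qed.

Lemma is_derive_shift (f : R -> R) (l t : R) :
  is_derive f (t + 2) l -> is_derive (fun s => f (s + 2)) t l.
Proof.
  intros H; replace l with (scal 1 l) by apply (scal_one (K := R_Ring)).
  apply (is_derive_comp f (fun s => s + 2)); [exact H|].
  auto_derive; [exact I|reflexivity].
Qed.

Lemma Derive_periodic2 (f : R -> R) : smooth f -> periodic2 f -> periodic2 (Derive f).
Proof.
  intros S P t; symmetry; apply is_derive_unique.
  apply (is_derive_ext (fun s => f (s + 2))); [exact P|].
  apply is_derive_shift, smooth_is_derive, S.
Qed.

Lemma vderiv_periodic2 (f : R -> vec3) : vsmooth f -> periodic2 f -> periodic2 (vderiv f).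
Proof.
  intros [S1 [S2 S3]] P t; apply vec3_eq.
  - apply (Derive_periodic2 (fun s => vx (f s)) S1); intros s; rewrite P; reflexivity.
  - apply (Derive_periodic2 (fun s => vy (f s)) S2); intros s; rewrite P; reflexivity.
  - apply (Derive_periodic2 (fun s => vz (f s)) S3); intros s; rewrite P; reflexivity.
Qed.

Lemma periodic2_reduce {T : Type} (f : R -> T) (t : R) :
  periodic2 f -> exists s, 0 <= s <= 2 /\ f t = f s.
Proof.
  intros P.
  assert (N : forall n : nat, forall s, f (s + 2 * INR n) = f s).
  { induction n as [|n IH]; intros s; [f_equal; simpl; ring|].
    rewrite S_INR, <- (IH s), <- (P (s + 2 * INR n)); f_equal; ring. }
  assert (Z : forall z : Z, forall s, f (s + 2 * IZR z) = f s).
  { intros [|p|p] s; [f_equal; ring| |].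
    - rewrite <- (N (Pos.to_nat p) s), INR_IZR_INZ, positive_nat_Z; reflexivity.
    - rewrite <- (N (Pos.to_nat p) (s + 2 * IZR (Zneg p))).
      rewrite INR_IZR_INZ, positive_nat_Z, <- Pos2Z.opp_pos, opp_IZR; f_equal; ring. }
  exists (t - 2 * IZR (Int_part (t / 2))); split.
  - destruct (base_Int_part (t / 2)); lra.
  - rewrite <- (Z (Int_part (t / 2)) (t - _)); f_equal; ring.
Qed.

Lemma is_derive_primitive (f : R -> R) (t : R) :
  smooth f -> is_derive (fun s => RInt f 0 s) t (f t).
Proof.
  intros H; apply (is_derive_RInt f _ 0).
  - apply filter_forall; intros s; apply (RInt_correct (V := R_CompleteNormedModule)).
    apply smooth_ex_RInt, H.
  - apply smooth_continuous, H.
Qed.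

Lemma smooth_primitive (f : R -> R) : smooth f -> smooth (fun s => RInt f 0 s).
Proof. intros H; apply (smooth_of_derive _ f); [intros; apply is_derive_primitive|]; exact H. Qed.

Lemma primitive_periodic2 (f : R -> R) :
  smooth f -> periodic2 f -> RInt f 0 2 = 0 -> periodic2 (fun s => RInt f 0 s).
Proof.
  intros S P Z t.
  assert (E := constant_of_derive_0 (fun s => RInt f 0 (s + 2) - RInt f 0 s)).
  assert (E' : RInt f 0 (t + 2) - RInt f 0 t = RInt f 0 (0 + 2) - RInt f 0 0).
  { apply E; intros s; apply (is_derive_value _ _ (f (s + 2) - f s)).
    - apply (is_derive_minus (fun s => RInt f 0 (s + 2)) (fun s => RInt f 0 s));
        [apply (is_derive_shift (fun s => RInt f 0 s))|]; apply is_derive_primitive, S.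
    - rewrite P; ring. }
  rewrite Rplus_0_l, Z, (RInt_point (V := R_CompleteNormedModule)) in E'.
  change zero with 0 in E'; lra.
Qed.

Lemma RInt_derive_periodic2 (f df : R -> R) :
  (forall t, is_derive f t (df t)) -> smooth df -> f 2 = f 0 -> RInt df 0 2 = 0.
Proof.
  intros D S P; apply is_RInt_unique.
  replace 0 with (minus (f 2) (f 0)) at 2 by (rewrite P; apply (minus_eq_zero (G := R_AbelianGroup))).
  apply (is_RInt_derive f df); intros t _; [apply D|apply smooth_continuous, S].
Qed.

Lemma RInt_eq (f g : R -> R) (a b : R) : (forall t, f t = g t) -> RInt f a b = RInt g a b.
Proof. intros H; apply RInt_ext; intros; apply H. Qed.

Lemma RInt_plus_smooth (f g : R -> R) (a b : R) :
  smooth f -> smooth g -> RInt (fun t => f t + g t) a b = RInt f a b + RInt g a b.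
Proof. intros; apply (RInt_plus (V := R_CompleteNormedModule)); apply smooth_ex_RInt; assumption. Qed.

Lemma RInt_scal_smooth (k : R) (f : R -> R) (a b : R) :
  smooth f -> RInt (fun t => k * f t) a b = k * RInt f a b.
Proof. intros; apply (RInt_scal (V := R_CompleteNormedModule)); apply smooth_ex_RInt; assumption. Qed.

Lemma RInt_const_R (c : R) : RInt (fun _ => c) 0 2 = 2 * c.
Proof. rewrite (RInt_const (V := R_CompleteNormedModule)); unfold scal; simpl; unfold mult; simpl; ring. Qed.

Lemma RInt_constant (f : R -> R) (c d : R) :
  (forall t, f t = c) -> 2 * c = d -> RInt f 0 2 = d.
Proof. intros H <-; rewrite (RInt_eq _ _ _ _ H); apply RInt_const_R. Qed.

Lemma RInt_nonneg_eq_0 (f : R -> R) :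
  smooth f -> (forall t, 0 <= f t) -> RInt f 0 2 = 0 -> forall t, 0 <= t <= 2 -> f t = 0.
Proof.
  intros S P Z.
  assert (I : forall t, 0 <= t <= 2 -> RInt f 0 t = 0).
  { intros t Ht.
    assert (E := RInt_Chasles f 0 t 2 (smooth_ex_RInt f 0 t S) (smooth_ex_RInt f t 2 S)).
    change plus with Rplus in E.
    assert (0 <= RInt f 0 t) by (apply RInt_ge_0; auto using smooth_ex_RInt; lra).
    assert (0 <= RInt f t 2) by (apply RInt_ge_0; auto using smooth_ex_RInt; lra).
    lra. }
  assert (J : forall t, 0 < t < 2 -> f t = 0).
  { intros t Ht; rewrite <- (is_derive_unique _ _ _ (is_derive_primitive f t S)).
    rewrite (Derive_ext_loc _ (fun _ => 0)); [apply Derive_const|].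
    assert (Q : 0 < Rmin t (2 - t)) by (apply Rmin_pos; lra).
    exists (mkposreal _ Q); intros s Hs; apply I.
    change (Rabs (s - t) < Rmin t (2 - t)) in Hs.
    assert (A := Rmin_l t (2 - t)); assert (B := Rmin_r t (2 - t)).
    apply Rabs_def2 in Hs; lra. }
  (* a positive value at an end point would persist inside the interval *)
  intros t Ht; destruct (Req_dec (f t) 0) as [E|E]; [exact E|exfalso].
  assert (Pt : 0 < f t) by (specialize (P t); lra).
  destruct (smooth_continuous f t S (fun y => 0 < y) (open_gt 0 (f t) Pt)) as [r Hr].
  assert (Q := cond_pos r).
  set (s := Rmin (r / 2) (1 / 2)).
  assert (0 < s <= 1 / 2) by (split; [apply Rmin_pos; lra|apply Rmin_r]).
  assert (s <= r / 2) by apply Rmin_l.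
  destruct (Rle_dec t 1) as [L|L].
  - assert (K := Hr (t + s)); rewrite J in K by lra; apply (Rlt_irrefl 0); apply K.
    change (Rabs (t + s - t) < r); rewrite Rabs_pos_eq; lra.
  - assert (K := Hr (t - s)); rewrite J in K by lra; apply (Rlt_irrefl 0); apply K.
    change (Rabs (t - s - t) < r); rewrite Rabs_left; lra.
Qed.

(** The pair [(f, g)] turned back by the angle [l t] has derivative zero. *)
Lemma harmonic_system (f g : R -> R) (l : R) :
  (forall t, is_derive f t (l * g t)) -> (forall t, is_derive g t (- l * f t)) ->
  forall t, f t = cos (l * t) * f 0 + sin (l * t) * g 0 /\
            g t = - sin (l * t) * f 0 + cos (l * t) * g 0.
Proof.
  intros Df Dg t.
  assert (E1 := constant_of_derive_0 (fun t => cos (l * t) * f t - sin (l * t) * g t)).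
  assert (E2 := constant_of_derive_0 (fun t => sin (l * t) * f t + cos (l * t) * g t)).
  assert (Xf : forall t, Derive f t = l * g t) by (intros; apply is_derive_unique, Df).
  assert (Xg : forall t, Derive g t = - l * f t) by (intros; apply is_derive_unique, Dg).
  assert (Ef : forall t, ex_derive f t) by (intros s; eexists; apply Df).
  assert (Eg : forall t, ex_derive g t) by (intros s; eexists; apply Dg).
  assert (A := fun H => E1 H t 0); assert (B := fun H => E2 H t 0); clear E1 E2.
  assert (C := cos_sin_unit (l * t)).
  assert (A' : cos (l * t) * f t - sin (l * t) * g t = f 0).
  { rewrite A; [rewrite Rmult_0_r, cos_0, sin_0; ring|].
    intros s; auto_derive; [auto|].
    change (fun x => f x) with f; change (fun x => g x) with g; rewrite Xf, Xg; ring. }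
  assert (B' : sin (l * t) * f t + cos (l * t) * g t = g 0).
  { rewrite B; [rewrite Rmult_0_r, cos_0, sin_0; ring|].
    intros s; auto_derive; [auto|].
    change (fun x => f x) with f; change (fun x => g x) with g; rewrite Xf, Xg; ring. }
  rewrite <- A', <- B'; split.
  - transitivity ((cos (l * t) * cos (l * t) + sin (l * t) * sin (l * t)) * f t);
      [rewrite C|]; ring.
  - transitivity ((cos (l * t) * cos (l * t) + sin (l * t) * sin (l * t)) * g t);
      [rewrite C|]; ring.
Qed.

Lemma cos_double_eq_1 (l : R) : cos (2 * l) = 1 -> exists k : Z, l = IZR k * PI.
Proof. intros H; apply sin_eq_0_0; rewrite cos_2a_sin in H; nra. Qed.

Lemma angle_of_unit (a b : R) : a * a + b * b = 1 -> exists p, cos p = a /\ sin p = b.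
Proof.
  intros H; assert (B : -1 <= a <= 1) by nra.
  assert (E : sqrt (1 - Rsqr a) = Rabs b).
  { rewrite <- sqrt_Rsqr_abs; f_equal; unfold Rsqr; lra. }
  destruct (Rle_dec 0 b) as [P|P].
  - exists (acos a); rewrite cos_acos, sin_acos, E by exact B.
    rewrite Rabs_pos_eq; auto.
  - exists (- acos a); rewrite cos_neg, sin_neg, cos_acos, sin_acos, E by exact B.
    rewrite Rabs_left by lra; split; ring.
Qed.

(** * The functional *)

(** The integrand [tw |g'|^2] of the weighted total twist, for any speed of parametrization. *)
Definition twist_density (g V : R -> vec3) (t : R) : R :=
  dot (vderiv V t) (cross (vderiv g t) (V t)).

Definition total_density (x : framed_loop) : R :=
  RInt (twist_density (curve x) (frame x)) 0 2.

(** The gradient of the functional at a loop of constant speed, as a function of the variation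
    of [g'] and up to a positive factor. *)
Definition moment (x : framed_loop) (t : R) : vec3 :=
  vadd (vscal (twist_density (curve x) (frame x) t - total_density x / 2) (vderiv (curve x) t))
       (cross (vderiv (curve x) t) (vderiv (vderiv (curve x)) t)).

Lemma speed_sqr (x : framed_loop) (t : R) :
  speed (curve x) t * speed (curve x) t = dot (vderiv (curve x) t) (vderiv (curve x) t).
Proof. apply sqrt_sqrt, Rlt_le, dot_vderiv_pos. Qed.

Lemma twist_density_rate (x : framed_loop) (t : R) :
  twist_rate (curve x) (frame x) t * speed (curve x) t * speed (curve x) t =
  twist_density (curve x) (frame x) t.
Proof.
  assert (P := speed_pos x t).
  unfold twist_rate, twist_density, conormal, tangent.
  set (s := speed (curve x) t) in *; clearbody s.
  generalize (vderiv (curve x) t) (vderiv (frame x) t) (frame x t); intros.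
  transitivity ((/ s * s) * (/ s * s) * dot v0 (cross v v1)); [vunf; ring|].
  rewrite Rinv_l by lra; ring.
Qed.

Lemma vsmooth_vderiv (f : R -> vec3) : vsmooth f -> vsmooth (vderiv f).
Proof. intros [? [? ?]]; split; [|split]; apply smooth_Derive; assumption. Qed.

Lemma smooth_twist_density (g V : R -> vec3) :
  vsmooth g -> vsmooth V -> smooth (twist_density g V).
Proof.
  intros Hg HV; apply vsmooth_vderiv in Hg; assert (HV' := vsmooth_vderiv V HV).
  apply smooth_of_joint; unfold twist_density; joint.
Qed.

Lemma smooth_speed (x : framed_loop) : smooth (speed (curve x)).
Proof.
  assert (H := vsmooth_vderiv _ (curve_smooth x)).
  apply smooth_of_joint; apply (joint_sqrt 0 1 (fun _ t => dot (vderiv (curve x) t) (vderiv (curve x) t))).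
  - intros; apply dot_vderiv_pos.
  - joint.
Qed.

Lemma framed_equiv_transport (x y : framed_loop) :
  framed_equiv x y ->
  exists (A : mat3) (r : R) (c : vec3), SO3 A /\ 0 < r /\
    curve y = (fun t => vadd (vscal r (mapply A (curve x t))) c) /\
    (forall t, speed (curve y) t = r * speed (curve x) t) /\
    length (curve y) = r * length (curve x) /\
    (forall t, twist_density (curve y) (frame y) t =
               r * twist_density (curve x) (frame x) t).
Proof.
  intros [A [r [c [th [HA [Hr E]]]]]].
  assert (Ec : curve y = (fun t => vadd (vscal r (mapply A (curve x t))) c)).
  { apply functional_extensionality; intros t; apply E. }
  assert (Ef : frame y = (fun t => mapply A (vadd (vscal (cos (2 * th)) (frame x t))
                 (vscal (sin (2 * th)) (conormal (curve x) (frame x) t))))).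
  { apply functional_extensionality; intros t; apply E. }
  assert (Es : forall t, speed (curve y) t = r * speed (curve x) t).
  { intros t; rewrite Ec; exact (speed_act x A r c HA Hr t). }
  exists A, r, c; split; [exact HA|split; [exact Hr|split; [exact Ec|split; [exact Es|split]]]].
  - rewrite Ec; exact (length_act x A r c HA Hr).
  - intros t; rewrite <- !twist_density_rate, Es, Ec, Ef.
    rewrite (twist_rate_act x A r c _ _ HA Hr (cos_sin_unit _)); field; lra.
Qed.

(** Under a similarity of ratio [r] both the density and the length are multiplied by [r];
    hence the quotient needs no normalization, and families of varying length can be
    differentiated directly. *)
Lemma Tw_formula (x : framed_loop) :
  Tw (class x) = / PI * (total_density x / length (curve x)).
Proof.
  assert (HPI := PI_RGT_0).
  destruct (length2_representative (class x)) as [y [Ly Ey]].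
  rewrite <- Ey, (Tw_class y Ly); apply class_eq in Ey.
  destruct (framed_equiv_transport y x Ey) as [A [r [c [_ [Hr [_ [_ [EL ED]]]]]]]].
  unfold weighted_total_twist.
  rewrite (RInt_eq _ (twist_density (curve y) (frame y)))
    by (intros; apply twist_density_rate).
  unfold total_density; rewrite EL, Ly.
  rewrite (RInt_eq (twist_density (curve x) (frame x))
             (fun t => r * twist_density (curve y) (frame y) t)) by (intros; apply ED).
  rewrite RInt_scal_smooth
    by (apply smooth_twist_density; [apply curve_smooth|apply frame_smooth]).
  field; lra.
Qed.

(** * First variation at constant speed *)

Definition vdiff (u : R -> vec3) (t : R) : Prop :=
  ex_derive (fun s => vx (u s)) t /\ ex_derive (fun s => vy (u s)) t /\
  ex_derive (fun s => vz (u s)) t.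

Lemma vsmooth_vdiff (u : R -> vec3) (t : R) : vsmooth u -> vdiff u t.
Proof. intros [? [? ?]]; split; [|split]; apply smooth_ex_derive; assumption. Qed.

Lemma is_derive_dot (u v : R -> vec3) (t : R) :
  vdiff u t -> vdiff v t ->
  is_derive (fun s => dot (u s) (v s)) t (dot (vderiv u t) (v t) + dot (u t) (vderiv v t)).
Proof.
  intros [u1 [u2 u3]] [v1 [v2 v3]]; rewrite <- Derive_dot by assumption.
  apply Derive_correct.
  assert (L : forall a b c e h k : R -> R, ex_derive a t -> ex_derive b t -> ex_derive c t ->
    ex_derive e t -> ex_derive h t -> ex_derive k t ->
    ex_derive (fun s => a s * b s + c s * e s + h s * k s) t).
  { intros; auto_derive; tauto. }
  exact (L (fun s => vx (u s)) (fun s => vx (v s)) (fun s => vy (u s)) (fun s => vy (v s))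
           (fun s => vz (u s)) (fun s => vz (v s)) u1 v1 u2 v2 u3 v3).
Qed.

Lemma vdiff_cross (u v : R -> vec3) (t : R) :
  vdiff u t -> vdiff v t -> vdiff (fun s => cross (u s) (v s)) t.
Proof.
  assert (L : forall a b c e : R -> R, ex_derive a t -> ex_derive b t -> ex_derive c t ->
    ex_derive e t -> ex_derive (fun s => a s * b s - c s * e s) t).
  { intros; auto_derive; tauto. }
  intros [u1 [u2 u3]] [v1 [v2 v3]]; split; [|split].
  - exact (L (fun s => vy (u s)) (fun s => vz (v s)) (fun s => vz (u s)) (fun s => vy (v s))
             u2 v3 u3 v2).
  - exact (L (fun s => vz (u s)) (fun s => vx (v s)) (fun s => vx (u s)) (fun s => vz (v s))
             u3 v1 u1 v3).
  - exact (L (fun s => vx (u s)) (fun s => vy (v s)) (fun s => vy (u s)) (fun s => vx (v s))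
             u1 v2 u2 v1).
Qed.

Lemma vderiv_cross (u v : R -> vec3) (t : R) :
  vdiff u t -> vdiff v t ->
  vderiv (fun s => cross (u s) (v s)) t =
  vadd (cross (vderiv u t) (v t)) (cross (u t) (vderiv v t)).
Proof.
  assert (L : forall a b c e : R -> R, ex_derive a t -> ex_derive b t -> ex_derive c t ->
    ex_derive e t -> Derive (fun s => a s * b s - c s * e s) t =
    Derive a t * b t - Derive c t * e t + (a t * Derive b t - c t * Derive e t)).
  { intros a b c e Ha Hb Hc He; apply is_derive_unique; auto_derive; [tauto|].
    change (fun x => a x) with a; change (fun x => b x) with b; change (fun x => c x) with c;
      change (fun x => e x) with e; ring. }
  intros [u1 [u2 u3]] [v1 [v2 v3]]; apply vec3_eq.
  - exact (L (fun s => vy (u s)) (fun s => vz (v s)) (fun s => vz (u s)) (fun s => vy (v s))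
             u2 v3 u3 v2).
  - exact (L (fun s => vz (u s)) (fun s => vx (v s)) (fun s => vx (u s)) (fun s => vz (v s))
             u3 v1 u1 v3).
  - exact (L (fun s => vx (u s)) (fun s => vy (v s)) (fun s => vy (u s)) (fun s => vx (v s))
             u1 v2 u2 v1).
Qed.

Lemma dot_add_r (u v w : vec3) : dot u (vadd v w) = dot u v + dot u w.
Proof. vunf; ring. Qed.

Lemma is_derive_triple (u v w : R -> vec3) (t : R) :
  vdiff u t -> vdiff v t -> vdiff w t ->
  is_derive (fun s => dot (u s) (cross (v s) (w s))) t
    (dot (vderiv u t) (cross (v t) (w t)) + dot (u t) (cross (vderiv v t) (w t))
     + dot (u t) (cross (v t) (vderiv w t))).
Proof.
  intros Hu Hv Hw; eapply is_derive_value.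
  - exact (is_derive_dot u (fun s => cross (v s) (w s)) t Hu (vdiff_cross v w t Hv Hw)).
  - rewrite vderiv_cross, dot_add_r by assumption; ring.
Qed.

(** Multiplicativity of the determinant: [det A * det B = det (A B^T)]. *)
Lemma triple_mult (u v w a b c : vec3) :
  dot u (cross v w) * dot a (cross b c) =
  dot u a * (dot v b * dot w c - dot v c * dot w b)
  - dot u b * (dot v a * dot w c - dot v c * dot w a)
  + dot u c * (dot v a * dot w b - dot v b * dot w a).
Proof.
  destruct u as [[? ?] ?], v as [[? ?] ?], w as [[? ?] ?], a as [[? ?] ?], b as [[? ?] ?],
    c as [[? ?] ?]; vunf; ring.
Qed.

Lemma dot_comm (u v : vec3) : dot u v = dot v u.
Proof. vunf; ring. Qed.

Lemma dot_cross_self (u v : vec3) : dot (cross u v) (cross u v) = dot u u * dot v v - dot u v * dot u v.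
Proof. vunf; ring. Qed.

(** Here [T = g'], [E = g''], and [n = eta'], [b] are the velocities of [g'] and [V]. In the
    orthogonal frame [T], [V], [T x V] the orthogonality relations fix every component of [b]
    except the one along [T x V], which measures the rotation of the frame and cancels. *)
Lemma variation_identity (T E V V' n b : vec3) (r : R) :
  0 < r -> dot T T = r * r -> dot V V = 1 -> dot V T = 0 -> dot E T = 0 -> dot V' V = 0 ->
  dot V' T + dot V E = 0 -> dot b V = 0 -> dot b T + dot V n = 0 ->
  dot V' (cross n V) + dot V' (cross T b) - dot b (cross E V) - dot b (cross T V') =
  / (r * r) * dot n (vadd (vscal (dot V' (cross T V)) T) (cross T E)).
Proof.
  intros Hr TT VV VT ET V'V V'T bV bT.
  set (W := cross T V).
  assert (TW : dot T W = 0) by (unfold W; vunf; ring).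
  assert (VW : dot V W = 0) by (unfold W; vunf; ring).
  assert (F : dot T (cross V W) = r * r).
  { rewrite <- TT; transitivity (dot T T * dot V V - dot V T * dot V T).
    - unfold W; vunf; ring.
    - rewrite VV, VT; ring. }
  assert (K : forall u v w, dot u (cross v w) = / (r * r) *
            (dot u T * (dot v V * dot w W - dot v W * dot w V)
             - dot u V * (dot v T * dot w W - dot v W * dot w T)
             + dot u W * (dot v T * dot w V - dot v V * dot w T))).
  { intros u v w; rewrite <- triple_mult, F; field; lra. }
  replace (dot n (vadd (vscal (dot V' W) T) (cross T E)))
    with (dot V' W * dot n T + dot n (cross T E)) by (vunf; ring).
  rewrite (K V' n V), (K V' T b), (K b E V), (K b T V'), (K n T E).
  rewrite (dot_comm V n) in bT; rewrite (dot_comm V E) in V'T.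
  assert (TV : dot T V = 0) by (rewrite dot_comm; exact VT).
  assert (V'T' : dot V' T = - dot E V) by lra.
  assert (bT' : dot b T = - dot n V) by lra.
  rewrite VV, VT, TT, VW, TW, TV, ET, V'V, bV, V'T', bT'.
  field; lra.
Qed.

Section FirstVariation.
Variables (X : R -> framed_loop) (d r : R).
Hypotheses (Hd : 0 < d) (Hr : 0 < r).
Hypothesis Hcurve : vjointly_smooth_near 0 d (fun e t => curve (X e) t).
Hypothesis Hframe : vjointly_smooth_near 0 d (fun e t => frame (X e) t).
Hypothesis Hspeed : forall t, speed (curve (X 0)) t = r.

Let eta (t : R) : vec3 := vderiv (fun e => curve (X e) t) 0.
Let beta (t : R) : vec3 := vderiv (fun e => frame (X e) t) 0.
Let g := curve (X 0).
Let V := frame (X 0).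

Let H0 : Rabs (0 - 0) < d.
Proof. rewrite Rminus_diag, Rabs_R0; exact Hd. Qed.

Lemma vjoint_velocity (f : R -> R -> vec3) :
  vjointly_smooth_near 0 d f -> vsmooth (fun t => vderiv (fun e => f e t) 0).
Proof.
  intros [f1 [f2 f3]]; split; [|split].
  - exact (joint_slice 0 d _ 0 (joint_partial1 0 d _ f1) H0).
  - exact (joint_slice 0 d _ 0 (joint_partial1 0 d _ f2) H0).
  - exact (joint_slice 0 d _ 0 (joint_partial1 0 d _ f3) H0).
Qed.

Lemma vjoint_vdiff (f : R -> R -> vec3) (t : R) :
  vjointly_smooth_near 0 d f -> vdiff (fun e => f e t) 0.
Proof.
  intros [f1 [f2 f3]]; split; [|split]; eexists.
  - exact (joint_is_derive1 0 d _ 0 t f1 H0).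
  - exact (joint_is_derive1 0 d _ 0 t f2 H0).
  - exact (joint_is_derive1 0 d _ 0 t f3 H0).
Qed.

Lemma vjoint_schwarz (f : R -> R -> vec3) (t : R) :
  vjointly_smooth_near 0 d f ->
  vderiv (fun e => vderiv (f e) t) 0 = vderiv (fun s => vderiv (fun e => f e s) 0) t.
Proof.
  intros [f1 [f2 f3]]; apply vec3_eq.
  - exact (joint_schwarz 0 d _ 0 t f1 H0).
  - exact (joint_schwarz 0 d _ 0 t f2 H0).
  - exact (joint_schwarz 0 d _ 0 t f3 H0).
Qed.

Let Sg : vsmooth g := curve_smooth (X 0).
Let SV : vsmooth V := frame_smooth (X 0).
Let Sg' : vsmooth (vderiv g) := vsmooth_vderiv g Sg.
Let Seta : vsmooth eta := vjoint_velocity _ Hcurve.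
Let Sbeta : vsmooth beta := vjoint_velocity _ Hframe.

Let Jcurve' : vjointly_smooth_near 0 d (fun e t => vderiv (curve (X e)) t) :=
  vjoint_vderiv 0 d (fun e t => curve (X e) t) Hcurve.
Let Jframe' : vjointly_smooth_near 0 d (fun e t => vderiv (frame (X e)) t) :=
  vjoint_vderiv 0 d (fun e t => frame (X e) t) Hframe.
Let curve_schwarz (t : R) : vderiv (fun e => vderiv (curve (X e)) t) 0 = vderiv eta t :=
  vjoint_schwarz (fun e t => curve (X e) t) t Hcurve.
Let frame_schwarz (t : R) : vderiv (fun e => vderiv (frame (X e)) t) 0 = vderiv beta t :=
  vjoint_schwarz (fun e t => frame (X e) t) t Hframe.

Lemma speed_constant_normal (t : R) : dot (vderiv (vderiv g) t) (vderiv g t) = 0.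
Proof.
  assert (E := is_derive_dot _ _ t (vsmooth_vdiff _ t Sg') (vsmooth_vdiff _ t Sg')).
  apply is_derive_unique in E.
  rewrite (Derive_ext _ (fun _ => r * r)), Derive_const in E.
  - rewrite (dot_comm (vderiv g t)) in E; lra.
  - intros s; unfold g; rewrite <- speed_sqr, Hspeed; reflexivity.
Qed.

Lemma is_derive_density (t : R) :
  Derive (fun e => twist_density (curve (X e)) (frame (X e)) t) 0 =
  dot (vderiv beta t) (cross (vderiv g t) (V t))
  + dot (vderiv V t) (cross (vderiv eta t) (V t))
  + dot (vderiv V t) (cross (vderiv g t) (beta t)).
Proof.
  apply is_derive_unique; eapply is_derive_value.
  - apply (is_derive_triple (fun e => vderiv (frame (X e)) t)
      (fun e => vderiv (curve (X e)) t) (fun e => frame (X e) t)).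
    + exact (vjoint_vdiff _ t Jframe').
    + exact (vjoint_vdiff _ t Jcurve').
    + exact (vjoint_vdiff _ t Hframe).
  - rewrite curve_schwarz, frame_schwarz; reflexivity.
Qed.

(** The first summand is the time derivative of the periodic function [<beta, g' x V>] and
    integrates to zero; in the second one the velocity [beta] of the frame has disappeared. *)
Lemma density_variation (t : R) :
  Derive (fun e => twist_density (curve (X e)) (frame (X e)) t) 0 =
  (dot (vderiv beta t) (cross (vderiv g t) (V t))
   + dot (beta t) (cross (vderiv (vderiv g) t) (V t))
   + dot (beta t) (cross (vderiv g t) (vderiv V t)))
  + / (r * r) * dot (vderiv eta t)
      (vadd (vscal (twist_density g V t) (vderiv g t))
            (cross (vderiv g t) (vderiv (vderiv g) t))).
Proof.
  rewrite is_derive_density.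
  assert (VV : forall e t, dot (frame (X e) t) (frame (X e) t) = 1) by (intros; apply frame_unit).
  assert (VT : forall e t, dot (frame (X e) t) (vderiv (curve (X e)) t) = 0)
    by (intros; apply frame_normal).
  assert (V'V : dot (vderiv V t) (V t) = 0).
  { assert (E := is_derive_dot V V t (vsmooth_vdiff _ t SV) (vsmooth_vdiff _ t SV)).
    apply is_derive_unique in E.
    rewrite (Derive_ext _ (fun _ => 1)), Derive_const, (dot_comm (V t)) in E
      by (intros; apply VV).
    lra. }
  assert (bV : dot (beta t) (V t) = 0).
  { assert (E := is_derive_dot _ _ 0 (vjoint_vdiff _ t Hframe) (vjoint_vdiff _ t Hframe)).
    apply is_derive_unique in E.
    rewrite (Derive_ext _ (fun _ => 1)), Derive_const, (dot_comm (frame (X 0) t)) in E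
      by (intros; apply VV).
    fold (beta t) V in E; lra. }
  assert (V'T : dot (vderiv V t) (vderiv g t) + dot (V t) (vderiv (vderiv g) t) = 0).
  { assert (E := is_derive_dot V (vderiv g) t (vsmooth_vdiff _ t SV) (vsmooth_vdiff _ t Sg')).
    apply is_derive_unique in E.
    rewrite (Derive_ext _ (fun _ => 0)), Derive_const in E by (intros; apply VT).
    symmetry; exact E. }
  assert (bT : dot (beta t) (vderiv g t) + dot (V t) (vderiv eta t) = 0).
  { assert (E := is_derive_dot _ _ 0 (vjoint_vdiff _ t Hframe) (vjoint_vdiff _ t Jcurve')).
    apply is_derive_unique in E.
    rewrite (Derive_ext _ (fun _ => 0)), Derive_const in E by (intros; apply VT).
    rewrite curve_schwarz in E.
    symmetry; exact E. }
  assert (TT : dot (vderiv g t) (vderiv g t) = r * r)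
    by (unfold g; rewrite <- speed_sqr, Hspeed; reflexivity).
  assert (I := variation_identity (vderiv g t) (vderiv (vderiv g) t) (V t) (vderiv V t)
    (vderiv eta t) (beta t) r Hr TT (VV 0 t) (VT 0 t) (speed_constant_normal t)
    V'V V'T bV bT).
  unfold twist_density; rewrite <- I; ring.
Qed.

Lemma is_derive_total_density :
  is_derive (fun e => total_density (X e)) 0
    (/ (r * r) * RInt (fun t => dot (vderiv eta t)
       (vadd (vscal (twist_density g V t) (vderiv g t))
             (cross (vderiv g t) (vderiv (vderiv g) t)))) 0 2).
Proof.
  assert (Seta' := vsmooth_vderiv _ Seta); assert (Sbeta' := vsmooth_vderiv _ Sbeta).
  assert (Sg'' := vsmooth_vderiv _ Sg'); assert (SV' := vsmooth_vderiv _ SV).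
  assert (SD := smooth_twist_density g V Sg SV).
  eapply is_derive_value.
  - apply (joint_is_derive_RInt 0 d (fun e t => twist_density (curve (X e)) (frame (X e)) t) Hd).
    unfold twist_density; apply joint_dot; [|apply vjoint_cross].
    + exact Jframe'.
    + exact Jcurve'.
    + exact Hframe.
  - rewrite (RInt_eq _ _ _ _ density_variation).
    rewrite (RInt_plus_smooth
      (fun t => dot (vderiv beta t) (cross (vderiv g t) (V t))
         + dot (beta t) (cross (vderiv (vderiv g) t) (V t))
         + dot (beta t) (cross (vderiv g t) (vderiv V t)))
      (fun t => / (r * r) * dot (vderiv eta t)
      (vadd (vscal (twist_density g V t) (vderiv g t))
            (cross (vderiv g t) (vderiv (vderiv g) t))))).
    + rewrite RInt_scal_smooth by (apply smooth_of_joint; joint).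
      rewrite (RInt_derive_periodic2 (fun t => dot (beta t) (cross (vderiv g t) (V t)))).
      * ring.
      * intros t; apply is_derive_triple; apply vsmooth_vdiff; assumption.
      * apply smooth_of_joint; joint.
      * assert (Pb : beta (0 + 2) = beta 0).
        { unfold beta; f_equal; apply functional_extensionality; intros e.
          apply frame_periodic. }
        assert (Pg := vderiv_periodic2 g Sg (curve_periodic (X 0)) 0).
        assert (PV := frame_periodic (X 0) 0); fold V in PV.
        rewrite Rplus_0_l in *; rewrite Pb, Pg, PV; reflexivity.
    + apply smooth_of_joint; joint.
    + apply smooth_of_joint; joint.
Qed.

Lemma is_derive_length :
  is_derive (fun e => length (curve (X e))) 0
    (/ r * RInt (fun t => dot (vderiv eta t) (vderiv g t)) 0 2).
Proof.
  assert (Seta' := vsmooth_vderiv _ Seta).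
  eapply is_derive_value.
  - apply (joint_is_derive_RInt 0 d (fun e t => speed (curve (X e)) t) Hd).
    apply (joint_sqrt 0 d (fun e t => dot (vderiv (curve (X e)) t) (vderiv (curve (X e)) t))).
    + intros; apply dot_vderiv_pos.
    + exact (joint_dot 0 d _ _ Jcurve' Jcurve').
  - rewrite <- RInt_scal_smooth by (apply smooth_of_joint; joint).
    apply RInt_eq; intros t; apply is_derive_unique.
    assert (P := dot_vderiv_pos (X 0) t).
    assert (S := Hspeed t); unfold speed, vnorm in S.
    assert (D := is_derive_dot _ _ 0 (vjoint_vdiff _ t Jcurve') (vjoint_vdiff _ t Jcurve')).
    cbv beta in D; rewrite curve_schwarz in D.
    eapply is_derive_value;
      [exact (is_derive_sqrt _ 0 _ D P)|].
    cbv beta; rewrite S, (dot_comm (vderiv (curve (X 0)) t)).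
    fold g; fold (eta); simpl; field; lra.
Qed.

(** Quotient rule for [G / L] with [L = 2 r]; the variation of the length supplies the mean
    value that is subtracted from the density in the moment. *)
Theorem first_variation :
  is_derive (fun e => Tw (class (X e))) 0
    (/ (2 * PI * r * r * r) * RInt (fun t => dot (vderiv eta t) (moment (X 0) t)) 0 2).
Proof.
  assert (HPI := PI_RGT_0).
  assert (L : length g = 2 * r).
  { unfold length; rewrite (RInt_eq _ (fun _ => r)) by (intros; apply Hspeed).
    apply RInt_const_R. }
  apply (is_derive_ext (fun e => / PI * (total_density (X e) / length (curve (X e))))).
  { intros e; symmetry; apply Tw_formula. }
  assert (Seta' := vsmooth_vderiv _ Seta); assert (Sg'' := vsmooth_vderiv _ Sg').
  assert (SD := smooth_twist_density g V Sg SV).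
  eapply is_derive_value.
  - apply is_derive_scal, is_derive_div;
      [exact is_derive_total_density|exact is_derive_length|].
    fold g; rewrite L; lra.
  - cbv beta; fold g; rewrite L.
    rewrite (RInt_eq (fun t => dot (vderiv eta t) (moment (X 0) t))
      (fun t => dot (vderiv eta t) (vadd (vscal (twist_density g V t) (vderiv g t))
                  (cross (vderiv g t) (vderiv (vderiv g) t)))
                + - (total_density (X 0) / 2) * dot (vderiv eta t) (vderiv g t))).
    + rewrite RInt_plus_smooth, RInt_scal_smooth by (apply smooth_of_joint; joint).
      field; lra.
    + intros t; unfold moment; fold g V; vunf; ring.
Qed.

End FirstVariation.

Lemma class_ext (x y : framed_loop) :
  (forall t, curve y t = curve x t) -> (forall t, frame y t = frame x t) -> class x = class y.
Proof.
  intros Ec Ef; apply class_eq; exists mid, 1, vzero, 0.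
  split; [exact SO3_mid|split; [lra|]].
  intros t; rewrite Rmult_0_r, cos_0, sin_0, !mapply_mid, Ec, Ef; unfold vzero; split; vring.
Qed.

Lemma critical_along (x : framed_loop) (X : R -> framed_loop) (d : R) :
  critical_point Tw (class x) -> 0 < d ->
  vjointly_smooth_near 0 d (fun e t => curve (X e) t) ->
  vjointly_smooth_near 0 d (fun e t => frame (X e) t) ->
  (forall t, curve (X 0) t = curve x t) -> (forall t, frame (X 0) t = frame x t) ->
  is_derive (fun e => Tw (class (X e))) 0 0.
Proof.
  intros H Hd Jc Jf Ec Ef; apply (H (fun e => class (X e))).
  - exists d, X; repeat split; try exact Hd; apply Jc || apply Jf.
  - symmetry; apply class_ext; assumption.
Qed.

Lemma ex_derive_mult1 (k f : R -> R) (t : R) :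
  ex_derive k t -> ex_derive f t -> ex_derive (fun s => k s * f s) t.
Proof. intros; auto_derive; tauto. Qed.

Lemma vdiff_scal (k : R -> R) (u : R -> vec3) (t : R) :
  ex_derive k t -> vdiff u t -> vdiff (fun s => vscal (k s) (u s)) t.
Proof.
  intros Hk [u1 [u2 u3]]; split; [|split].
  - exact (ex_derive_mult1 k (fun s => vx (u s)) t Hk u1).
  - exact (ex_derive_mult1 k (fun s => vy (u s)) t Hk u2).
  - exact (ex_derive_mult1 k (fun s => vz (u s)) t Hk u3).
Qed.

Lemma vderiv_scal (k : R -> R) (u : R -> vec3) (t : R) :
  ex_derive k t -> vdiff u t ->
  vderiv (fun s => vscal (k s) (u s)) t = vadd (vscal (Derive k t) (u t)) (vscal (k t) (vderiv u t)).
Proof.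
  intros Hk [u1 [u2 u3]]; apply vec3_eq.
  - exact (Derive_mult k (fun s => vx (u s)) t Hk u1).
  - exact (Derive_mult k (fun s => vy (u s)) t Hk u2).
  - exact (Derive_mult k (fun s => vz (u s)) t Hk u3).
Qed.

Lemma vderiv_add (u v : R -> vec3) (t : R) :
  vdiff u t -> vdiff v t ->
  vderiv (fun s => vadd (u s) (v s)) t = vadd (vderiv u t) (vderiv v t).
Proof.
  intros [u1 [u2 u3]] [v1 [v2 v3]]; apply vec3_eq.
  - exact (Derive_plus (fun s => vx (u s)) (fun s => vx (v s)) t u1 v1).
  - exact (Derive_plus (fun s => vy (u s)) (fun s => vy (v s)) t u2 v2).
  - exact (Derive_plus (fun s => vz (u s)) (fun s => vz (v s)) t u3 v3).
Qed.

Lemma dot_derive_unit (u : R -> vec3) (t : R) :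
  vdiff u t -> (forall s, dot (u s) (u s) = 1) -> dot (vderiv u t) (u t) = 0.
Proof.
  intros D U; assert (E := is_derive_dot u u t D D); apply is_derive_unique in E.
  rewrite (Derive_ext _ (fun _ => 1)), Derive_const, (dot_comm (u t)) in E by (intros; apply U).
  lra.
Qed.

Lemma dot_derive_orthogonal (u v : R -> vec3) (t : R) :
  vdiff u t -> vdiff v t -> (forall s, dot (u s) (v s) = 0) ->
  dot (vderiv u t) (v t) + dot (u t) (vderiv v t) = 0.
Proof.
  intros Du Dv U; assert (E := is_derive_dot u v t Du Dv); apply is_derive_unique in E.
  rewrite (Derive_ext _ (fun _ => 0)), Derive_const in E by (intros; apply U).
  lra.
Qed.

(** * Rotating the frame: critical points have constant speed *)

Lemma smooth_inv_speed (x : framed_loop) : smooth (fun t => / speed (curve x) t).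
Proof.
  assert (H := vsmooth_vderiv _ (curve_smooth x)).
  apply smooth_of_joint;
    apply (joint_inv_sqrt 0 1 (fun _ t => dot (vderiv (curve x) t) (vderiv (curve x) t))).
  - intros; apply dot_vderiv_pos.
  - joint.
Qed.

Lemma vsmooth_conormal (x : framed_loop) : vsmooth (conormal (curve x) (frame x)).
Proof.
  assert (H := vsmooth_vderiv _ (curve_smooth x)); assert (K := smooth_inv_speed x).
  assert (F := frame_smooth x).
  apply vsmooth_of_joint; unfold conormal, tangent; joint.
Qed.

Lemma speed_periodic2 (x : framed_loop) : periodic2 (speed (curve x)).
Proof.
  intros t; unfold speed.
  rewrite (vderiv_periodic2 _ (curve_smooth x) (curve_periodic x) t); reflexivity.
Qed.

Lemma conormal_periodic2 (x : framed_loop) : periodic2 (conormal (curve x) (frame x)).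
Proof.
  intros t; unfold conormal, tangent.
  rewrite (speed_periodic2 x t), (frame_periodic x t).
  rewrite (vderiv_periodic2 _ (curve_smooth x) (curve_periodic x) t); reflexivity.
Qed.

Section FrameRotation.
Variables (x : framed_loop) (a : R -> R).
Hypotheses (Ha : smooth a) (Pa : periodic2 a).
Let g := curve x.
Let V := frame x.
Let W := conormal g V.

Definition rotated_frame (e t : R) : vec3 :=
  vadd (vscal (cos (e * a t)) (V t)) (vscal (sin (e * a t)) (W t)).

Lemma rotated_frame_joint (e0 d : R) : vjointly_smooth_near e0 d rotated_frame.
Proof.
  assert (F := frame_smooth x : vsmooth V); assert (K := vsmooth_conormal x : vsmooth W).
  unfold rotated_frame; joint.
Qed.

Lemma rotated_frame_smooth (e : R) : vsmooth (rotated_frame e).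
Proof.
  apply (vjoint_slice e 1 rotated_frame e (rotated_frame_joint e 1)).
  rewrite Rminus_diag, Rabs_R0; lra.
Qed.

Lemma rotated_frame_periodic (e : R) : periodic2 (rotated_frame e).
Proof.
  intros t; unfold rotated_frame, W, V, g.
  rewrite Pa, (frame_periodic x t), (conormal_periodic2 x t); reflexivity.
Qed.

Lemma rotated_frame_unit (e t : R) : dot (rotated_frame e t) (rotated_frame e t) = 1.
Proof.
  assert (VV := frame_unit x t : dot (V t) (V t) = 1).
  assert (WW := conormal_unit x t : dot (W t) (W t) = 1).
  assert (WV := conormal_normal x t : dot (W t) (V t) = 0).
  unfold rotated_frame; rewrite <- (cos_sin_unit (e * a t)).
  set (c := cos (e * a t)); set (s := sin (e * a t)).
  transitivity (c * c * dot (V t) (V t) + s * s * dot (W t) (W t) + 2 * c * s * dot (W t) (V t));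
    [vunf|rewrite VV, WW, WV]; ring.
Qed.

Lemma conormal_vderiv (t : R) : dot (W t) (vderiv g t) = 0.
Proof. unfold W, conormal, tangent; generalize (/ speed g t) (vderiv g t); intros; vunf; ring. Qed.

Lemma rotated_frame_normal (e t : R) : dot (rotated_frame e t) (vderiv g t) = 0.
Proof.
  assert (VT := frame_normal x t : dot (V t) (vderiv g t) = 0).
  assert (WT := conormal_vderiv t).
  unfold rotated_frame; set (c := cos (e * a t)); set (s := sin (e * a t)).
  transitivity (c * dot (V t) (vderiv g t) + s * dot (W t) (vderiv g t));
    [vunf|rewrite VT, WT]; ring.
Qed.

Definition rotated_loop (e : R) : framed_loop :=
  @FramedLoop g (rotated_frame e) (curve_smooth x) (rotated_frame_smooth e)
    (curve_periodic x) (rotated_frame_periodic e) (curve_immersion x)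
    (rotated_frame_unit e) (rotated_frame_normal e).

(** The twist rate of the frame rotated by the angle [e a] exceeds that of [V] by [e] times the
    arclength derivative of [a]; the density carries two more factors [speed]. *)
Lemma rotated_density (e t : R) :
  twist_density g (rotated_frame e) t =
  twist_density g V t + e * (Derive a t * speed g t).
Proof.
  assert (SV := frame_smooth x : vsmooth V); assert (SW := vsmooth_conormal x : vsmooth W).
  assert (DV := vsmooth_vdiff V t SV); assert (DW := vsmooth_vdiff W t SW).
  assert (VV := frame_unit x t : dot (V t) (V t) = 1).
  assert (WW := conormal_unit x t : dot (W t) (W t) = 1).
  assert (WV := conormal_normal x t : dot (W t) (V t) = 0).
  assert (V'V := dot_derive_unit V t DV (frame_unit x)).
  assert (W'W := dot_derive_unit W t DW (conormal_unit x)).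
  assert (W'V := dot_derive_orthogonal W V t DW DV (conormal_normal x)).
  assert (Da := smooth_is_derive a t Ha).
  assert (Ea := smooth_ex_derive a t Ha).
  assert (P := speed_pos x t); fold g in P.
  assert (Tg : vderiv g t = vscal (speed g t) (tangent g t)).
  { unfold tangent; apply vec3_eq; cbn; fold g; field; lra. }
  assert (TW : cross (tangent g t) (W t) = vscal (-1) (V t)) by exact (cross_tangent_conormal x t).
  assert (Dc : is_derive (fun s => cos (e * a s)) t (- (e * Derive a t * sin (e * a t)))).
  { auto_derive; [exact Ea|change (fun x => a x) with a; ring]. }
  assert (Ds : is_derive (fun s => sin (e * a s)) t (e * Derive a t * cos (e * a t))).
  { auto_derive; [exact Ea|change (fun x => a x) with a; ring]. }
  assert (Ec : ex_derive (fun s => cos (e * a s)) t) by (eexists; exact Dc).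
  assert (Es : ex_derive (fun s => sin (e * a s)) t) by (eexists; exact Ds).
  assert (Xc : Derive (fun s : R => cos (e * a s)) t = - (e * Derive a t * sin (e * a t)))
    by exact (is_derive_unique _ _ _ Dc).
  assert (Xs : Derive (fun s : R => sin (e * a s)) t = e * Derive a t * cos (e * a t))
    by exact (is_derive_unique _ _ _ Ds).
  unfold twist_density, rotated_frame; rewrite vderiv_add by (apply vdiff_scal; assumption).
  rewrite !vderiv_scal by assumption.
  rewrite Xc, Xs.
  assert (U := cos_sin_unit (e * a t)).
  set (c := cos (e * a t)) in *; set (s := sin (e * a t)) in *.
  set (k := e * Derive a t); set (r := speed g t) in *.
  assert (C1 : cross (vderiv g t) (V t) = vscal r (W t)) by (rewrite Tg; unfold W, conormal; vring).
  assert (C2 : cross (vderiv g t) (W t) = vscal (- r) (V t)).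
  { transitivity (vscal r (cross (tangent g t) (W t))); [rewrite Tg|rewrite TW]; vring. }
  transitivity (dot (vadd (vadd (vscal (- (k * s)) (V t)) (vscal c (vderiv V t)))
                          (vadd (vscal (k * c) (W t)) (vscal s (vderiv W t))))
                    (vadd (vscal c (cross (vderiv g t) (V t)))
                          (vscal s (cross (vderiv g t) (W t)))));
    [vunf; ring|].
  rewrite C1, C2.
  transitivity (r * ((c * c * dot (vderiv V t) (W t) - s * s * dot (vderiv W t) (V t)
     + c * s * (dot (vderiv W t) (W t) - dot (vderiv V t) (V t)))
     + k * (s * s * dot (V t) (V t) + c * c * dot (W t) (W t) - 2 * s * c * dot (W t) (V t))));
    [vunf; ring|].
  rewrite (dot_comm (W t)) in W'V.
  rewrite VV, WW, WV, V'V, W'W.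
  replace (dot (vderiv W t) (V t)) with (- dot (vderiv V t) (W t)) by lra.
  transitivity ((c * c + s * s) * (r * dot (vderiv V t) (W t) + r * k)); [ring|].
  rewrite U; unfold k; transitivity (dot (vderiv V t) (vscal r (W t)) + e * (Derive a t * r));
    [vunf; ring|reflexivity].
Qed.

End FrameRotation.

(** The functional is affine along the rotations of the frame by [e a], with slope proportional
    to the integral of [a' * speed]. The choice [a' = speed - 1] is possible because [speed - 1]
    has mean zero. *)
Lemma critical_speed (x : framed_loop) :
  length (curve x) = 2 -> critical_point Tw (class x) -> forall t, speed (curve x) t = 1.
Proof.
  intros Lx H.
  set (g := curve x) in *; set (f := fun t => speed g t - 1).
  assert (Ss := smooth_speed x : smooth (speed g)).
  assert (Sf : smooth f) by (apply smooth_of_joint; unfold f; joint).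
  assert (Pf : periodic2 f) by (intros t; unfold f, g; rewrite (speed_periodic2 x t); reflexivity).
  assert (Zf : RInt f 0 2 = 0 :> R).
  { unfold f; rewrite (RInt_eq _ (fun t => speed g t + -1)) by (intros; ring).
    rewrite (RInt_plus_smooth (speed g) (fun _ => -1)), RInt_const_R
      by (assumption || (apply smooth_of_joint; joint)).
    fold (length g); lra. }
  set (a := fun t => RInt f 0 t).
  assert (Sa : smooth a) by exact (smooth_primitive f Sf).
  assert (Pa : periodic2 a) by exact (primitive_periodic2 f Sf Pf Zf).
  assert (Da : forall t, Derive a t = f t) by (intros; apply is_derive_unique, is_derive_primitive, Sf).
  set (X := rotated_loop x a Sa Pa).
  assert (SD := smooth_twist_density g (frame x) (curve_smooth x) (frame_smooth x)).
  assert (D : is_derive (fun e => Tw (class (X e))) 0 0).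
  { apply (critical_along x X 1 H); [lra| | | |].
    - apply (vjoint_time 0 1 g), curve_smooth.
    - apply rotated_frame_joint; assumption.
    - reflexivity.
    - intros t; cbn; unfold rotated_frame; rewrite Rmult_0_l, cos_0, sin_0; vring. }
  assert (E : forall e, Tw (class (X e)) =
                / PI * ((total_density x + e * RInt (fun t => f t * speed g t) 0 2) / 2)).
  { intros e; rewrite Tw_formula; cbn [curve X rotated_loop]; fold g; rewrite Lx.
    do 2 f_equal; unfold total_density; cbn [curve frame X rotated_loop].
    rewrite (RInt_eq _ (fun t => twist_density g (frame x) t + e * (f t * speed g t))).
    - rewrite (RInt_plus_smooth (twist_density g (frame x)) (fun t => e * (f t * speed g t))),
        (RInt_scal_smooth e (fun t => f t * speed g t))
        by (assumption || (apply smooth_of_joint; joint)).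
      reflexivity.
    - intros t; rewrite <- Da; apply (rotated_density x a Sa). }
  assert (HPI := PI_RGT_0).
  assert (K : RInt (fun t => f t * speed g t) 0 2 = 0 :> R).
  { set (I := RInt (fun t => f t * speed g t) 0 2 : R) in *.
    assert (D' : is_derive (fun e => Tw (class (X e))) 0 (/ PI * (I / 2))).
    { apply (is_derive_ext (fun e => / PI * ((total_density x + e * I) / 2)));
        [intros; symmetry; apply E|auto_derive; [exact Logic.I|field; lra]]. }
    assert (U := eq_trans (eq_sym (is_derive_unique _ _ _ D')) (is_derive_unique _ _ _ D)).
    apply (f_equal (Rmult (2 * PI))) in U; rewrite Rmult_0_r in U; rewrite <- U.
    change (@eq R I (2 * PI * (/ PI * (I / 2)))); field; lra. }
  (* [int f = 0] turns [int f * speed] into [int f^2] *)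
  assert (Q : RInt (fun t => f t * f t) 0 2 = 0 :> R).
  { rewrite (RInt_eq _ (fun t => f t * speed g t + -1 * f t)) by (intros; unfold f; ring).
    rewrite (RInt_plus_smooth (fun t => f t * speed g t) (fun t => -1 * f t)), RInt_scal_smooth
      by (assumption || (apply smooth_of_joint; joint)).
    rewrite K, Zf; ring. }
  intros t; destruct (periodic2_reduce (speed g) t (speed_periodic2 x)) as [s [Hs ->]].
  assert (F := RInt_nonneg_eq_0 (fun t => f t * f t) ltac:(apply smooth_of_joint; joint)
                 ltac:(intros; nra) Q s Hs).
  cbv beta in F; unfold f in F; nra.
Qed.

(** * Moving the curve: critical points have constant moment *)

Definition vRInt (f : R -> vec3) (a b : R) : vec3 :=
  (RInt (fun t => vx (f t)) a b, RInt (fun t => vy (f t)) a b, RInt (fun t => vz (f t)) a b).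

Lemma vderiv_primitive (f : R -> vec3) (t : R) :
  vsmooth f -> vderiv (fun s => vRInt f 0 s) t = f t.
Proof.
  intros [f1 [f2 f3]]; apply vec3_eq; apply is_derive_unique.
  - exact (is_derive_primitive _ t f1).
  - exact (is_derive_primitive _ t f2).
  - exact (is_derive_primitive _ t f3).
Qed.

Lemma vsmooth_primitive (f : R -> vec3) : vsmooth f -> vsmooth (fun s => vRInt f 0 s).
Proof.
  intros [f1 [f2 f3]]; split; [|split].
  - exact (smooth_primitive _ f1).
  - exact (smooth_primitive _ f2).
  - exact (smooth_primitive _ f3).
Qed.

Lemma vprimitive_periodic2 (f : R -> vec3) :
  vsmooth f -> periodic2 f -> vRInt f 0 2 = vzero -> periodic2 (fun s => vRInt f 0 s).
Proof.
  intros [f1 [f2 f3]] P Z t.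
  apply vec3_eq.
  - apply (primitive_periodic2 _ f1); [intros s; rewrite P; reflexivity|exact (f_equal vx Z)].
  - apply (primitive_periodic2 _ f2); [intros s; rewrite P; reflexivity|exact (f_equal vy Z)].
  - apply (primitive_periodic2 _ f3); [intros s; rewrite P; reflexivity|exact (f_equal vz Z)].
Qed.

Lemma RInt_dot_const (f : R -> vec3) (w : vec3) :
  vsmooth f -> RInt (fun t => dot (f t) w) 0 2 = dot (vRInt f 0 2) w.
Proof.
  intros [f1 [f2 f3]].
  rewrite (RInt_eq _ (fun t => vx w * vx (f t) + vy w * vy (f t) + vz w * vz (f t)))
    by (intros; unfold dot; ring).
  rewrite !RInt_plus_smooth, !RInt_scal_smooth
    by (assumption || (apply smooth_of_joint; joint)).
  unfold dot, vRInt; cbn -[RInt]; ring.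
Qed.

Lemma periodic2_bounded (f : R -> R) :
  smooth f -> periodic2 f -> exists M, 0 < M /\ forall t, Rabs (f t) <= M.
Proof.
  intros S P.
  destruct (continuity_ab_maj (fun t => f t * f t) 0 2) as [m [Hm _]]; [lra| |].
  - intros t _; apply smooth_continuity, smooth_of_joint; joint.
  - exists (1 + f m * f m); split; [nra|].
    intros t; destruct (periodic2_reduce f t P) as [s [Hs ->]].
    specialize (Hm s Hs); cbv beta in Hm.
    unfold Rabs; destruct (Rcase_abs (f s)); nra.
Qed.

Lemma vsmooth_moment (x : framed_loop) : vsmooth (moment x).
Proof.
  assert (S1 := vsmooth_vderiv _ (curve_smooth x)); assert (S2 := vsmooth_vderiv _ S1).
  assert (SD := smooth_twist_density _ _ (curve_smooth x) (frame_smooth x)).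
  apply vsmooth_of_joint; unfold moment; joint.
Qed.

Lemma moment_periodic2 (x : framed_loop) : periodic2 (moment x).
Proof.
  intros t; unfold moment, twist_density.
  rewrite (frame_periodic x t), (vderiv_periodic2 _ (frame_smooth x) (frame_periodic x) t).
  assert (P := vderiv_periodic2 _ (curve_smooth x) (curve_periodic x)).
  rewrite (P t), (vderiv_periodic2 _ (vsmooth_vderiv _ (curve_smooth x)) P t); reflexivity.
Qed.

Lemma vec3_eq_of_dot (a b : vec3) :
  dot (vadd a (vscal (-1) b)) (vadd a (vscal (-1) b)) = 0 -> a = b.
Proof.
  intros F; destruct (sumsq0 _ _ _ F) as [F1 [F2 F3]]; clear F.
  destruct a as [[? ?] ?], b as [[? ?] ?]; apply vec3_eq; vunf; lra.
Qed.

Section CurveVariation.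
Variables (x : framed_loop) (eta : R -> vec3).
Hypothesis Hspeed : forall t, speed (curve x) t = 1.
Hypotheses (Seta : vsmooth eta) (Peta : periodic2 eta).
Hypothesis Beta : forall t, Rabs (dot (vderiv eta t) (vderiv (curve x) t)) <= 1 / 2.
Let g := curve x.
Let V := frame x.

(** The parameter enters through [sin e], which is bounded and has derivative 1 at 0: the bound
    on [eta'] keeps the curve immersed for every real [e], so the family needs no cut-off. *)
Definition moved_curve (e t : R) : vec3 := vadd (g t) (vscal (sin e) (eta t)).

(** The projection of [V] to the normal plane of the moved curve, multiplied by [|T|^2] to avoid
    a division. *)
Definition projected_frame (e t : R) : vec3 :=
  let T := vderiv (moved_curve e) t in
  vadd (vscal (dot T T) (V t)) (vscal (- dot (V t) T) T).

Definition moved_frame (e t : R) : vec3 :=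
  vscal (/ sqrt (dot (projected_frame e t) (projected_frame e t))) (projected_frame e t).

Lemma vderiv_moved (e t : R) :
  vderiv (moved_curve e) t = vadd (vderiv g t) (vscal (sin e) (vderiv eta t)).
Proof.
  unfold moved_curve; transitivity (vadd (vscal 1 (vderiv g t)) (vscal (sin e) (vderiv eta t)));
    [|vring].
  destruct (vsmooth_vdiff g t (curve_smooth x)) as [? [? ?]].
  destruct (vsmooth_vdiff eta t Seta) as [? [? ?]].
  rewrite <- vderiv_comb by assumption.
  f_equal; apply functional_extensionality; intros s; vring.
Qed.

Lemma tangent_dot (t : R) : dot (vderiv g t) (vderiv g t) = 1.
Proof. unfold g; rewrite <- speed_sqr, Hspeed; ring. Qed.

Lemma moved_dot_tangent (e t : R) : 1 / 2 <= dot (vderiv (moved_curve e) t) (vderiv g t).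
Proof.
  rewrite vderiv_moved; assert (B := Beta t); assert (T := tangent_dot t); fold g in B.
  replace (dot (vadd (vderiv g t) (vscal (sin e) (vderiv eta t))) (vderiv g t))
    with (dot (vderiv g t) (vderiv g t) + sin e * dot (vderiv eta t) (vderiv g t)) by (vunf; ring).
  rewrite T; destruct (SIN_bound e); set (b := dot (vderiv eta t) (vderiv g t)) in *.
  assert (A : Rabs (sin e * b) <= 1 * (1 / 2)).
  { rewrite Rabs_mult; apply Rmult_le_compat; try apply Rabs_pos; [apply Rabs_le; lra|exact B]. }
  assert (C := Rle_abs (- (sin e * b))); rewrite Rabs_Ropp in C; lra.
Qed.

Lemma projected_frame_pos (e t : R) : 0 < dot (projected_frame e t) (projected_frame e t).
Proof.
  assert (H := moved_dot_tangent e t); assert (TT := tangent_dot t).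
  assert (VV := frame_unit x t : dot (V t) (V t) = 1).
  assert (VT := frame_normal x t : dot (V t) (vderiv g t) = 0).
  unfold projected_frame; cbv zeta; set (u := vderiv (moved_curve e) t) in *.
  replace (dot (vadd (vscal (dot u u) (V t)) (vscal (- dot (V t) u) u))
               (vadd (vscal (dot u u) (V t)) (vscal (- dot (V t) u) u)))
    with (dot u u * (dot u u * dot (V t) (V t) - dot (V t) u * dot (V t) u)) by (vunf; ring).
  rewrite VV.
  (* [|u|^2 - <V, u>^2] is the squared norm of the projection, at least [<g', u>^2] *)
  assert (E : dot u u = dot u (vderiv g t) * dot u (vderiv g t) + dot (V t) u * dot (V t) u
                + dot u (cross (vderiv g t) (V t)) * dot u (cross (vderiv g t) (V t))).
  { rewrite triple_mult, (dot_comm (vderiv g t) (V t)), VT, TT, VV, (dot_comm (V t) u),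
      (dot_comm (vderiv g t) u); ring. }
  apply Rmult_lt_0_compat; [rewrite E|rewrite Rmult_1_r; rewrite E at 1]; nra.
Qed.

Lemma moved_curve_joint (e0 d : R) : vjointly_smooth_near e0 d moved_curve.
Proof. assert (G := curve_smooth x : vsmooth g); unfold moved_curve; joint. Qed.

Lemma moved_frame_joint (e0 d : R) : vjointly_smooth_near e0 d moved_frame.
Proof.
  assert (F := frame_smooth x : vsmooth V).
  assert (J : vjointly_smooth_near e0 d (fun e t => vderiv (moved_curve e) t))
    by exact (vjoint_vderiv e0 d moved_curve (moved_curve_joint e0 d)).
  assert (K : vjointly_smooth_near e0 d projected_frame)
    by (unfold projected_frame; cbv zeta; joint).
  apply vjoint_scal; [|exact K].
  apply (joint_inv_sqrt e0 d (fun e t => dot (projected_frame e t) (projected_frame e t))).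
  - intros; apply projected_frame_pos.
  - joint.
Qed.

Lemma moved_curve_smooth (e : R) : vsmooth (moved_curve e).
Proof.
  apply (vjoint_slice e 1 moved_curve e (moved_curve_joint e 1)).
  rewrite Rminus_diag, Rabs_R0; lra.
Qed.

Lemma moved_frame_smooth (e : R) : vsmooth (moved_frame e).
Proof.
  apply (vjoint_slice e 1 moved_frame e (moved_frame_joint e 1)).
  rewrite Rminus_diag, Rabs_R0; lra.
Qed.

Lemma moved_curve_periodic (e : R) : periodic2 (moved_curve e).
Proof. intros t; unfold moved_curve, g; rewrite Peta, (curve_periodic x t); reflexivity. Qed.

Lemma moved_frame_periodic (e : R) : periodic2 (moved_frame e).
Proof.
  intros t; unfold moved_frame, projected_frame, V.
  rewrite (vderiv_periodic2 _ (moved_curve_smooth e) (moved_curve_periodic e) t).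
  rewrite (frame_periodic x t); reflexivity.
Qed.

Lemma moved_immersion (e t : R) : vderiv (moved_curve e) t <> vzero.
Proof.
  intros E; assert (H := moved_dot_tangent e t); rewrite E in H.
  replace (dot vzero (vderiv g t)) with 0 in H by (unfold vzero; vunf; ring); lra.
Qed.

Lemma moved_frame_unit (e t : R) : dot (moved_frame e t) (moved_frame e t) = 1.
Proof.
  assert (P := projected_frame_pos e t); assert (Q := sqrt_lt_R0 _ P).
  unfold moved_frame; set (u := projected_frame e t) in *.
  transitivity (/ sqrt (dot u u) * / sqrt (dot u u) * dot u u).
  - generalize (/ sqrt (dot u u)); intros; vunf; ring.
  - rewrite <- (sqrt_sqrt (dot u u)) at 3 by lra; field; lra.
Qed.

Lemma moved_frame_normal (e t : R) : dot (moved_frame e t) (vderiv (moved_curve e) t) = 0.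
Proof.
  unfold moved_frame, projected_frame; cbv zeta; set (u := vderiv (moved_curve e) t).
  generalize (/ sqrt (dot (vadd (vscal (dot u u) (V t)) (vscal (- dot (V t) u) u))
               (vadd (vscal (dot u u) (V t)) (vscal (- dot (V t) u) u)))).
  intros; vunf; ring.
Qed.

Definition moved_loop (e : R) : framed_loop :=
  @FramedLoop (moved_curve e) (moved_frame e) (moved_curve_smooth e) (moved_frame_smooth e)
    (moved_curve_periodic e) (moved_frame_periodic e) (moved_immersion e)
    (moved_frame_unit e) (moved_frame_normal e).

Lemma moved_curve_0 (t : R) : moved_curve 0 t = g t.
Proof. unfold moved_curve; rewrite sin_0; vring. Qed.

Lemma moved_frame_0 (t : R) : moved_frame 0 t = V t.
Proof.
  assert (VT := frame_normal x t : dot (V t) (vderiv g t) = 0).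
  assert (VV := frame_unit x t : dot (V t) (V t) = 1).
  assert (P : projected_frame 0 t = V t).
  { unfold projected_frame; cbv zeta.
    replace (vderiv (moved_curve 0) t) with (vderiv g t)
      by (rewrite vderiv_moved, sin_0; vring).
    rewrite tangent_dot, VT; vring. }
  unfold moved_frame; rewrite P, VV, sqrt_1, Rinv_1; vring.
Qed.

Lemma moved_velocity (t : R) : vderiv (fun e => moved_curve e t) 0 = eta t.
Proof.
  unfold moved_curve; apply vec3_eq; cbn; apply is_derive_unique; auto_derive;
    try exact I; rewrite cos_0; ring.
Qed.

Lemma critical_moment_orthogonal :
  critical_point Tw (class x) -> RInt (fun t => dot (vderiv eta t) (moment x t)) 0 2 = 0 :> R.
Proof.
  intros H; assert (HPI := PI_RGT_0).
  assert (Ec : curve (moved_loop 0) = curve x)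
    by (apply functional_extensionality; exact moved_curve_0).
  assert (Ef : frame (moved_loop 0) = frame x)
    by (apply functional_extensionality; exact moved_frame_0).
  assert (D : is_derive (fun e => Tw (class (moved_loop e))) 0 0).
  { apply (critical_along x moved_loop 1 H); [lra| | | |].
    - exact (moved_curve_joint 0 1).
    - exact (moved_frame_joint 0 1).
    - intros t; rewrite Ec; reflexivity.
    - intros t; rewrite Ef; reflexivity. }
  assert (F := first_variation moved_loop 1 1 Rlt_0_1 Rlt_0_1 (moved_curve_joint 0 1)
                 (moved_frame_joint 0 1) ltac:(rewrite Ec; exact Hspeed)).
  assert (U := eq_trans (eq_sym (is_derive_unique _ _ _ D)) (is_derive_unique _ _ _ F)).
  assert (Ee : (fun t => vderiv (fun e => curve (moved_loop e) t) 0) = eta)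
    by (apply functional_extensionality; exact moved_velocity).
  assert (Em : moment (moved_loop 0) = moment x)
    by (unfold moment, total_density; rewrite Ec, Ef; reflexivity).
  rewrite Ee, Em in U.
  apply (f_equal (Rmult (2 * PI))) in U; rewrite Rmult_0_r in U.
  assert (A : forall I, 0 = 2 * PI * (/ (2 * PI * 1 * 1 * 1) * I) -> I = 0).
  { intros I E; rewrite E; field; lra. }
  exact (A _ U).
Qed.

End CurveVariation.

(** The admissible derivatives [eta'] are the periodic fields of mean zero. Testing against a small
    multiple of [z = Z - mean Z] gives that the integral of [|z|^2] vanishes. *)
Lemma critical_moment (x : framed_loop) :
  (forall t, speed (curve x) t = 1) -> critical_point Tw (class x) ->
  exists l, forall t, moment x t = l.
Proof.
  intros Hs H.
  set (m := vscal (1 / 2) (vRInt (moment x) 0 2)).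
  set (z := fun t => vadd (moment x t) (vscal (-1) m)).
  assert (Sm := vsmooth_moment x).
  assert (Sc : vsmooth (fun _ => m)).
  { destruct m as [[? ?] ?]; split; [|split]; apply smooth_of_joint; cbn; joint. }
  assert (Sz : vsmooth z) by (apply vsmooth_of_joint; unfold z; joint; exact (vjoint_time 0 1 _ Sc)).
  assert (Pz : periodic2 z) by (intros t; unfold z; rewrite moment_periodic2; reflexivity).
  assert (Zz : vRInt z 0 2 = vzero).
  { assert (L : forall (f : R -> R) c, smooth f -> c = 1 / 2 * RInt f 0 2 ->
              RInt (fun t => f t + -1 * c) 0 2 = 0 :> R).
    { intros f c Sf ->; rewrite (RInt_plus_smooth f (fun _ => -1 * (1 / 2 * RInt f 0 2))),
        RInt_const_R by (assumption || (apply smooth_of_joint; joint)).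
      field. }
    destruct Sm as [m1 [m2 m3]]; apply vec3_eq.
    - exact (L _ _ m1 eq_refl).
    - exact (L _ _ m2 eq_refl).
    - exact (L _ _ m3 eq_refl). }
  assert (Sg := vsmooth_vderiv _ (curve_smooth x)).
  destruct (periodic2_bounded (fun t => dot (z t) (vderiv (curve x) t))) as [B [HB Bz]].
  { apply smooth_of_joint; joint. }
  { intros t; rewrite Pz, (vderiv_periodic2 _ (curve_smooth x) (curve_periodic x) t); reflexivity. }
  set (k := / (2 * B)).
  assert (Hk : 0 < k) by (apply Rinv_0_lt_compat; lra).
  assert (Sp := vsmooth_primitive z Sz).
  set (eta := fun t => vscal k (vRInt z 0 t)).
  assert (Seta : vsmooth eta) by (apply vsmooth_of_joint; unfold eta; joint).
  assert (Peta : periodic2 eta).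
  { intros t; unfold eta; f_equal; exact (vprimitive_periodic2 z Sz Pz Zz t). }
  assert (Deta : forall t, vderiv eta t = vscal k (z t)).
  { intros t; unfold eta.
    rewrite (vderiv_scal (fun _ => k) (fun s => vRInt z 0 s)), Derive_const, vderiv_primitive;
      [vring|exact Sz|apply ex_derive_const|apply vsmooth_vdiff, Sp]. }
  assert (O : RInt (fun t => dot (vderiv eta t) (moment x t)) 0 2 = 0 :> R).
  { apply critical_moment_orthogonal; try assumption.
    intros t; rewrite Deta.
    replace (dot (vscal k (z t)) (vderiv (curve x) t))
      with (k * dot (z t) (vderiv (curve x) t)) by (vunf; ring).
    rewrite Rabs_mult, (Rabs_pos_eq k) by lra.
    apply Rle_trans with (k * B); [apply Rmult_le_compat_l; [lra|apply Bz]|].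
    unfold k; right; field; lra. }
  assert (Q : RInt (fun t => dot (z t) (z t)) 0 2 = 0 :> R).
  { rewrite (RInt_eq _ (fun t => / k * dot (vderiv eta t) (moment x t) + -1 * dot (z t) m)).
    - assert (Seta' := vsmooth_vderiv _ Seta).
      rewrite RInt_plus_smooth, !RInt_scal_smooth, O, RInt_dot_const, Zz
        by (assumption || (apply smooth_of_joint; joint; exact (vjoint_time 0 1 _ Sc))).
      unfold vzero; vunf; ring.
    - intros t; rewrite Deta.
      transitivity ((/ k * k) * dot (z t) (moment x t) + -1 * dot (z t) m).
      + rewrite Rinv_l by lra; unfold z; vunf; ring.
      + generalize (z t) (moment x t) (/ k); intros; vunf; ring. }
  exists m; intros t.
  destruct (periodic2_reduce (moment x) t (moment_periodic2 x)) as [s [Is ->]].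
  assert (F := RInt_nonneg_eq_0 (fun t => dot (z t) (z t)) ltac:(apply smooth_of_joint; joint)
                 ltac:(intros; unfold dot; nra) Q s Is).
  exact (vec3_eq_of_dot _ _ F).
Qed.

(** * Constant moment is sufficient *)

(** A curve of classes through [class x] lifts to a family of loops starting at a loop equivalent
    to [x], not at [x] itself; constant speed and constant moment are inherited by that loop. *)
Lemma critical_of_moment (x : framed_loop) (l : vec3) :
  (forall t, speed (curve x) t = 1) -> (forall t, moment x t = l) ->
  critical_point Tw (class x).
Proof.
  intros Hs Hm c [d [X [Hd [Jc [Jf E]]]]] c0.
  assert (H0 : Rabs (0 - 0) < d) by (rewrite Rminus_diag, Rabs_R0; exact Hd).
  assert (Q : framed_equiv x (X 0)) by (apply class_eq; rewrite <- c0; apply E, H0).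
  destruct (framed_equiv_transport x (X 0) Q) as [A [r [b [HA [Hr [Ec [Es [_ ED]]]]]]]].
  assert (Sg := vsmooth_vderiv _ (curve_smooth x)).
  assert (D1 : forall t, vderiv (curve (X 0)) t = vscal r (mapply A (vderiv (curve x) t))).
  { intros t; rewrite Ec; exact (vderiv_act x A r b t). }
  assert (D2 : forall t, vderiv (vderiv (curve (X 0))) t =
                 vscal r (mapply A (vderiv (vderiv (curve x)) t))).
  { intros t; replace (vderiv (curve (X 0)))
      with (fun s => vadd (vscal r (mapply A (vderiv (curve x) s))) vzero).
    - destruct (vsmooth_vdiff _ t Sg) as [? [? ?]]; apply vderiv_affine; assumption.
    - apply functional_extensionality; intros s; rewrite D1; unfold vzero; vring. }
  assert (Hm' : forall t, moment (X 0) t = vscal (r * r) (mapply A l)).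
  { intros t; rewrite <- (Hm t); unfold moment; rewrite D1, D2, ED.
    replace (total_density (X 0)) with (r * total_density x).
    - transitivity (vscal (r * r)
        (vadd (vscal (twist_density (curve x) (frame x) t - total_density x / 2)
                     (mapply A (vderiv (curve x) t)))
              (vscal 1 (cross (mapply A (vderiv (curve x) t))
                     (mapply A (vderiv (vderiv (curve x)) t)))))).
      + generalize (mapply A (vderiv (curve x) t)) (mapply A (vderiv (vderiv (curve x)) t)).
        intros; apply vec3_eq; unfold vadd, vscal, cross, vx, vy, vz; cbn; field.
      + rewrite SO3_mapply_cross, <- mapply_lin by exact HA; do 2 f_equal; vring.
    - unfold total_density; rewrite <- RInt_scal_smooth
        by (apply smooth_twist_density; [apply curve_smooth|apply frame_smooth]).
      apply RInt_eq; intros; symmetry; apply ED. }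
  apply (is_derive_ext_loc (fun e => Tw (class (X e)))).
  { apply (filter_imp (fun e => Rabs (e - 0) < d)); [|exact (strip_locally 0 d 0 H0)].
    intros e He; rewrite (E e He); reflexivity. }
  eapply is_derive_value.
  - apply (first_variation X d r Hd Hr Jc Jf).
    intros t; rewrite Es, Hs; ring.
  - (* for constant [m] the function [<eta', m>] is the derivative of [<eta, m>] *)
    set (eta := fun t => vderiv (fun e => curve (X e) t) 0).
    assert (Seta : vsmooth eta) by exact (vjoint_velocity d Hd _ Jc).
    assert (Seta' := vsmooth_vderiv _ Seta).
    set (m := vscal (r * r) (mapply A l)) in *.
    assert (Sm : vsmooth (fun _ => m)).
    { destruct m as [[? ?] ?]; split; [|split]; apply smooth_of_joint; cbn; joint. }
    rewrite (RInt_eq _ (fun t => dot (vderiv eta t) m)) by (intros; rewrite Hm'; reflexivity).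
    rewrite (RInt_derive_periodic2 (fun t => dot (eta t) m)); [ring| | |].
    + intros t; eapply is_derive_value;
        [exact (is_derive_dot eta (fun _ => m) t (vsmooth_vdiff _ t Seta) (vsmooth_vdiff _ t Sm))|].
      replace (vderiv (fun _ => m) t) with vzero
        by (apply vec3_eq; unfold vderiv; cbn; rewrite Derive_const; reflexivity).
      unfold vzero; vunf; ring.
    + apply smooth_of_joint; joint; exact (vjoint_time 0 1 _ Sm).
    + assert (Pe : eta (0 + 2) = eta 0).
      { unfold eta; f_equal; apply functional_extensionality; intros e; apply curve_periodic. }
      rewrite Rplus_0_l in Pe; rewrite Pe; reflexivity.
Qed.

(** * From constant moment to a circle *)

Lemma vconst_of_derive_0 (f : R -> vec3) :
  (forall t, vdiff f t) -> (forall t, vderiv f t = vzero) -> forall s t, f s = f t.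
Proof.
  intros D Z s t; apply vec3_eq.
  - apply (constant_of_derive_0 (fun s => vx (f s))); intros r.
    eapply is_derive_value; [apply Derive_correct, D|exact (f_equal vx (Z r))].
  - apply (constant_of_derive_0 (fun s => vy (f s))); intros r.
    eapply is_derive_value; [apply Derive_correct, D|exact (f_equal vy (Z r))].
  - apply (constant_of_derive_0 (fun s => vz (f s))); intros r.
    eapply is_derive_value; [apply Derive_correct, D|exact (f_equal vz (Z r))].
Qed.

Lemma vharmonic_system (f g : R -> vec3) (w : R) :
  (forall t, vdiff f t) -> (forall t, vdiff g t) ->
  (forall t, vderiv f t = vscal w (g t)) -> (forall t, vderiv g t = vscal (- w) (f t)) ->
  forall t, f t = vadd (vscal (cos (w * t)) (f 0)) (vscal (sin (w * t)) (g 0)) /\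
            g t = vadd (vscal (- sin (w * t)) (f 0)) (vscal (cos (w * t)) (g 0)).
Proof.
  intros Df Dg Ef Eg t.
  destruct (harmonic_system (fun s => vx (f s)) (fun s => vx (g s)) w) with (t := t) as [X1 X2].
  { intros r; eapply is_derive_value; [apply Derive_correct, Df|exact (f_equal vx (Ef r))]. }
  { intros r; eapply is_derive_value; [apply Derive_correct, Dg|exact (f_equal vx (Eg r))]. }
  destruct (harmonic_system (fun s => vy (f s)) (fun s => vy (g s)) w) with (t := t) as [Y1 Y2].
  { intros r; eapply is_derive_value; [apply Derive_correct, Df|exact (f_equal vy (Ef r))]. }
  { intros r; eapply is_derive_value; [apply Derive_correct, Dg|exact (f_equal vy (Eg r))]. }
  destruct (harmonic_system (fun s => vz (f s)) (fun s => vz (g s)) w) with (t := t) as [Z1 Z2].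
  { intros r; eapply is_derive_value; [apply Derive_correct, Df|exact (f_equal vz (Ef r))]. }
  { intros r; eapply is_derive_value; [apply Derive_correct, Dg|exact (f_equal vz (Eg r))]. }
  split; apply vec3_eq; assumption.
Qed.

Lemma vsmooth_const (c : vec3) : vsmooth (fun _ => c).
Proof. destruct c as [[? ?] ?]; split; [|split]; apply smooth_of_joint; cbn; joint. Qed.

Lemma vderiv_const (c : vec3) (t : R) : vderiv (fun _ => c) t = vzero.
Proof. unfold vderiv, vzero; rewrite !Derive_const; reflexivity. Qed.

Lemma is_derive_dot_const (f : R -> vec3) (c : vec3) (t : R) :
  vdiff f t -> is_derive (fun s => dot (f s) c) t (dot (vderiv f t) c).
Proof.
  intros D; eapply is_derive_value.
  - exact (is_derive_dot f (fun _ => c) t D (vsmooth_vdiff _ t (vsmooth_const c))).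
  - rewrite vderiv_const; unfold vzero; vunf; ring.
Qed.

Lemma RInt_tangent_dot (x : framed_loop) (c : vec3) :
  RInt (fun t => dot (vderiv (curve x) t) c) 0 2 = 0.
Proof.
  assert (S := curve_smooth x); assert (S' := vsmooth_vderiv _ S).
  apply (RInt_derive_periodic2 (fun t => dot (curve x t) c)).
  - intros t; apply is_derive_dot_const, vsmooth_vdiff, S.
  - assert (Sc := vsmooth_const c).
    apply smooth_of_joint; joint; exact (vjoint_time 0 1 _ Sc).
  - assert (P := curve_periodic x 0); rewrite Rplus_0_l in P; rewrite P; reflexivity.
Qed.

(** Unit speed and closing up after time 2 in [h] turns force the radius [/ (h PI)]. *)
Definition uniform_circle (x : framed_loop) (h : nat) (p u v : vec3) : Prop :=
  dot u u = 1 /\ dot v v = 1 /\ dot u v = 0 /\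
  (forall t, curve x t = vadd p (vscal (/ (INR h * PI))
     (vadd (vscal (cos (INR h * PI * t)) u) (vscal (sin (INR h * PI * t)) v)))) /\
  (forall t, vderiv (curve x) t =
     vadd (vscal (- sin (INR h * PI * t)) u) (vscal (cos (INR h * PI * t)) v)).

(** Pairing [l = (D - mean D) T + T x T'] with [T'] and with [T] shows that [<T, l>] is constant
    and equal to [D - mean D]; the curve being closed, the constant is zero. There remains
    [T' = l x T] with [l] normal to [T], so [T] and the radial direction [n = - T' / |l|] form a
    harmonic system, and [g - n / |l|] is the centre. *)
Lemma moment_circle (x : framed_loop) (l : vec3) :
  (forall t, speed (curve x) t = 1) -> (forall t, moment x t = l) ->
  (exists h p u v, (1 <= h)%nat /\ uniform_circle x h p u v) /\
  forall t, twist_density (curve x) (frame x) t = total_density x / 2.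
Proof.
  intros Hs Hm.
  set (T := vderiv (curve x)); set (E := vderiv T).
  set (D := twist_density (curve x) (frame x)); set (b := total_density x / 2).
  assert (ST : vsmooth T) by apply vsmooth_vderiv, curve_smooth.
  assert (SE : vsmooth E) by apply vsmooth_vderiv, ST.
  assert (TT : forall t, dot (T t) (T t) = 1) by (intros; unfold T; rewrite <- speed_sqr, Hs; ring).
  assert (ET : forall t, dot (E t) (T t) = 0)
    by (intros; apply dot_derive_unit; [apply vsmooth_vdiff, ST|exact TT]).
  assert (M : forall t, l = vadd (vscal (D t - b) (T t)) (cross (T t) (E t)))
    by (intros t; rewrite <- (Hm t); reflexivity).
  assert (Tl : forall t, dot (T t) l = D t - b).
  { intros t; rewrite (M t); transitivity ((D t - b) * dot (T t) (T t));
      [generalize (T t) (E t); intros; vunf; ring|rewrite TT; ring]. }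
  assert (El : forall t, dot (E t) l = 0).
  { intros t; rewrite (M t); transitivity ((D t - b) * dot (E t) (T t));
      [generalize (T t) (E t); intros; vunf; ring|rewrite ET; ring]. }
  assert (C : forall t, dot (T t) l = dot (T 0) l).
  { intros t; apply (constant_of_derive_0 (fun t => dot (T t) l)); intros s.
    eapply is_derive_value; [apply is_derive_dot_const, vsmooth_vdiff, ST|apply El]. }
  assert (Z : forall t, dot (T t) l = 0).
  { assert (I := RInt_tangent_dot x l); fold T in I.
    rewrite (RInt_eq _ _ _ _ C), RInt_const_R in I.
    intros t; rewrite C; lra. }
  assert (HD : forall t, D t = b) by (intros t; specialize (Tl t); rewrite Z in Tl; lra).
  split; [|exact HD].
  assert (M' : forall t, l = cross (T t) (E t)).
  { intros t; rewrite (M t), HD; vring. }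
  assert (EE : forall t, E t = cross l (T t)).
  { intros t; rewrite (M' t).
    transitivity (vadd (vscal (dot (T t) (T t)) (E t)) (vscal (- dot (E t) (T t)) (T t)));
      [rewrite TT, ET|]; generalize (T t) (E t); intros; vring. }
  assert (LL : 0 < dot l l).
  { destruct (Req_dec (dot l l) 0) as [N|N]; [exfalso|unfold dot in *; nra].
    (* if [l = 0] then [T] is constant, and a curve of constant velocity does not close up *)
    destruct (sumsq0 _ _ _ N) as [N1 [N2 N3]].
    assert (E0 : forall t, vderiv T t = vzero).
    { intros t; fold E; rewrite EE; replace l with vzero by (apply vec3_eq; symmetry; assumption).
      generalize (T t); unfold vzero; intros; vring. }
    assert (CT := vconst_of_derive_0 T (fun t => vsmooth_vdiff T t ST) E0).
    assert (I := RInt_tangent_dot x (T 0)); fold T in I.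
    rewrite (RInt_eq _ (fun _ => 1)), RInt_const_R in I by (intros t; rewrite (CT t 0); apply TT).
    lra. }
  set (w := sqrt (dot l l)).
  assert (Hw : 0 < w) by (apply sqrt_lt_R0, LL).
  assert (Ww : w * w = dot l l) by (apply sqrt_sqrt; lra).
  assert (DE : forall t, vderiv E t = vscal (- (w * w)) (T t)).
  { intros t; replace E with (fun s => cross l (T s)) at 1
      by (apply functional_extensionality; intros; symmetry; apply EE).
    rewrite (vderiv_cross (fun _ => l) T t (vsmooth_vdiff _ t (vsmooth_const l)) (vsmooth_vdiff T t ST)).
    fold (E t); rewrite EE, vderiv_const, Ww.
    transitivity (vadd (vscal (dot (T t) l) l) (vscal (- dot l l) (T t)));
      [|rewrite Z]; generalize (T t); unfold vzero; intros; vring. }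
  set (n := fun t => vscal (- / w) (E t)).
  assert (Sn : vsmooth n) by (apply vsmooth_of_joint; unfold n; joint).
  assert (Dn : forall t, vderiv n t = vscal w (T t)).
  { intros t; unfold n.
    rewrite (vderiv_scal (fun _ => - / w) E) by (apply ex_derive_const || apply vsmooth_vdiff, SE).
    rewrite Derive_const, DE; generalize (E t) (T t); intros.
    apply vec3_eq; unfold vadd, vscal, vx, vy, vz; cbn; field; lra. }
  assert (DT : forall t, vderiv T t = vscal (- w) (n t)).
  { intros t; fold E; unfold n; generalize (E t); intros.
    apply vec3_eq; unfold vadd, vscal, vx, vy, vz; cbn; field; lra. }
  assert (H := vharmonic_system n T w (fun t => vsmooth_vdiff n t Sn)
                 (fun t => vsmooth_vdiff T t ST) Dn DT).
  assert (UU : dot (n 0) (n 0) = 1).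
  { transitivity (/ w * / w * dot (E 0) (E 0)); [unfold n; generalize (E 0); intros; vunf; ring|].
    rewrite EE, dot_cross_self, TT, (dot_comm l (T 0)), Z, <- Ww; field; lra. }
  assert (UV : dot (n 0) (T 0) = 0).
  { transitivity (- / w * dot (E 0) (T 0));
      [unfold n; generalize (E 0) (T 0); intros; vunf; ring|rewrite ET; ring]. }
  assert (Pn : n 2 = n 0).
  { assert (P := vderiv_periodic2 T ST (vderiv_periodic2 _ (curve_smooth x) (curve_periodic x)) 0).
    rewrite Rplus_0_l in P; unfold n; f_equal; exact P. }
  assert (C2 : cos (2 * w) = 1).
  { destruct (H 2) as [H2 _]; rewrite Pn in H2; rewrite (Rmult_comm 2 w).
    assert (K := f_equal (fun a => dot a (n 0)) H2); cbv beta in K.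
    transitivity (cos (w * 2) * dot (n 0) (n 0) + sin (w * 2) * dot (n 0) (T 0)).
    - rewrite UU, UV; ring.
    - rewrite UU in K; rewrite K; generalize (n 0) (T 0); intros; vunf; ring. }
  destruct (cos_double_eq_1 w C2) as [k Hk].
  assert (HPI := PI_RGT_0).
  assert (Pk : (0 < k)%Z) by (apply lt_IZR; nra).
  assert (Eh : INR (Z.to_nat k) * PI = w) by (rewrite INR_IZR_INZ, Z2Nat.id by lia; lra).
  set (p := fun t => vadd (curve x t) (vscal (- / w) (n t))).
  assert (Sc := curve_smooth x).
  assert (Dp : forall t, vderiv p t = vzero).
  { intros t; unfold p.
    rewrite vderiv_add, (vderiv_scal (fun _ => - / w) n), Derive_const, Dn
      by (apply ex_derive_const || (apply vsmooth_vdiff; assumption) ||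
          (apply vdiff_scal; [apply ex_derive_const|apply vsmooth_vdiff; assumption])).
    fold T; generalize (T t) (n t); intros; unfold vzero.
    apply vec3_eq; unfold vadd, vscal, vx, vy, vz; cbn; field; lra. }
  assert (Cp := vconst_of_derive_0 p
    ltac:(intros t; apply vsmooth_vdiff, vsmooth_of_joint; unfold p; joint) Dp).
  exists (Z.to_nat k), (p 0), (n 0), (T 0); split; [lia|].
  unfold uniform_circle; rewrite Eh.
  split; [exact UU|split; [apply TT|split; [exact UV|split]]]; intros t.
  - destruct (H t) as [H1 _]; rewrite <- H1, (Cp 0 t); unfold p; generalize (n t) (curve x t).
    intros; vring.
  - apply H.
Qed.

Lemma uniform_circle_covers (x : framed_loop) (h : nat) (p u v : vec3) :
  (1 <= h)%nat -> uniform_circle x h p u v -> covers_round_circle h (curve x).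
Proof.
  intros Hh [UU [VV [UV [C _]]]].
  assert (HPI := PI_RGT_0); assert (Hh' := lt_0_INR h Hh).
  assert (Pw : 0 < INR h * PI) by nra.
  assert (DA : forall t, is_derive (fun t => INR h * PI * t) t (INR h * PI)).
  { intros t; auto_derive; [exact I|ring]. }
  exists p, (/ (INR h * PI)), u, v, (fun t => INR h * PI * t).
  split; [apply Rinv_0_lt_compat, Pw|].
  split; [exact UU|split; [exact VV|split; [exact UV|]]].
  split; [|split; [|split; [intros; ring|exact C]]].
  - apply (smooth_of_derive _ (fun _ => INR h * PI) DA), smooth_of_joint; joint.
  - intros t; replace (Derive _ t) with (INR h * PI);
      [exact Pw|symmetry; exact (is_derive_unique _ _ _ (DA t))].
Qed.

(** * From a circle to constant moment *)

Lemma vderiv_combination (k m : R -> R) (u v : vec3) (t : R) :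
  ex_derive k t -> ex_derive m t ->
  vderiv (fun s => vadd (vscal (k s) u) (vscal (m s) v)) t =
  vadd (vscal (Derive k t) u) (vscal (Derive m t) v).
Proof.
  intros Hk Hm.
  assert (Cu := vsmooth_vdiff _ t (vsmooth_const u)); assert (Cv := vsmooth_vdiff _ t (vsmooth_const v)).
  rewrite (vderiv_add (fun s => vscal (k s) u) (fun s => vscal (m s) v)).
  - rewrite (vderiv_scal k (fun _ => u)), (vderiv_scal m (fun _ => v)), !vderiv_const by assumption.
    unfold vzero; vring.
  - exact (vdiff_scal k (fun _ => u) t Hk Cu).
  - exact (vdiff_scal m (fun _ => v) t Hm Cv).
Qed.

Lemma moment_of_constant_density (x : framed_loop) (k : R) (l : vec3) :
  (forall t, twist_density (curve x) (frame x) t = k) ->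
  (forall t, cross (vderiv (curve x) t) (vderiv (vderiv (curve x)) t) = l) ->
  forall t, moment x t = l.
Proof.
  intros Hk Hl t; unfold moment, total_density.
  rewrite (RInt_eq _ _ _ _ Hk), RInt_const_R, Hk, Hl; destruct l as [[? ?] ?].
  apply vec3_eq; unfold vadd, vscal, vx, vy, vz; cbn; field.
Qed.

(** Unit speed makes the angular speed constant, equal to the inverse of the radius, so that
    [T x T'] is a fixed vector along the axis. *)
Lemma circle_moment (x : framed_loop) (h : nat) :
  (forall t, speed (curve x) t = 1) -> covers_round_circle h (curve x) ->
  constant_twist_rate (curve x) (frame x) -> exists l, forall t, moment x t = l.
Proof.
  intros Hs [p [r [u [v [a [Hr [UU [VV [UV [Sa [Pa [_ C]]]]]]]]]]]] [k Hk].
  assert (Da := fun t => smooth_is_derive a t Sa); assert (Ea := fun t => smooth_ex_derive a t Sa).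
  assert (Dcos : forall t, is_derive (fun s => cos (a s)) t (- (Derive a t * sin (a t)))).
  { intros t; auto_derive; [apply Ea|change (fun x => a x) with a; ring]. }
  assert (Dsin : forall t, is_derive (fun s => sin (a s)) t (Derive a t * cos (a t))).
  { intros t; auto_derive; [apply Ea|change (fun x => a x) with a; ring]. }
  assert (G1 : forall t, vderiv (curve x) t = vscal (r * Derive a t)
             (vadd (vscal (- sin (a t)) u) (vscal (cos (a t)) v))).
  { intros t.
    replace (curve x) with (fun s => vadd p (vadd (vscal (r * cos (a s)) u) (vscal (r * sin (a s)) v)))
      by (apply functional_extensionality; intros s; rewrite C; vring).
    assert (E1 : is_derive (fun s => r * cos (a s)) t (r * - (Derive a t * sin (a t))))
      by (apply is_derive_scal, Dcos).
    assert (E2 : is_derive (fun s => r * sin (a s)) t (r * (Derive a t * cos (a t))))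
      by (apply is_derive_scal, Dsin).
    assert (X1 : ex_derive (fun s => r * cos (a s)) t) by (eexists; exact E1).
    assert (X2 : ex_derive (fun s => r * sin (a s)) t) by (eexists; exact E2).
    assert (Y1 : Derive (fun s : R => r * cos (a s)) t = r * - (Derive a t * sin (a t)))
      by exact (is_derive_unique _ _ _ E1).
    assert (Y2 : Derive (fun s : R => r * sin (a s)) t = r * (Derive a t * cos (a t)))
      by exact (is_derive_unique _ _ _ E2).
    assert (Scos : smooth (fun s => r * cos (a s))) by (apply smooth_of_joint; joint).
    assert (Ssin : smooth (fun s => r * sin (a s))) by (apply smooth_of_joint; joint).
    assert (Su := vsmooth_const u); assert (Sv := vsmooth_const v).
    rewrite vderiv_add, vderiv_const, vderiv_combination, Y1, Y2; try assumption.
    - unfold vzero; vring.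
    - apply vsmooth_vdiff, vsmooth_const.
    - apply vsmooth_vdiff, vsmooth_of_joint; joint. }
  assert (K : forall t, r * Derive a t = 1).
  { intros t; assert (Q := speed_sqr x t); rewrite Hs, G1 in Q.
    assert (P : 0 < r * Derive a t) by (apply Rmult_lt_0_compat; [exact Hr|apply Pa]).
    assert (U := cos_sin_unit (a t)).
    set (q := r * Derive a t) in *; set (c := cos (a t)) in *; set (s := sin (a t)) in *.
    assert (Q' : 1 * 1 = q * q * (s * s * dot u u + c * c * dot v v - 2 * s * c * dot u v)).
    { rewrite Q; clear; clearbody q c s; vunf; ring. }
    rewrite UU, VV, UV in Q'.
    replace (s * s * 1 + c * c * 1 - 2 * s * c * 0) with (c * c + s * s) in Q' by ring.
    rewrite U in Q'; nra. }
  assert (T : vderiv (curve x) = fun t => vadd (vscal (- sin (a t)) u) (vscal (cos (a t)) v)).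
  { apply functional_extensionality; intros t; rewrite G1, K; vring. }
  exists (vscal (/ r) (cross u v)); apply (moment_of_constant_density x k).
  - intros t; rewrite <- twist_density_rate, Hs, Hk; ring.
  - intros t; rewrite T.
    assert (E1 : is_derive (fun s => - sin (a s)) t (- (Derive a t * cos (a t))))
      by (apply (is_derive_opp (fun s => sin (a s))), Dsin).
    assert (Y1 : Derive (fun s : R => - sin (a s)) t = - (Derive a t * cos (a t)))
      by exact (is_derive_unique _ _ _ E1).
    assert (Y2 : Derive (fun s : R => cos (a s)) t = - (Derive a t * sin (a t)))
      by exact (is_derive_unique _ _ _ (Dcos t)).
    rewrite vderiv_combination, Y1, Y2; [|eexists; exact E1|eexists; apply Dcos].
    assert (U := cos_sin_unit (a t)).
    replace (Derive a t) with (/ r) by (specialize (K t); apply (Rmult_eq_reg_l r); [rewrite K; field|]; lra).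
    set (c := cos (a t)) in *; set (s := sin (a t)) in *; clearbody c s.
    transitivity (vscal (/ r * (c * c + s * s)) (cross u v)); [|rewrite U, Rmult_1_r; reflexivity].
    clear; generalize (/ r); intros; vring.
Qed.

(** * Symmetric torus knots *)

Lemma cos_sin_add_IZR_PI (x : R) (n : Z) :
  exists s, (s = if Z.even n then 1 else -1) /\
    cos (x + IZR n * PI) = s * cos x /\ sin (x + IZR n * PI) = s * sin x.
Proof.
  exists (if Z.even n then 1 else -1); split; [reflexivity|].
  assert (S0 : sin (IZR n * PI) = 0) by (apply sin_eq_0_1; exists n; reflexivity).
  assert (C : cos (IZR n * PI) = if Z.even n then 1 else -1).
  { assert (D : forall j, cos (IZR (2 * j) * PI) = 1).
    { intros j; rewrite mult_IZR, Rmult_assoc, cos_2a_sin.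
      rewrite (sin_eq_0_1 (IZR j * PI)) by (exists j; reflexivity); ring. }
    destruct (Z.even n) eqn:En.
    - apply Z.even_spec in En; destruct En as [j ->]; apply D.
    - assert (On : Z.odd n = true) by (rewrite <- Z.negb_even, En; reflexivity).
      apply Z.odd_spec in On; destruct On as [j ->].
      rewrite plus_IZR, Rmult_plus_distr_r, Rmult_1_l, neg_cos, D; reflexivity. }
  rewrite cos_plus, sin_plus, S0, C; split; ring.
Qed.

Lemma smooth_id : smooth (fun t => t).
Proof.
  apply (smooth_of_derive _ (fun _ => 1)).
  - intros t; apply (is_derive_id (K := R_AbsRing)).
  - apply smooth_of_joint; joint.
Qed.

Lemma inv_sqrt_2_sqr : / sqrt 2 * / sqrt 2 = / 2.
Proof. rewrite <- Rinv_mult, sqrt_sqrt by lra; reflexivity. Qed.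

Section TorusKnot.
Variables (h : nat) (k : Z).
Hypothesis Hh : (1 <= h)%nat.
Let w := INR h * PI.
Let m := IZR k * PI.

Let w_pos : 0 < w.
Proof. assert (HPI := PI_RGT_0); assert (H := lt_0_INR h Hh); unfold w; nra. Qed.

Lemma torus_angles (t : R) :
  let a := / 2 * (IZR k + INR h) * PI * t in
  let b := / 2 * (IZR k - INR h) * PI * t in
  a + b = m * t /\ a - b = w * t.
Proof. cbv zeta; unfold m, w; split; field. Qed.

Lemma torus_knot_tangent (t : R) :
  qim (qmul (qmul (qconj (torus_knot h k t)) qi) (torus_knot h k t)) =
  (0, sin (w * t), cos (w * t)).
Proof.
  destruct (torus_angles t) as [_ <-].
  unfold torus_knot, expi.
  set (a := / 2 * (IZR k + INR h) * PI * t); set (b := / 2 * (IZR k - INR h) * PI * t).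
  rewrite sin_minus, cos_minus.
  assert (Ua := cos_sin_unit a); assert (Ub := cos_sin_unit b).
  assert (R2 := inv_sqrt_2_sqr); set (q := / sqrt 2) in *.
  set (ca := cos a) in *; set (sa := sin a) in *; set (cb := cos b) in *; set (sb := sin b) in *.
  clearbody a b ca sa cb sb q.
  unfold qim, qmul, qconj, qi, Cmult, Cconj, Copp, Cminus, Cplus, RtoC, Ci, Re, Im; cbn.
  apply (f_equal2 pair); [apply (f_equal2 pair)|].
  - transitivity (q * q * ((ca * ca + sa * sa) - (cb * cb + sb * sb))); [|rewrite Ua, Ub]; ring.
  - transitivity (2 * (q * q) * (sa * cb - ca * sb)); [|rewrite R2; field]; ring.
  - transitivity (2 * (q * q) * (ca * cb + sa * sb)); [|rewrite R2; field]; ring.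
Qed.

(** The knot turns the frame by [k PI t] from the inward normal towards the axis. *)
Definition torus_frame (t : R) : vec3 :=
  (sin (m * t), cos (m * t) * cos (w * t), - (cos (m * t) * sin (w * t))).

Lemma torus_knot_norm (t : R) :
  Cmod (fst (torus_knot h k t)) = / sqrt 2 /\ Cmod (snd (torus_knot h k t)) = / sqrt 2.
Proof.
  assert (P : 0 < / sqrt 2) by (apply Rinv_0_lt_compat, sqrt_lt_R0; lra).
  assert (U : forall a, Cmod (expi a) = 1).
  { intros a; unfold Cmod, expi; cbn [fst snd].
    replace (cos a ^ 2 + sin a ^ 2) with 1 by (rewrite <- (cos_sin_unit a); ring).
    apply sqrt_1. }
  unfold torus_knot; cbn [fst snd]; rewrite !Cmod_mult, !U, !Cmod_R, Rabs_pos_eq by lra.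
  split; ring.
Qed.

Lemma torus_knot_frame (t : R) :
  vscal (/ qnorm2 (torus_knot h k t))
    (qim (qmul (qmul (qconj (torus_knot h k t)) qj) (torus_knot h k t))) = torus_frame t.
Proof.
  assert (N : qnorm2 (torus_knot h k t) = 1).
  { unfold qnorm2; destruct (torus_knot_norm t) as [-> ->].
    assert (R2 := inv_sqrt_2_sqr); nra. }
  rewrite N, Rinv_1; unfold torus_frame.
  destruct (torus_angles t) as [<- <-].
  unfold torus_knot, expi.
  set (a := / 2 * (IZR k + INR h) * PI * t); set (b := / 2 * (IZR k - INR h) * PI * t).
  rewrite sin_minus, cos_minus, sin_plus, cos_plus.
  assert (Ua := cos_sin_unit a); assert (Ub := cos_sin_unit b).
  assert (R2 := inv_sqrt_2_sqr); set (q := / sqrt 2) in *.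
  set (ca := cos a) in *; set (sa := sin a) in *; set (cb := cos b) in *; set (sb := sin b) in *.
  clear N; clearbody a b ca sa cb sb q.
  unfold vscal, vx, vy, vz, qim, qmul, qconj, qj, Cmult, Cconj, Copp, Cminus, Cplus, RtoC,
    Ci, Re, Im; cbn.
  apply (f_equal2 pair); [apply (f_equal2 pair)|].
  - transitivity (2 * (q * q) * (sa * cb + ca * sb)); [|rewrite R2; field]; ring.
  - transitivity (q * q * (ca * ca - sa * sa + cb * cb - sb * sb)); [ring|].
    rewrite R2; replace (sa * sa) with (1 - ca * ca) by lra.
    replace (sb * sb) with (1 - cb * cb) by lra.
    transitivity (ca * ca * (cb * cb) - (1 - ca * ca) * (1 - cb * cb)); [field|].
    replace (1 - ca * ca) with (sa * sa) by lra; replace (1 - cb * cb) with (sb * sb) by lra; ring.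
  - transitivity (2 * (q * q) * (sb * cb - sa * ca)); [ring|rewrite R2].
    transitivity (sb * cb * (ca * ca + sa * sa) - sa * ca * (cb * cb + sb * sb));
      [rewrite Ua, Ub; field|ring].
Qed.

Lemma vderiv_torus_frame (t : R) :
  vderiv torus_frame t =
  (m * cos (m * t),
   - (m * sin (m * t) * cos (w * t) + w * cos (m * t) * sin (w * t)),
   m * sin (m * t) * sin (w * t) - w * cos (m * t) * cos (w * t)).
Proof.
  apply vec3_eq; cbn; apply is_derive_unique; auto_derive; try exact I; ring.
Qed.

Lemma vderiv_torus_tangent (t : R) :
  vderiv (fun t => (0, sin (w * t), cos (w * t))) t = (0, w * cos (w * t), - (w * sin (w * t))).
Proof. apply vec3_eq; cbn; apply is_derive_unique; auto_derive; try exact I; ring. Qed.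

Lemma torus_moment (x : framed_loop) :
  framed_loop_of_path (torus_knot h k) x ->
  (forall t, speed (curve x) t = 1) /\ forall t, moment x t = (- w, 0, 0).
Proof.
  intros H.
  assert (T : vderiv (curve x) = fun t => (0, sin (w * t), cos (w * t))).
  { apply functional_extensionality; intros t; rewrite (proj1 (H t)); apply torus_knot_tangent. }
  assert (F : frame x = torus_frame).
  { apply functional_extensionality; intros t; rewrite (proj2 (H t)); apply torus_knot_frame. }
  split.
  - intros t; unfold speed, vnorm; rewrite T.
    replace (dot _ _) with 1; [apply sqrt_1|].
    rewrite <- (cos_sin_unit (w * t)); unfold dot, vx, vy, vz; cbn; ring.
  - apply (moment_of_constant_density x (- m)).
    + intros t; unfold twist_density; rewrite T, F, vderiv_torus_frame; unfold torus_frame.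
      assert (Um := cos_sin_unit (m * t)); assert (Uw := cos_sin_unit (w * t)).
      set (cm := cos (m * t)) in *; set (sm := sin (m * t)) in *.
      set (cw := cos (w * t)) in *; set (sw := sin (w * t)) in *.
      transitivity (- m * ((cw * cw + sw * sw) * (cm * cm + sm * sm)));
        [unfold dot, cross, vx, vy, vz; cbn; ring|rewrite Uw, Um; ring].
    + intros t; rewrite T, vderiv_torus_tangent.
      assert (Uw := cos_sin_unit (w * t)).
      apply vec3_eq; unfold cross, vx, vy, vz; cbn; try ring.
      transitivity (- w * (cos (w * t) * cos (w * t) + sin (w * t) * sin (w * t)));
        [ring|rewrite Uw; ring].
Qed.

Lemma torus_coordinates :
  complex_coordinates (fun t => fst (torus_knot h k t)) (fun t => snd (torus_knot h k t)).
Proof.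
  assert (SI := smooth_id).
  assert (CS : forall q c, Csmooth (fun t => Cmult (RtoC q) (expi (c * t)))).
  { intros q c; split; apply smooth_of_joint; cbn; joint. }
  assert (P : 0 < / sqrt 2) by (apply Rinv_0_lt_compat, sqrt_lt_R0; lra).
  assert (R2 := inv_sqrt_2_sqr).
  split; [apply CS|split; [apply CS|split; [|split; [|split; [|split]]]]].
  - (* over a period both coordinates are multiplied by [(-1)^(k+h)], since [k+h] and [k-h]
       have the same parity *)
    assert (X : forall t, exists s, (s = if Z.even (k + Z.of_nat h) then 1 else -1) /\
      fst (torus_knot h k (t + 2)) = Cmult (RtoC s) (fst (torus_knot h k t)) /\
      snd (torus_knot h k (t + 2)) = Cmult (RtoC s) (snd (torus_knot h k t))).
    { intros t.
      destruct (cos_sin_add_IZR_PI (/ 2 * (IZR k + INR h) * PI * t) (k + Z.of_nat h))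
        as [s [Es [C1 S1]]].
      destruct (cos_sin_add_IZR_PI (/ 2 * (IZR k - INR h) * PI * t) (k - Z.of_nat h))
        as [s' [Es' [C2 S2]]].
      assert (Ess : s' = s).
      { rewrite Es, Es', Z.even_sub, Z.even_add; reflexivity. }
      clear Es'; subst s'; exists s; split; [exact Es|].
      rewrite plus_IZR, <- INR_IZR_INZ in C1, S1; rewrite minus_IZR, <- INR_IZR_INZ in C2, S2.
      unfold torus_knot, expi; cbn [fst snd].
      replace (/ 2 * (IZR k + INR h) * PI * (t + 2))
        with (/ 2 * (IZR k + INR h) * PI * t + (IZR k + INR h) * PI) by field.
      replace (/ 2 * (IZR k - INR h) * PI * (t + 2))
        with (/ 2 * (IZR k - INR h) * PI * t + (IZR k - INR h) * PI) by field.
      rewrite C1, S1, C2, S2.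
      split; unfold Cmult, RtoC; cbn [fst snd]; f_equal; ring. }
    destruct (Z.even (k + Z.of_nat h)); [left|right]; split; intros t;
      destruct (X t) as [s [-> [E1 E2]]].
    + rewrite E1; apply Cmult_1_l.
    + rewrite E2; apply Cmult_1_l.
    + rewrite E1; unfold Cmult, RtoC, Copp; cbn [fst snd]; f_equal; ring.
    + rewrite E2; unfold Cmult, RtoC, Copp; cbn [fst snd]; f_equal; ring.
  - intros t [E _]; destruct (torus_knot_norm t) as [N _].
    rewrite E, Cmod_0 in N; lra.
  - unfold l2_inner, RtoC; f_equal.
    + apply (RInt_constant _ (/ 2)); [|field].
      intros t; unfold torus_knot, expi, Cmult, Cconj, RtoC, Re, Im; cbn [fst snd].
      set (a := / 2 * (IZR k + INR h) * PI * t); rewrite <- R2; set (q := / sqrt 2).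
      transitivity (q * q * (cos a * cos a + sin a * sin a)); [ring|].
      rewrite cos_sin_unit; ring.
    + apply (RInt_constant _ 0); [|ring].
      intros t; unfold torus_knot, expi, Cmult, Cconj, RtoC, Re, Im; cbn [fst snd]; ring.
  - unfold l2_inner, RtoC; f_equal.
    + apply (RInt_constant _ (/ 2)); [|field].
      intros t; unfold torus_knot, expi, Cmult, Cconj, RtoC, Re, Im; cbn [fst snd].
      set (a := / 2 * (IZR k - INR h) * PI * t); rewrite <- R2; set (q := / sqrt 2).
      transitivity (q * q * (cos a * cos a + sin a * sin a)); [ring|].
      rewrite cos_sin_unit; ring.
    + apply (RInt_constant _ 0); [|ring].
      intros t; unfold torus_knot, expi, Cmult, Cconj, RtoC, Re, Im; cbn [fst snd]; ring.
  - (* the product of the first coordinate with the conjugate of the second is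
       [exp(i h pi t) / 2] *)
    destruct (cos_sin_add_IZR_PI 0 (2 * Z.of_nat h)) as [s [Es [C2 S2]]].
    rewrite Z.even_mul in Es; cbn in Es; subst s.
    rewrite mult_IZR, <- INR_IZR_INZ, Rplus_0_l in C2, S2.
    rewrite cos_0, Rmult_1_l in C2; rewrite sin_0, Rmult_0_r in S2.
    replace (2 * INR h * PI) with (w * 2) in C2, S2 by (unfold w; ring).
    unfold l2_inner, RtoC; f_equal.
    + apply (RInt_derive_periodic2 (fun t => / (2 * w) * sin (w * t))).
      * intros t; destruct (torus_angles t) as [_ W]; cbv zeta in W.
        auto_derive; [exact I|].
        unfold torus_knot, expi, Cmult, Cconj, RtoC, Re, Im; cbn [fst snd].
        rewrite <- W, cos_minus.
        set (a := / 2 * (IZR k + INR h) * PI * t); set (b := / 2 * (IZR k - INR h) * PI * t).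
        transitivity ((/ 2) * (cos a * cos b + sin a * sin b)); [field; lra|].
        rewrite <- R2; ring.
      * apply smooth_of_joint; cbn; joint.
      * rewrite S2, !Rmult_0_r, sin_0; ring.
    + apply (RInt_derive_periodic2 (fun t => - / (2 * w) * cos (w * t))).
      * intros t; destruct (torus_angles t) as [_ W]; cbv zeta in W.
        auto_derive; [exact I|].
        unfold torus_knot, expi, Cmult, Cconj, RtoC, Re, Im; cbn [fst snd].
        rewrite <- W, sin_minus.
        set (a := / 2 * (IZR k + INR h) * PI * t); set (b := / 2 * (IZR k - INR h) * PI * t).
        transitivity ((/ 2) * (sin a * cos b - cos a * sin b)); [field; lra|].
        rewrite <- R2; ring.
      * apply smooth_of_joint; cbn; joint.
      * rewrite C2, !Rmult_0_r, cos_0; ring.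
Qed.

Definition torus_curve (t : R) : vec3 := (0, - / w * cos (w * t), / w * sin (w * t)).

Lemma vderiv_torus_curve (t : R) : vderiv torus_curve t = (0, sin (w * t), cos (w * t)).
Proof.
  apply vec3_eq; cbn; apply is_derive_unique; auto_derive; try exact I; field; lra.
Qed.

Lemma torus_curve_smooth : vsmooth torus_curve.
Proof. assert (SI := smooth_id); split; [|split]; apply smooth_of_joint; cbn; joint. Qed.

Lemma torus_frame_smooth : vsmooth torus_frame.
Proof. assert (SI := smooth_id); split; [|split]; apply smooth_of_joint; cbn; joint. Qed.

Lemma trig_shift (n : Z) (t : R) :
  cos (IZR n * PI * (t + 2)) = cos (IZR n * PI * t) /\
  sin (IZR n * PI * (t + 2)) = sin (IZR n * PI * t).
Proof.
  destruct (cos_sin_add_IZR_PI (IZR n * PI * t) (2 * n)) as [s [Es [C2 S2]]].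
  rewrite Z.even_mul in Es; cbn in Es; subst s; rewrite mult_IZR in C2, S2.
  replace (IZR n * PI * (t + 2)) with (IZR n * PI * t + 2 * IZR n * PI) by ring.
  rewrite C2, S2; split; ring.
Qed.

Lemma torus_curve_periodic : periodic2 torus_curve.
Proof.
  intros t; unfold torus_curve, w; rewrite INR_IZR_INZ.
  destruct (trig_shift (Z.of_nat h) t) as [-> ->]; reflexivity.
Qed.

Lemma torus_frame_periodic : periodic2 torus_frame.
Proof.
  intros t; unfold torus_frame, w, m; rewrite INR_IZR_INZ.
  destruct (trig_shift (Z.of_nat h) t) as [-> ->], (trig_shift k t) as [-> ->]; reflexivity.
Qed.

Lemma torus_immersion (t : R) : vderiv torus_curve t <> vzero.
Proof.
  rewrite vderiv_torus_curve; intros E.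
  assert (U := cos_sin_unit (w * t)); injection E as E1 E2; rewrite E1, E2 in U; lra.
Qed.

Lemma torus_frame_unit (t : R) : dot (torus_frame t) (torus_frame t) = 1.
Proof.
  assert (Um := cos_sin_unit (m * t)); assert (Uw := cos_sin_unit (w * t)).
  transitivity (sin (m * t) * sin (m * t) + cos (m * t) * cos (m * t)
                * (cos (w * t) * cos (w * t) + sin (w * t) * sin (w * t)));
    [unfold torus_frame, dot, vx, vy, vz; cbn; ring|rewrite Uw; lra].
Qed.

Lemma torus_frame_normal (t : R) : dot (torus_frame t) (vderiv torus_curve t) = 0.
Proof. rewrite vderiv_torus_curve; unfold torus_frame, dot, vx, vy, vz; cbn; ring. Qed.

Definition torus_loop : framed_loop :=
  @FramedLoop torus_curve torus_frame torus_curve_smooth torus_frame_smooth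
    torus_curve_periodic torus_frame_periodic torus_immersion torus_frame_unit
    torus_frame_normal.

Lemma torus_loop_of_knot : framed_loop_of_path (torus_knot h k) torus_loop.
Proof.
  intros t; rewrite torus_knot_tangent, torus_knot_frame; cbn [curve frame torus_loop].
  split; [apply vderiv_torus_curve|reflexivity].
Qed.

Lemma torus_conormal (t : R) :
  conormal torus_curve torus_frame t =
  (- cos (m * t), sin (m * t) * cos (w * t), - (sin (m * t) * sin (w * t))).
Proof.
  assert (Uw := cos_sin_unit (w * t)).
  assert (S : speed torus_curve t = 1).
  { exact (proj1 (torus_moment torus_loop torus_loop_of_knot) t). }
  unfold conormal, tangent; rewrite S, Rinv_1, vderiv_torus_curve; unfold torus_frame.
  apply vec3_eq; unfold cross, vscal, vx, vy, vz; cbn; try ring.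
  transitivity (- (cos (m * t) * (cos (w * t) * cos (w * t) + sin (w * t) * sin (w * t))));
    [ring|rewrite Uw; ring].
Qed.

End TorusKnot.

(** * Every circle with constant twist is a torus knot *)

Lemma orthonormal_expand (u v a b : vec3) :
  dot u u = 1 -> dot v v = 1 -> dot u v = 0 ->
  dot a b = dot a u * dot b u + dot a v * dot b v + dot a (cross u v) * dot b (cross u v).
Proof.
  intros UU VV UV; rewrite triple_mult, UU, VV, UV, (dot_comm v u), UV, (dot_comm u b), (dot_comm v b).
  ring.
Qed.

Lemma orthonormal_decompose (u v a : vec3) :
  dot u u = 1 -> dot v v = 1 -> dot u v = 0 ->
  a = vadd (vscal (dot a u) u) (vadd (vscal (dot a v) v) (vscal (dot a (cross u v)) (cross u v))).
Proof.
  intros UU VV UV.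
  assert (E := fun b => orthonormal_expand u v a b UU VV UV); clear UU VV UV.
  assert (E1 := E (1, 0, 0)); assert (E2 := E (0, 1, 0)); assert (E3 := E (0, 0, 1)); clear E.
  set (c := cross u v) in *; clearbody c.
  generalize dependent (dot a u); generalize dependent (dot a v); generalize dependent (dot a c).
  intros; destruct a as [[? ?] ?], u as [[? ?] ?], v as [[? ?] ?], c as [[? ?] ?].
  apply vec3_eq; vunf; lra.
Qed.

(** With [n] the radial direction and [B] the axis, [y1 = <V, n>] and [y2 = <V, B>] satisfy
    [y1' = D y2] and [y2' = - D y1], and [(y1, y2)] is a periodic unit vector; hence [D] is an
    integral multiple of [PI]. The rotation sends the coordinate axes to [- B], [- u], [v], and
    the twist angle is read off from [(y1, y2)] at time 0. *)
Lemma uniform_circle_torus (x : framed_loop) (h : nat) (p u v : vec3) (D : R) :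
  (1 <= h)%nat -> uniform_circle x h p u v ->
  (forall t, twist_density (curve x) (frame x) t = D) ->
  exists (k : Z) (Hh : (1 <= h)%nat), framed_equiv (torus_loop h k Hh) x.
Proof.
  intros Hh [UU [VV [UV [C T]]]] HD.
  set (w := INR h * PI) in *; set (V := frame x).
  set (B := cross u v).
  assert (SV := frame_smooth x : vsmooth V).
  assert (DV := fun t => vsmooth_vdiff V t SV).
  assert (F1 := frame_unit x : forall t, dot (V t) (V t) = 1).
  assert (FT : forall t, - sin (w * t) * dot (V t) u + cos (w * t) * dot (V t) v = 0).
  { intros t; transitivity (dot (V t) (vderiv (curve x) t)); [|apply frame_normal].
    rewrite T; generalize (V t); clear; intros; vunf; ring. }
  set (n := fun t => vadd (vscal (cos (w * t)) u) (vscal (sin (w * t)) v)).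
  set (y1 := fun t => dot (V t) (n t)); set (y2 := fun t => dot (V t) B).
  assert (Vu : forall t, dot (V t) u = cos (w * t) * y1 t).
  { intros t; specialize (FT t); unfold y1, n; assert (Uw := cos_sin_unit (w * t)).
    set (c := cos (w * t)) in *; set (s := sin (w * t)) in *.
    replace (dot (V t) (vadd (vscal c u) (vscal s v))) with (c * dot (V t) u + s * dot (V t) v)
      by (generalize (V t); clear; clearbody c s; intros; vunf; ring).
    transitivity ((c * c + s * s) * dot (V t) u + s * (- s * dot (V t) u + c * dot (V t) v));
      [rewrite Uw, FT|]; ring. }
  assert (Vv : forall t, dot (V t) v = sin (w * t) * y1 t).
  { intros t; specialize (FT t); unfold y1, n; assert (Uw := cos_sin_unit (w * t)).
    set (c := cos (w * t)) in *; set (s := sin (w * t)) in *.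
    replace (dot (V t) (vadd (vscal c u) (vscal s v))) with (c * dot (V t) u + s * dot (V t) v)
      by (generalize (V t); clear; clearbody c s; intros; vunf; ring).
    transitivity ((c * c + s * s) * dot (V t) v - c * (- s * dot (V t) u + c * dot (V t) v));
      [rewrite Uw, FT|]; ring. }
  assert (Un : forall t, y1 t * y1 t + y2 t * y2 t = 1).
  { intros t; rewrite <- (F1 t), (orthonormal_expand u v (V t) (V t) UU VV UV), Vu, Vv.
    fold B (y2 t); rewrite <- (Rmult_1_l (y1 t * y1 t)), <- (cos_sin_unit (w * t)); ring. }
  assert (TT : forall t, dot (vderiv (curve x) t) (vderiv (curve x) t) = 1).
  { intros t; rewrite T, <- (cos_sin_unit (w * t)).
    set (c := cos (w * t)); set (s := sin (w * t)).
    transitivity (s * s * dot u u + c * c * dot v v - 2 * s * c * dot u v);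
      [clear; clearbody c s; vunf; ring|rewrite UU, VV, UV; ring]. }
  assert (TV : forall t, dot (vderiv (curve x) t) (V t) = 0)
    by (intros t; rewrite dot_comm; apply frame_normal).
  assert (V'V := fun t => dot_derive_unit V t (DV t) F1).
  (* [V'] has no component along [V], and its component along [T x V] is [D] *)
  assert (VD : forall t a, dot a (vderiv (curve x) t) = 0 ->
             dot (vderiv V t) a = D * dot a (cross (vderiv (curve x) t) (V t))).
  { intros t a Ha; rewrite <- (HD t).
    rewrite (orthonormal_expand _ _ (vderiv V t) a (TT t) (F1 t) (TV t)), Ha, V'V.
    unfold twist_density; fold V; ring. }
  assert (Dn : forall t, vderiv n t = vscal w (vderiv (curve x) t)).
  { intros t; rewrite T; unfold n.
    assert (Y1 : is_derive (fun s => cos (w * s)) t (- (w * sin (w * t))))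
      by (auto_derive; [exact I|ring]).
    assert (Y2 : is_derive (fun s => sin (w * s)) t (w * cos (w * t)))
      by (auto_derive; [exact I|ring]).
    rewrite vderiv_combination by (eexists; eassumption).
    assert (Z1 : Derive (fun s : R => cos (w * s)) t = - (w * sin (w * t)))
      by exact (is_derive_unique _ _ _ Y1).
    assert (Z2 : Derive (fun s : R => sin (w * s)) t = w * cos (w * t))
      by exact (is_derive_unique _ _ _ Y2).
    rewrite Z1, Z2; clear; vring. }
  assert (Sn : vsmooth n).
  { assert (SI := smooth_id); assert (Su := vsmooth_const u); assert (Sv := vsmooth_const v).
    apply vsmooth_of_joint; unfold n; joint. }
  assert (D1 : forall t, is_derive y1 t (D * y2 t)).
  { intros t; eapply is_derive_value;
      [exact (is_derive_dot V n t (DV t) (vsmooth_vdiff n t Sn))|].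
    rewrite Dn, VD.
    - replace (dot (V t) (vscal w (vderiv (curve x) t))) with (w * dot (vderiv (curve x) t) (V t))
        by (generalize (V t) (vderiv (curve x) t); clear; intros; vunf; ring).
      rewrite TV, T; unfold y2, B, n; assert (Uw := cos_sin_unit (w * t)).
      set (c := cos (w * t)) in *; set (s := sin (w * t)) in *.
      transitivity (D * ((c * c + s * s) * dot (V t) (cross u v))); [|rewrite Uw; ring].
      generalize (V t); clear; clearbody c s; intros; vunf; ring.
    - rewrite T; unfold n; set (c := cos (w * t)); set (s := sin (w * t)).
      transitivity (c * s * (dot v v - dot u u) + (c * c - s * s) * dot u v);
        [clear; clearbody c s; vunf; ring|rewrite UU, VV, UV; ring]. }
  assert (D2 : forall t, is_derive y2 t (- D * y1 t)).
  { intros t; eapply is_derive_value; [exact (is_derive_dot_const V B t (DV t))|].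
    rewrite VD.
    - rewrite T; unfold y1, B, n.
      set (c := cos (w * t)); set (s := sin (w * t)).
      transitivity (D * (- s * (dot u u * dot (V t) v - dot u v * dot (V t) u)
                         + c * (dot u v * dot (V t) v - dot v v * dot (V t) u)));
        [generalize (V t); clear; clearbody c s; intros; vunf; ring|].
      rewrite UU, VV, UV; generalize (V t); clear; clearbody c s; intros; vunf; ring.
    - rewrite T; unfold B; clear; vunf; ring. }
  assert (H := harmonic_system y1 y2 D D1 D2).
  assert (PV := frame_periodic x 0); rewrite Rplus_0_l in PV; fold V in PV.
  assert (P2 : y2 2 = y2 0) by (unfold y2; rewrite PV; reflexivity).
  assert (P1 : y1 2 = y1 0).
  { unfold y1, n; rewrite PV; unfold w; rewrite INR_IZR_INZ.
    destruct (trig_shift (Z.of_nat h) 0) as [E1 E2].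
    rewrite Rplus_0_l in E1, E2; rewrite E1, E2; reflexivity. }
  assert (C2 : cos (2 * D) = 1).
  { destruct (H 2) as [H1 H2]; rewrite P1 in H1; rewrite P2 in H2; specialize (Un 0).
    rewrite (Rmult_comm 2 D).
    assert (K1 := f_equal (Rmult (y1 0)) H1); assert (K2 := f_equal (Rmult (y2 0)) H2).
    assert (K3 := f_equal (Rmult (cos (D * 2))) Un).
    lra. }
  destruct (cos_double_eq_1 D C2) as [j Hj].
  destruct (angle_of_unit (- y1 0) (y2 0)) as [f [Cf Sf]]; [specialize (Un 0); lra|].
  exists (- j)%Z, Hh, (mtrans (vscal (-1) B, vscal (-1) u, v)), 1, p, (f / 2).
  split; [|split; [lra|]].
  - apply SO3_mtrans.
    assert (BB : dot B B = 1) by (unfold B; rewrite dot_cross_self, UU, VV, UV; ring).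
    assert (Bu : dot B u = 0) by (unfold B; vunf; ring).
    assert (Bv : dot B v = 0) by (unfold B; vunf; ring).
    unfold SO3, det3, row1, row2, row3; cbn [fst snd].
    repeat split.
    + transitivity (dot B B); [clear; clearbody B; vunf; ring|exact BB].
    + transitivity (dot u u); [clear; vunf; ring|exact UU].
    + exact VV.
    + transitivity (dot B u); [clear; clearbody B; vunf; ring|exact Bu].
    + transitivity (- dot B v); [clear; clearbody B; vunf; ring|rewrite Bv; ring].
    + transitivity (- dot u v); [clear; vunf; ring|rewrite UV; ring].
    + transitivity (dot B (cross u v)); [clear; clearbody B; vunf; ring|exact BB].
  - intros t; cbn [curve frame torus_loop]; rewrite torus_conormal by exact Hh.
    replace (2 * (f / 2)) with f by field; rewrite Cf, Sf.
    fold V; split.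
    + rewrite C; unfold torus_curve; fold w; clear; clearbody B; vring.
    + destruct (H t) as [H1 H2].
      rewrite (orthonormal_decompose u v (V t) UU VV UV) at 1; rewrite Vu, Vv; fold B (y2 t).
      rewrite H1, H2; unfold torus_frame; fold w; rewrite Hj, opp_IZR.
      replace (- IZR j * PI * t) with (- (IZR j * PI * t)) by ring.
      rewrite cos_neg, sin_neg; clear; clearbody B.
      generalize (cos (IZR j * PI * t)) (sin (IZR j * PI * t)) (cos (w * t)) (sin (w * t)) (y1 0) (y2 0).
      intros; vring.
Qed.

(** * Characterization of the critical points *)

Lemma critical_characterization (x : framed_loop) :
  length (curve x) = 2 -> critical_point Tw (class x) ->
  (forall t, speed (curve x) t = 1) /\
  (exists h p u v, (1 <= h)%nat /\ uniform_circle x h p u v) /\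
  (forall t, twist_density (curve x) (frame x) t = total_density x / 2).
Proof.
  intros Lx H; assert (Hs := critical_speed x Lx H).
  destruct (critical_moment x Hs H) as [l Hl].
  split; [exact Hs|exact (moment_circle x l Hs Hl)].
Qed.

Theorem theorem5p2 :
  (forall x : framed_loop,
     length (curve x) = 2 ->
     (critical_point Tw (class x) <->
        arclength_parameterized (curve x) /\
        multiply_covered_round_circle (curve x) /\
        constant_twist_rate (curve x) (frame x)))
  /\
  (forall m : M,
     critical_point Tw m <->
       exists (h : nat) (k : Z), (1 <= h)%nat /\ represents (torus_knot h k) m)
  /\
  (forall (h : nat) (k : Z) (t : R), clifford_torus (torus_knot h k t)).
Proof.
  split; [|split].
  - intros x Lx; split.
    + intros H; destruct (critical_characterization x Lx H) as [Hs [[h [p [u [v [Hh Hc]]]]] HD]].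
      split; [exact Hs|split].
      * exists h; split; [exact Hh|exact (uniform_circle_covers x h p u v Hh Hc)].
      * exists (total_density x / 2); intros t.
        rewrite <- (HD t), <- twist_density_rate, Hs; ring.
    + intros [Hs [[h [_ Hc]] Hk]].
      destruct (circle_moment x h Hs Hc Hk) as [l Hl]; exact (critical_of_moment x l Hs Hl).
  - intros m; split.
    + intros H; destruct (length2_representative m) as [x [Lx Ex]]; subst m.
      destruct (critical_characterization x Lx H) as [_ [[h [p [u [v [Hh Hc]]]]] HD]].
      destruct (uniform_circle_torus x h p u v _ Hh Hc HD) as [k [Hh' E]].
      exists h, k; split; [exact Hh|split; [exact (torus_coordinates h k Hh)|]].
      exists (torus_loop h k Hh'); split; [apply torus_loop_of_knot|apply class_eq, E].
    + intros [h [k [Hh [_ [x [Hx <-]]]]]].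
      destruct (torus_moment h k x Hx) as [Hs Hm]; exact (critical_of_moment x _ Hs Hm).
  - intros h k t; exact (torus_knot_norm h k t).
Qed.
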